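(* Assume $\rho_0\in\mathcal{P}(\mathbb{R})$ and $v_0:\mathbb{R}\to\mathbb{R}$ is continuous with $\int_{\mathbb{R}}v_0^2\,d\rho_0<\infty$. Then there is $\eta\in\mathcal{P}(\Gamma)$ which satisfies all of the following properties. (i) $\rho_0=e_{0\#}\eta$. (ii) For each $0<s\le t$ and $\gamma,\xi\in\operatorname{supp}(\eta)$, $$\frac{1}{t}|\gamma(t)-\xi(t)|\le\frac{1}{s}|\gamma(s)-\xi(s)|.$$ (iii) For $\eta$-almost every $\gamma\in\Gamma$, $\gamma:[0,\infty)\to\mathbb{R}$ is absolutely continuous. (iv) There is a Borel function $v:\mathbb{R}\times(0,\infty)\to\mathbb{R}$ such that for $\eta$-almost every $\gamma\in\Gamma$, $$\dot\gamma(t)=v(\gamma(t),t)\quad\text{for a.e. } t>0.$$ (v) For almost every $t\in(0,\infty)$ and each $h\in C_b(\mathbb{R})$, $$\int_{\Gamma}\dot\gamma(t)h(\gamma(t))\,d\eta(\gamma)=\int_{\Gamma}v_0(\gamma(0))h(\gamma(t))\,d\eta(\gamma).$$ (vi) For almost every $0\le s\le t<\infty$, $$\int_{\Gamma}\dot\gamma(t)^2\,d\eta(\gamma)\le\int_{\Gamma}\dot\gamma(s)^2\,d\eta(\gamma)<\infty.$$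
   Context: $\mathcal{P}(Y)$ denotes the Borel probability measures on a topological space $Y$. $C_b(\mathbb{R})$ is the space of bounded continuous functions $\mathbb{R}\to\mathbb{R}$. $\Gamma:=C([0,\infty))$ is the space of continuous paths $\gamma:[0,\infty)\to\mathbb{R}$ with the topology of local uniform convergence (uniform convergence on compact subsets). For $t\ge0$, $e_t:\Gamma\to\mathbb{R}$ is the evaluation map $e_t(\gamma)=\gamma(t)$, and $e_{t\#}\eta\in\mathcal{P}(\mathbb{R})$ is the push-forward, $\int_{\mathbb{R}}f\,d(e_{t\#}\eta)=\int_\Gamma f(\gamma(t))\,d\eta(\gamma)$. $\operatorname{supp}(\eta)$ is the (closed) support of $\eta$. $\dot\gamma(t)$ is the derivative of $\gamma$ at $t$, where it exists. ''Absolutely continuous on $[0,\infty)$'' means absolutely continuous on every compact subinterval of $[0,\infty)$. ''Almost every'' for times refers to Lebesgue measure; ''for almost every $0\le s\le t<\infty$'' means that there is a Lebesgue-null set $N\subset[0,\infty)$ such that the assertion holds for all $s,t\in[0,\infty)\setminus N$ with $s\le t$. *)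

(* Defs.v *)
From HB Require Import structures.
From mathcomp Require Import all_boot all_order all_algebra.
From mathcomp Require Import all_classical all_reals all_analysis.

Set Implicit Arguments.
Unset Strict Implicit.
Unset Printing Implicit Defensive.

Import Order.TTheory GRing.Theory Num.Theory.
Import numFieldTopology.Exports numFieldNormedType.Exports.

Local Open Scope classical_set_scope.
Local Open Scope ring_scope.

(* [0, +oo[ as a type; a set coerces to the type of its elements, which carries
   the topology induced by that of R. *)
Definition halfline (R : realType) : set R := `[0, +oo[.
Arguments halfline : clear implicits.

Definition Gamma (R : realType) : Type := continuousType (halfline R) R.

Section Gamma_structure.
Variable R : realType.

HB.instance Definition _ := Choice.on (Gamma R).

Definition Gamma_fun (g : Gamma R) : {family compact, halfline R -> R} :=
  (g : continuousType (halfline R) R) : halfline R -> R.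

HB.instance Definition _ :=
  Topological.copy (Gamma R) (initial_topology Gamma_fun).

Let cst0_continuous : continuous (cst 0 : halfline R -> R).
Proof. exact: cst_continuous. Qed.

HB.instance Definition _ := isPointed.Build (Gamma R)
  (mkcts cst0_continuous : continuousType (halfline R) R).

HB.instance Definition _ := Measurable.copy (Gamma R)
  (g_sigma_algebraType (@open (Gamma R))).

End Gamma_structure.

Lemma max0_halfline (R : realType) (t : R) : Num.max t 0 \in halfline R.
Proof. by rewrite mem_setE in_itv /= andbT le_max lexx orbT. Qed.

(* The path g as a function on R, extended by the constant g(0) to t < 0; only
   its values for t >= 0 and its derivative for t > 0 are meaningful. *)
Definition path_at (R : realType) (g : Gamma R) (t : R) : R :=
  Gamma_fun g (exist _ (Num.max t 0) (max0_halfline t)).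

Definition eval_at (R : realType) (t : R) (g : Gamma R) : R := path_at g t.

(* Equal to 0 (the default value of lim) where the path is not derivable. *)
Definition velocity (R : realType) (g : Gamma R) (t : R) : R :=
  derive1 (path_at g) t.

Definition measure_support (R : realType) (eta : set (Gamma R) -> \bar R) :
    set (Gamma R) :=
  [set g | forall U : set (Gamma R), open U -> U g -> (0 < eta U)%E].

Definition absolutely_continuous_on (R : realType) (a b : R) (f : R -> R) :=
  forall e : R, 0 < e -> exists2 d : R, 0 < d &
    forall (n : nat) (l r : 'I_n -> R),
      (forall i, [/\ a <= l i, l i <= r i & r i <= b]) ->
      trivIset [set: 'I_n] (fun i => `]l i, r i[%classic) ->
      \sum_(i < n) (r i - l i) < d ->
      \sum_(i < n) `|f (r i) - f (l i)| < e.

Definition locally_absolutely_continuous (R : realType) (f : R -> R) :=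
  forall a b : R, 0 <= a -> a <= b -> absolutely_continuous_on a b f.

(* Main.v *)
Require Import Defs.
From HB Require Import structures.
From mathcomp Require Import all_boot all_order all_algebra.
From mathcomp Require Import all_classical all_reals all_analysis.
From mathcomp Require Import measurable_realfun ring lra.
Import Order.TTheory GRing.Theory Num.Theory.
Import numFieldTopology.Exports numFieldNormedType.Exports.
Set Implicit Arguments.
Unset Strict Implicit.
Unset Printing Implicit Defensive.
Local Open Scope classical_set_scope.
Local Open Scope ring_scope.

(** Particles are labelled by the mass to their left: if X0 is the quantile
    function of rho0 then rho0 is the law of X0 under the uniform law U on
    ]0, 1[, and the particle m starts at X0 m with velocity V0 m = v0 (X0
    m). Free motion X0 + t V0 does not stay nondecreasing in m; sticky
    collisions replace it by its L2 projection on the nondecreasing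
    functions. With F and G primitives of X0 and V0, this projection X t is
    the left derivative of the convex envelope C t of the potential W t = F
    + t G. The measure eta is the law under U of the path t |-> X t m.

    For s <= t one has W s = (s/t) W t + (1 - s/t) F, and F is convex.
    Comparing supporting lines of W t and of F gives at once that (X t m' -
    X t m) / t is nonincreasing in t ([flow_ratio]), which passes to the
    support of eta and bounds the paths there, and that the gap W - C satisfies
    gap s <= (s/t) gap t ([gap_le]). By the first fact particles that meet
    stay together, so for s > 0 the position at time t >= s is a Borel
    function of the position at time s ([flow_mapE]), and the velocity at
    time t is a Borel function v of position and time ([velocity_fieldE]).

    The path of m is Lipschitz, the constant being the largest slope of G
    over intervals around m; so it is absolutely continuous, and by
    Rademacher and Fubini almost all paths are derivable at almost every t.
    By Cauchy-Schwarz that constant is at most 2 (M (V0 ^ 2) m)^(1/2), where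
    M is the Hardy-Littlewood maximal operator. The weak (1,1) inequality
    makes the square root integrable, so the difference quotients of the
    paths have an integrable majorant ([flow_increment_dominated]).

    The end point of a sublevel set {X t < c} is a limit of points at which
    W t almost touches C t ([contact]), so by [gap_le] the same holds for W
    s and C s with s <= t. As X s - X0 - s V0 is the derivative of C s - W
    s, its integral over {X t < c} is the same for all c, hence zero
    ([residual_sublevel]). Subtracting two times and dividing, the velocity
    at time t minus V0 is orthogonal to every indicator of {X t < c}, then
    by a Dynkin argument to every bounded Borel function of X t
    ([velocity_projection]). So the velocity at time t is the conditional
    expectation given X t of V0. Since bounded Borel functions of X t are
    bounded Borel functions of X s, it is also the conditional expectation
    given X t of the velocity at time s, and conditional expectations do not
    increase the energy ([projection_energy_le]). *)

(** * Left derivatives of the convex envelope of a potential *)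

Section flow_def.
Context {R : realType}.
Variables F G : R -> R.
Implicit Types a b c m s t x y : R.

Definition potential (t m : R) := F m + t * G m.

(** Slopes of lines through a point of the graph to the left of m that stay
    below the graph to the right of m.  Their supremum is the left derivative
    at m of the convex envelope of the potential. *)
Definition slopes (t m : R) : set R :=
  [set c | exists2 a, 0 < a < m & forall b, m <= b < 1 ->
    c * (b - a) <= potential t b - potential t a].

(** The left derivative of the convex envelope, expressed without the envelope
    so that the potentials at two times can be compared directly. *)
Definition flow (t m : R) : R := sup (slopes t m).

End flow_def.

Section flow_theory.
Context {R : realType}.
Variables F G X0 K : R -> R.
Implicit Types a b c m s t x y : R.
Local Notation W := (potential F G).
Local Notation S := (slopes F G).
Local Notation X := (flow F G).

(** Convexity of H, given by a choice D of slopes of supporting lines. *)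
Definition subgradient (H D : R -> R) := forall x y, 0 < x < 1 -> 0 < y < 1 ->
  H x + D x * (y - x) <= H y.

Definition slope_bound (H L : R -> R) := forall a m b, 0 < a -> a <= m ->
  m <= b -> b < 1 -> `|H b - H a| <= L m * (b - a).

Hypothesis FX0 : subgradient F X0.
Hypothesis GK : slope_bound G K.

Lemma subgradient_nondecreasing (H D : R -> R) : subgradient H D ->
  forall x y, 0 < x -> x <= y -> y < 1 -> D x <= D y.
Proof.
move=> HD x y x0; rewrite le_eqVlt => /predU1P[->//|xy] y1.
have h1 := HD x y; have h2 := HD y x.
have {}h1 := h1 ltac:(lra) ltac:(lra); have {}h2 := h2 ltac:(lra) ltac:(lra).
have xy0 : 0 < y - x by lra.
by rewrite -(ler_pM2r xy0); lra.
Qed.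

Lemma potential_lower t a m b : 0 < a -> a <= m -> m <= b -> b < 1 ->
  (X0 a - `|t| * K m) * (b - a) <= W t b - W t a.
Proof.
move=> a0 am mb b1; rewrite /potential.
have h1 := FX0 (x := a) (y := b) ltac:(lra) ltac:(lra).
have h2 := GK a0 am mb b1.
have : `|t * (G b - G a)| <= `|t| * (K m * (b - a)).
  by rewrite normrM ler_wpM2l.
by rewrite ler_norml => /andP[h3 _]; lra.
Qed.

Lemma potential_upper t a m b : 0 < a -> a <= m -> m <= b -> b < 1 ->
  W t b - W t a <= (X0 b + `|t| * K m) * (b - a).
Proof.
move=> a0 am mb b1; rewrite /potential.
have h1 := FX0 (x := b) (y := a) ltac:(lra) ltac:(lra).
have h2 := GK a0 am mb b1.
have : `|t * (G b - G a)| <= `|t| * (K m * (b - a)).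
  by rewrite normrM ler_wpM2l.
by rewrite ler_norml => /andP[_ h3]; lra.
Qed.

Lemma slopes_nonempty t m a : 0 < a -> a < m -> m < 1 ->
  S t m (X0 a - `|t| * K m).
Proof.
move=> a0 am m1; exists a; first by lra.
by move=> b mb; apply: potential_lower; lra.
Qed.

Lemma slopes_ub t m : 0 < m < 1 -> ubound (S t m) (X0 m + `|t| * K m).
Proof.
move=> m01 c [a a0m h]; have h1 := h m ltac:(lra).
have h2 := @potential_upper t a m m ltac:(lra) ltac:(lra) ltac:(lra) ltac:(lra).
have ma0 : 0 < m - a by lra.
by rewrite -(ler_pM2r ma0); lra.
Qed.

Lemma slopes_has_sup t m : 0 < m < 1 -> has_sup (S t m).
Proof.
move=> m01; split.
  exists (X0 (m / 2) - `|t| * K m); apply: slopes_nonempty; lra.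
by exists (X0 m + `|t| * K m); exact: slopes_ub.
Qed.

Lemma flow_le t m : 0 < m < 1 -> X t m <= X0 m + `|t| * K m.
Proof.
move=> m01; apply: ge_sup; first by case: (slopes_has_sup t m01).
exact: slopes_ub.
Qed.

Lemma slopes_le_flow t m c : 0 < m < 1 -> S t m c -> c <= X t m.
Proof. by move=> m01 Sc; apply: ub_le_sup => //; case: (slopes_has_sup t m01). Qed.

Lemma lt_flow t m c : 0 < m < 1 -> c < X t m -> S t m c.
Proof.
move=> m01 /(sup_gt (proj1 (slopes_has_sup t m01)))[c' [a a0m h] cc'].
exists a => // b mb; apply: le_trans (h b mb).
by apply: ler_wpM2r; lra.
Qed.

Lemma flow_lt t m c a : 0 < m < 1 -> X t m < c -> 0 < a < m ->
  exists2 b, m <= b < 1 & W t b - W t a < c * (b - a).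
Proof.
move=> m01 Xc a0m; apply: contrapT => h.
have /(slopes_le_flow m01) : S t m c; last by rewrite leNgt Xc.
exists a => // b mb; rewrite leNgt; apply/negP => bad; apply: h.
by exists b.
Qed.

Lemma flow_nondecreasing t m m' : 0 < m -> m <= m' -> m' < 1 ->
  X t m <= X t m'.
Proof.
move=> m0 mm' m'1; apply: ge_sup.
  by apply: (proj1 (slopes_has_sup t _)); lra.
move=> c [a a0m h]; apply: slopes_le_flow; first by lra.
by exists a => [|b mb]; [lra|apply: h; lra].
Qed.

(** Changing t by h tilts every chord across m by at most K m * |h|, so the
    admissible slopes move by no more than that. *)
Lemma flow_lipschitz s t m : 0 < m < 1 ->
  `|X t m - X s m| <= K m * `|t - s|.
Proof.
move=> m01.
have key s' t' : X t' m <= X s' m + K m * `|t' - s'|.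
  apply: ge_sup; first by apply: (proj1 (slopes_has_sup t' m01)).
  move=> c [a a0m h].
  suff /(slopes_le_flow m01) : S s' m (c - K m * `|t' - s'|) by lra.
  exists a => // b mb; have {h} := h b mb; rewrite /potential.
  have h2 := @GK a m b ltac:(lra) ltac:(lra) ltac:(lra) ltac:(lra).
  have : `|(t' - s') * (G b - G a)| <= `|t' - s'| * (K m * (b - a)).
    by rewrite normrM ler_wpM2l.
  by rewrite ler_norml => /andP[_ h3]; lra.
have h1 := key s t; have h2 := key t s; rewrite distrC in h2.
by rewrite ler_norml; apply/andP; split; lra.
Qed.

Lemma flow0 m : 0 < m < 1 ->
  (forall c, c < X0 m -> exists2 a, 0 < a < m & c <= X0 a) -> X 0 m = X0 m.
Proof.
move=> m01 lc; apply/eqP; rewrite eq_le; apply/andP; split.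
  by have := flow_le 0 m01; rewrite normr0; lra.
rewrite leNgt; apply/negP => Xm.
have [a a0m ha] := lc (2^-1 * (X 0 m + X0 m)) ltac:(lra).
have := slopes_le_flow m01 (@slopes_nonempty 0 m a ltac:(lra) ltac:(lra) ltac:(lra)).
by rewrite normr0 mul0r; lra.
Qed.

Lemma locally_lipschitz_continuous (H : R -> R) (x L r : R) : 0 < r ->
  (forall y, `|y - x| < r -> `|H y - H x| <= L * `|y - x|) ->
  {for x, continuous H}.
Proof.
move=> r0 HL; apply/cvgrPdistC_lt => e e0.
pose d := Num.min r (e / (`|L| + 1)).
have L0 : 0 < `|L| + 1 by rewrite ltr_wpDl.
have d0 : 0 < d by rewrite /d lt_min r0 divr_gt0.
exists d => //= y; rewrite /ball/= distrC /d lt_min ltr_pdivlMr// => /andP[yr yd].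
apply: le_lt_trans (HL _ yr) _; apply: le_lt_trans yd.
rewrite mulrC; apply: ler_wpM2l => //.
by have := ler_norm L; lra.
Qed.

Lemma subgradient_continuous (H D : R -> R) : subgradient H D ->
  forall x, 0 < x < 1 -> {for x, continuous H}.
Proof.
move=> HD x x01.
pose r := 2^-1 * Num.min x (1 - x).
have r0 : 0 < r by rewrite mulr_gt0// lt_min; lra.
have rx : r < x by rewrite /r; case: (leP x (1 - x)); lra.
have rx1 : r < 1 - x by rewrite /r; case: (leP x (1 - x)); lra.
apply: (@locally_lipschitz_continuous _ _ (`|D (x - r)| + `|D (x + r)|) r) => //.
move=> y; rewrite ltr_norml => /andP[h1 h2].
have nd := subgradient_nondecreasing HD.
have a1 := nd (x - r) y ltac:(lra) ltac:(lra) ltac:(lra).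
have a2 := nd y (x + r) ltac:(lra) ltac:(lra) ltac:(lra).
have a3 := nd (x - r) x ltac:(lra) ltac:(lra) ltac:(lra).
have a4 := nd x (x + r) ltac:(lra) ltac:(lra) ltac:(lra).
have b1 := HD x y ltac:(lra) ltac:(lra).
have b2 := HD y x ltac:(lra) ltac:(lra).
have n1 : `|D y| <= `|D (x - r)| + `|D (x + r)|.
  rewrite ler_norml; have := ler_norm (D (x + r)); have := ler_norm (- D (x - r)).
  have := normr_ge0 (D (x + r)); have := normr_ge0 (D (x - r)).
  rewrite normrN; lra.
have n2 : `|D x| <= `|D (x - r)| + `|D (x + r)|.
  rewrite ler_norml; have := ler_norm (D (x + r)); have := ler_norm (- D (x - r)).
  have := normr_ge0 (D (x + r)); have := normr_ge0 (D (x - r)).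
  rewrite normrN; lra.
have {n1} : `|D y * (y - x)| <= (`|D (x - r)| + `|D (x + r)|) * `|y - x|.
  by rewrite normrM ler_wpM2r.
have {n2} : `|D x * (y - x)| <= (`|D (x - r)| + `|D (x + r)|) * `|y - x|.
  by rewrite normrM ler_wpM2r.
by rewrite !ler_norml; lra.
Qed.

Lemma slope_bound_continuous (H L : R -> R) : slope_bound H L ->
  forall x, 0 < x < 1 -> {for x, continuous H}.
Proof.
move=> HL x x01.
apply: (@locally_lipschitz_continuous _ _ (L x) (Num.min x (1 - x))).
  by rewrite lt_min; lra.
move=> y; rewrite lt_min !ltr_norml => h.
have [yx|xy] := leP y x.
  by rewrite distrC (distrC y) (@ger0_norm _ (x - y)); [apply: HL; lra|lra].
by rewrite (@gtr0_norm _ (y - x)); [apply: HL; lra|lra].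
Qed.

Lemma potential_continuous t x : 0 < x < 1 -> {for x, continuous (W t)}.
Proof.
move=> x01; apply: continuousD; first exact: subgradient_continuous FX0 _ x01.
apply: (@continuousM _ _ (cst t)); first exact: cvg_cst.
exact: slope_bound_continuous GK _ x01.
Qed.

(** A line that lies strictly below the graph to the right of m also does so
    to the right of nearby m' < m, by continuity of the potential at m. *)
Lemma flow_left_continuous t m c : 0 < m < 1 -> c < X t m ->
  \forall m' \near m^'-, c <= X t m'.
Proof.
move=> m01 cX.
have [a a0m h] := @lt_flow t m (2^-1 * (c + X t m)) m01 ltac:(lra).
pose f b := W t b - W t a - c * (b - a).
have fm : {for m, continuous f}.
  apply: continuousB; last first.
    apply: (@continuousM _ _ (cst c)); first exact: cvg_cst.
    by apply: continuousB; [exact: cvg_id|exact: cvg_cst].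
  by apply: continuousB; [exact: potential_continuous|exact: cvg_cst].
have fm0 : 0 < f m.
  have := h m ltac:(lra).
  have : 0 < (X t m - c) * (m - a) by rewrite mulr_gt0; lra.
  by rewrite /f; lra.
have : \forall b \near m, 0 < f b by exact: (cvgr_gt (f m) fm).
move=> [r/= r0 hr]; near=> m'.
have m'm : m' < m by near: m'; exact: nbhs_left_lt.
have m'a : a < m' by near: m'; apply: nbhs_left_gt; lra.
have m'r : m - r < m' by near: m'; apply: nbhs_left_gt; lra.
apply: slopes_le_flow; first by lra.
exists a; first by lra.
move=> b m'b; have [mb|bm] := leP m b.
  apply: le_trans (h b ltac:(lra)); apply: ler_wpM2r; lra.
have /hr : ball m r b by rewrite /ball/= ltr_norml; lra.
by rewrite /f; lra.
Unshelve. all: by end_near. Qed.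

(** If c is strictly between the values of the flow at m and m', the line of
    slope c supports the graph at some point in between: a minimiser over
    [m, m'] of the potential minus c x is a minimiser over the whole interval,
    because every point outside has a value above that of some point inside. *)
Lemma separator t m m' c : 0 < m -> m <= m' -> m' < 1 ->
  X t m < c -> c < X t m' ->
  exists2 mu, m <= mu < m' &
    forall x, 0 < x < 1 -> W t mu - c * mu <= W t x - c * x.
Proof.
move=> m0 mm' m'1 Xm Xm'.
have [a a0m' ha] := @lt_flow t m' (2^-1 * (c + X t m')) ltac:(lra) ltac:(lra).
have {}ha b : m' <= b < 1 -> W t a - c * a < W t b - c * b.
  move=> m'b; have h1 := ha b m'b.
  have : 0 < (X t m' - c) * (b - a) by rewrite mulr_gt0; lra.
  by lra.
have hb x : 0 < x < m -> exists2 b, m <= b < 1 & W t b - c * b < W t x - c * x.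
  move=> /(@flow_lt t m c x ltac:(lra) Xm)[b b1 h]; exists b => //; lra.
have [mu] : exists2 mu, mu \in `[m, m'] & forall x, x \in `[m, m'] ->
    W t mu - c * mu <= W t x - c * x.
  apply: (@EVT_min _ (fun x => W t x - c * x)) => //.
  apply: continuous_in_subspaceT => x; rewrite inE/= in_itv/= => xmm'.
  apply: continuousB; first by apply: potential_continuous; lra.
  by apply: (@continuousM _ _ (cst c)); [exact: cvg_cst|exact: cvg_id].
rewrite in_itv/= => mumm' hmu.
have {}hmu x : m <= x <= m' -> W t mu - c * mu <= W t x - c * x.
  by move=> xmm'; apply: hmu; rewrite in_itv.
have mua : W t mu - c * mu <= W t a - c * a.
  have [ma|am] := leP m a; first by apply: hmu; lra.
  have [b mb1 hba] := hb a ltac:(lra).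
  have [bm'|m'b] := leP b m'; first by have := hmu b ltac:(lra); lra.
  by have := ha b ltac:(lra); lra.
have mum' : mu < m'.
  rewrite lt_neqAle; apply/andP; split; last lra.
  by apply/eqP => e; have := ha m' ltac:(lra); rewrite e in mua; lra.
exists mu; first lra.
move=> x x01; have [xm|mx] := ltP x m.
  have [b mb1 hbx] := hb x ltac:(lra).
  have [bm'|m'b] := leP b m'; first by have := hmu b ltac:(lra); lra.
  by have := ha b ltac:(lra); lra.
have [xm'|m'x] := leP x m'; first by apply: hmu; lra.
by have := ha x ltac:(lra); lra.
Qed.

Lemma potential_rescale s t a b : 0 < s -> s <= t ->
  W s b - W s a = s / t * (W t b - W t a) + (1 - s / t) * (F b - F a).
Proof.
move=> s0 st; rewrite /potential.
have t0 : t != 0 by lra.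
by field.
Qed.

(** Take points be <= al at which lines of slopes just above X t m and just
    below X t m' support W t.  Since W s is a convex combination of W t and F,
    the same combinations of slopes of W t and of F are slopes of W s at these
    points, and those of F are ordered as X0 be <= X0 al. *)
Lemma flow_ratio s t m m' : 0 < s -> s <= t -> 0 < m -> m <= m' -> m' < 1 ->
  t^-1 * (X t m' - X t m) <= s^-1 * (X s m' - X s m).
Proof.
move=> s0 st m0 mm' m'1; have t0 : 0 < t by lra.
suff H : s / t * (X t m' - X t m) <= X s m' - X s m.
  by rewrite -(ler_pM2l s0) !mulrA divff ?mul1r//; lra.
have st0 : 0 < s / t by rewrite divr_gt0.
have st1 : s / t <= 1 by rewrite ler_pdivrMr// mul1r.
have nds := flow_nondecreasing s m0 mm' m'1.
have := flow_nondecreasing t m0 mm' m'1.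
rewrite le_eqVlt => /predU1P[<-|Xtlt]; first by rewrite subrr mulr0; lra.
apply/ler_addgt0Pr => /= e0 e00.
(* The first bound keeps the slopes X t m + e and X t m' - e ordered. *)
pose e := Num.min (4^-1 * (X t m' - X t m)) (4^-1 * e0).
have ee0 : 0 < e by rewrite /e lt_min; lra.
have e1 : e <= 4^-1 * (X t m' - X t m) by rewrite /e ge_min lexx.
have e2 : e <= 4^-1 * e0 by rewrite /e ge_min lexx orbT.
have [be be01 hbe] := @separator t m m' (X t m + e) m0 mm' m'1 ltac:(lra) ltac:(lra).
have [al al01 hal] := @separator t m m' (X t m' - e) m0 mm' m'1 ltac:(lra) ltac:(lra).
have beal : be <= al.
  have h1 := hbe al ltac:(lra); have h2 := hal be ltac:(lra).
  have h3 : 0 < X t m' - e - (X t m + e) by lra.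
  by rewrite -subr_ge0 -(pmulr_rge0 _ h3); lra.
have mono : X0 be <= X0 al.
  by apply: (subgradient_nondecreasing FX0); lra.
move: st0 st1; rewrite (lock (s / t)); set k := locked _ => k0 k1.
have A1 : k * (X t m' - e) + (1 - k) * X0 al <= X s m'.
  apply: slopes_le_flow; first lra.
  exists al; first lra.
  move=> b mb; rewrite (potential_rescale _ _ s0 st) (lock (s / t)) -/k.
  have h1 := hal b ltac:(lra).
  have h2 := FX0 (x := al) (y := b) ltac:(lra) ltac:(lra).
  have : 0 <= k * (W t b - W t al - (X t m' - e) * (b - al)).
    by apply: mulr_ge0; lra.
  have : 0 <= (1 - k) * (F b - F al - X0 al * (b - al)).
    by apply: mulr_ge0; lra.
  lra.
have A2 : X s m <= k * (X t m + e) + (1 - k) * X0 be.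
  apply: ge_sup; first by apply: (proj1 (slopes_has_sup s _)); lra.
  move=> c [a a0m h]; have {h} := h be ltac:(lra).
  have ba : 0 < be - a by lra.
  rewrite (potential_rescale _ _ s0 st) (lock (s / t)) -/k.
  move=> h; rewrite -(ler_pM2r ba); apply: le_trans h _.
  have h1 := hbe a ltac:(lra).
  have h2 := FX0 (x := be) (y := a) ltac:(lra) ltac:(lra).
  have : 0 <= k * (W t a - W t be - (X t m + e) * (a - be)).
    by apply: mulr_ge0; lra.
  have : 0 <= (1 - k) * (F a - F be - X0 be * (a - be)).
    by apply: mulr_ge0; lra.
  lra.
have A3 : (1 - k) * X0 be <= (1 - k) * X0 al.
  by apply: ler_wpM2l; lra.
have A4 : k * e <= e by rewrite ler_piMl; lra.
lra.
Qed.

(** * The envelope, its gap, and the end points of sublevel sets *)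

Variable B : R.
Hypothesis GB : forall x, 0 < x < 1 -> `|G x| <= B.

(** Minus the Legendre transform of the potential. *)
Definition dual t c : R := inf [set W t x - c * x | x in [set x | 0 < x < 1]].

(** The envelope evaluated on its supporting line of slope X t m; that this
    line is the highest one at m is [le_envelope]. *)
Definition envelope t m : R := dual t (X t m) + X t m * m.

Local Notation C := envelope.

Lemma dual_has_lbound t c : has_lbound [set W t x - c * x | x in [set x | 0 < x < 1]].
Proof.
exists (F 2^-1 - `|X0 2^-1| - `|t| * B - `|c|) => _ [x /= x01 <-].
have h1 := FX0 (x := 2^-1) (y := x) ltac:(lra) ltac:(lra).
have : `|t * G x| <= `|t| * B by rewrite normrM ler_wpM2l// GB.
have : `|X0 2^-1 * (x - 2^-1)| <= `|X0 2^-1|.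
  by rewrite normrM ler_piMr// ler_norml; lra.
have : `|c * x| <= `|c| by rewrite normrM ler_piMr// ler_norml; lra.
by rewrite !ler_norml /potential; lra.
Qed.

Lemma dual_le t c x : 0 < x < 1 -> dual t c <= W t x - c * x.
Proof.
move=> x01; apply: ge_inf; first exact: dual_has_lbound.
by exists x.
Qed.

Lemma dual_ge t c z : (forall x, 0 < x < 1 -> z <= W t x - c * x) ->
  z <= dual t c.
Proof.
move=> h; apply: lb_le_inf.
  by exists (W t 2^-1 - c * 2^-1), 2^-1 => //=; lra.
by move=> _ [x /= /h + <-].
Qed.

Lemma envelope_le t m : 0 < m < 1 -> C t m <= W t m.
Proof. by move=> m01; have := dual_le t (X t m) m01; rewrite /envelope; lra. Qed.

(** Lines below the graph are at m no higher than the one of slope X t m.  To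
    compare the values for the slopes c and X t m, test the latter at a point y:
    on one side of m the change of slope only helps; for y on the other side,
    a chord from y across m of slope close to X t m leads to the good side. *)
Lemma le_envelope t m c : 0 < m < 1 -> dual t c + c * m <= C t m.
Proof.
move=> m01; rewrite /envelope -lerBlDr; apply: dual_ge => y y01.
have dl := dual_le t c.
have [cX|Xc|cX] := ltgtP c (X t m); last first.
- by rewrite cX addrK; exact: dual_le.
- have [my|ym] := leP m y.
    have : c * (y - m) >= X t m * (y - m) by apply: ler_wpM2r; lra.
    by have := dl y y01; lra.
  suff : forall e, 0 < e -> dual t c + c * m <= W t y - X t m * (y - m) + e.
    by move=> /ler_addgt0Pr; lra.
  move=> e e0.
  pose c' := Num.min c (X t m + e).
  have c'c : c' <= c by rewrite ge_min lexx.
  have c'e : c' <= X t m + e by rewrite ge_min lexx orbT.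
  have Xc' : X t m < c' by rewrite lt_min; lra.
  have [b mb hb] := @flow_lt t m c' y m01 Xc' ltac:(lra).
  have := dl b ltac:(lra).
  have : 0 <= (c - c') * (b - m) by apply: mulr_ge0; lra.
  have : 0 <= (X t m + e - c') * (m - y) by apply: mulr_ge0; lra.
  have : e * (m - y) <= e by rewrite ler_piMr; lra.
  lra.
- have [my|ym] := leP m y; last first.
    have : c * (y - m) >= X t m * (y - m).
      by rewrite -subr_ge0 -mulrBl -mulrNN mulr_ge0; lra.
    by have := dl y y01; lra.
  suff : forall e, 0 < e -> dual t c + c * m <= W t y - X t m * (y - m) + e.
    by move=> /ler_addgt0Pr; lra.
  move=> e e0.
  pose c' := Num.max c (X t m - e).
  have c'c : c <= c' by rewrite le_max lexx.
  have c'e : X t m - e <= c' by rewrite le_max lexx orbT.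
  have Xc' : c' < X t m by rewrite gt_max; lra.
  have [a a0m ha] := @lt_flow t m c' m01 Xc'.
  have {}ha := ha y ltac:(lra).
  have := dl a ltac:(lra).
  have : 0 <= (c' - c) * (m - a) by apply: mulr_ge0; lra.
  have : 0 <= (c' - (X t m - e)) * (y - m) by apply: mulr_ge0; lra.
  have : e * (y - m) <= e by rewrite ler_piMr; lra.
  lra.
Qed.

Lemma envelope_subgradient t : subgradient (C t) (X t).
Proof.
move=> x y x01 y01; have := le_envelope t (X t x) y01.
have -> : C t x = dual t (X t x) + X t x * x by [].
by lra.
Qed.

Definition gap t m : R := W t m - C t m.

Lemma gap_ge0 t m : 0 < m < 1 -> 0 <= gap t m.
Proof. by move=> /(envelope_le t); rewrite /gap; lra. Qed.

(** Combine the line of slope X t m below W t with the supporting line of F at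
    m.  The result is a line below W s, and its distance to W s at m is s / t
    times the gap at time t, since the line of F touches F. *)
Lemma gap_le s t m : 0 < s -> s <= t -> 0 < m < 1 ->
  gap s m <= s / t * gap t m.
Proof.
move=> s0 st m01; have t0 : 0 < t by lra.
have st0 : 0 < s / t by rewrite divr_gt0.
have st1 : s / t <= 1 by rewrite ler_pdivrMr// mul1r.
have rescale a b := potential_rescale a b s0 st.
move: st0 st1 rescale; move: (s / t) => k k0 k1 rescale.
pose c := k * X t m + (1 - k) * X0 m.
have := le_envelope s c m01.
suff : W s m - k * gap t m - c * m <= dual s c by rewrite /gap; lra.
apply: dual_ge => x x01.
have := rescale m x.
have h1 := FX0 m01 x01.
have h2 := dual_le t (X t m) x01.
have : 0 <= (1 - k) * (F x - F m - X0 m * (x - m)) by apply: mulr_ge0; lra.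
have : 0 <= k * (W t x - X t m * x - dual t (X t m)) by apply: mulr_ge0; lra.
rewrite /c /gap /envelope; lra.
Qed.

Definition sublevel_end t c : R := sup [set m | 0 < m < 1 /\ X t m < c].

Local Notation al := sublevel_end.

Lemma sublevel_has_ubound t c : has_ubound [set m | 0 < m < 1 /\ X t m < c].
Proof. by exists 1 => x [x01 _]; lra. Qed.

Lemma sublevel_end_ge0 t c : 0 <= al t c.
Proof.
rewrite /al; set E := [set _ | _].
have [->|/set0P[x [x01 xc]]] := eqVneq E set0; first by rewrite sup0.
apply: (@le_trans _ _ x); first by lra.
by apply: ub_le_sup => //; exact: sublevel_has_ubound.
Qed.

Lemma sublevel_end_le1 t c : al t c <= 1.
Proof.
rewrite /al; set E := [set _ | _].
have [->|/set0P E0] := eqVneq E set0; first by rewrite sup0.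
by apply: ge_sup => // x [x01 _]; lra.
Qed.

Lemma sublevel_end_gt t c m : 0 < m < 1 -> al t c < m -> c <= X t m.
Proof.
move=> m01; rewrite leNgt => am; apply/negP => Xc; move: am.
rewrite ltNge => /negP; apply; apply: ub_le_sup => //.
exact: sublevel_has_ubound.
Qed.

Lemma sublevel_end_lt t c m : 0 < m -> m < al t c ->
  exists2 m', m < m' < 1 & X t m' < c.
Proof.
move=> m0 mal; have E0 : [set m | 0 < m < 1 /\ X t m < c] !=set0.
  apply/set0P/eqP => E0; move: mal; rewrite /al E0 sup0; lra.
by have [m1 [m101 Xm1] hm1] := sup_gt E0 mal; exists m1 => //; lra.
Qed.

Lemma flow_lt_sublevel_end t c m : 0 < m < 1 -> m < al t c -> X t m < c.
Proof.
move=> m01 /(sublevel_end_lt (proj1 (andP m01)))[m' mm' Xc].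
by apply: le_lt_trans Xc; apply: flow_nondecreasing; lra.
Qed.

(** Suppose that the gap is at least e within distance d of the end point.  A
    line of slope c' slightly below c that supports the graph is a positive
    distance below the envelope outside this neighbourhood, because the slopes
    of the envelope are less than c' to the left of it and at least c to the
    right of it; inside it is at least e below the graph.  It could be raised. *)
Lemma contact t c (d e : R) : 0 < d -> 0 < e ->
  exists2 x, 0 < x < 1 & `|x - al t c| < d /\ gap t x < e.
Proof.
move=> d0 e0; apply: contrapT => noc.
have := sublevel_end_ge0 t c; have := sublevel_end_le1 t c.
have := @sublevel_end_gt t c; have := @sublevel_end_lt t c.
move: noc; set a := al t c => noc below above a1 a0.
have {}noc x : 0 < x < 1 -> a - d < x < a + d -> e <= gap t x.
  move=> x01 xal; rewrite leNgt; apply/negP => gx; apply: noc.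
  by exists x => //; split=> //; rewrite ltr_norml; lra.
(* The slope c' and a margin k on the left of a - d. *)
have [c' [cc' [k k0 left]]] : exists c', c' < c /\ exists2 k, 0 < k &
    forall z, 0 < z < 1 -> z <= a - d -> dual t c' + k <= C t z - c' * z.
  have [h|h] := leP (a - d) 0.
    by exists (c - 1); split; [lra|exists 1 => // z z0 h1; lra].
  have [m1 hm1 Xm1] := below (a - d) h ltac:(lra).
  have m101 : 0 < m1 < 1 by lra.
  exists (2^-1 * (X t m1 + c)); split; first lra.
  exists ((2^-1 * (X t m1 + c) - X t m1) * (m1 - (a - d))).
    by rewrite mulr_gt0; lra.
  move=> z z01 zal.
  have h1 := envelope_subgradient t m101 z01.
  have h2 := le_envelope t (2^-1 * (X t m1 + c)) m101.
  have : 0 <= (2^-1 * (X t m1 + c) - X t m1) * (a - d - z).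
    by rewrite mulr_ge0; lra.
  lra.
(* The same line has a margin on the right of a + d. *)
have [k' k'0 right] : exists2 k', 0 < k' &
    forall z, 0 < z < 1 -> a + d <= z -> dual t c' + k' <= C t z - c' * z.
  have [h|h] := leP 1 (a + d).
    by exists 1 => // z z0 h1; lra.
  pose m2 := a + 2^-1 * d.
  have m201 : 0 < m2 < 1 by rewrite /m2; lra.
  have Xm2 : c <= X t m2 by apply: above => //; rewrite /m2; lra.
  exists ((X t m2 - c') * (a + d - m2)); first by rewrite mulr_gt0 /m2//; lra.
  move=> z z01 zal.
  have h1 := envelope_subgradient t m201 z01.
  have h2 := le_envelope t c' m201.
  have : 0 <= (X t m2 - c') * (z - (a + d)) by rewrite mulr_ge0; lra.
  lra.
pose k0' := Num.min e (Num.min k k').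
have : dual t c' + k0' <= dual t c'.
  apply: dual_ge => z z01.
  have h1 : k0' <= k by rewrite /k0' !ge_min lexx !orbT.
  have h2 : k0' <= k' by rewrite /k0' !ge_min lexx !orbT.
  have h3 : k0' <= e by rewrite /k0' !ge_min lexx.
  have h4 := envelope_le t z01.
  have [zl|zl] := leP z (a - d); first by have := left z z01 zl; lra.
  have [zr|zr] := leP (a + d) z; first by have := right z z01 zr; lra.
  have := noc z z01 ltac:(lra); have := le_envelope t c' z01; rewrite /gap; lra.
have : 0 < k0' by rewrite /k0' !lt_min; lra.
lra.
Qed.
End flow_theory.

(** * The uniform law on the unit interval *)

Section uniform_on_R.
Variable R : realType.

(** The uniform probability carried by the Borel structure that R bears as a
    real type, so that it can be pushed forward by functions on R. *)
Definition unif (A : set R) : \bar R := uniform_prob (@ltr01 R) A.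

Let unif0 : unif set0 = 0%E. Proof. exact: measure0. Qed.

Let unif_ge0 A : (0 <= unif A)%E. Proof. exact: measure_ge0. Qed.

Let unif_additive : semi_sigma_additive unif.
Proof. exact: (@measure_semi_sigma_additive _ _ _ (uniform_prob (@ltr01 R))). Qed.

HB.instance Definition _ := isMeasure.Build _ R R unif unif0 unif_ge0 unif_additive.

Let unif_setT : unif setT = 1%E.
Proof. exact: (@probability_setT _ _ _ (uniform_prob (@ltr01 R))). Qed.

HB.instance Definition _ := Measure_isProbability.Build _ R R unif unif_setT.

End uniform_on_R.

Section unit_interval.
Context {R : realType}.
Local Notation mu := (@lebesgue_measure R).
Local Notation U := (@unif R).

Lemma uniformE (A : set R) : measurable A -> U A = mu (A `&` `[0, 1]).
Proof.
move=> mA; rewrite /unif /uniform_prob integral_uniform_pdf.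
rewrite (eq_integral (cst 1%E)).
  by rewrite integral_cst ?mul1e//; exact: measurableI.
move=> x; rewrite inE => -[_]; rewrite /= in_itv/= /uniform_pdf => ->.
by rewrite subr0 invr1.
Qed.

Lemma uniform_oc (a b : R) : 0 <= a -> a <= b -> b <= 1 ->
  U `]a, b] = (b - a)%:E.
Proof.
move=> a0 ab b1; rewrite uniformE//.
rewrite setIidl.
  have [<-|nab] := eqVneq a b; first by rewrite set_itvoc0 measure0 subrr.
  rewrite lebesgue_measure_itv/= lte_fin lt_neqAle nab ab/=.
  by rewrite EFinB.
by move=> x /=; rewrite !in_itv/=; lra.
Qed.

Lemma uniform_le (A : set R) : measurable A -> (U A <= mu A)%E.
Proof.
move=> mA; rewrite uniformE//; apply: le_measure; rewrite ?inE//.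
exact: measurableI.
Qed.

Lemma uniform_out : U (~` `]0, 1[) = 0%E.
Proof.
rewrite uniformE//; last exact: measurableC.
apply/eqP; rewrite eq_le measure_ge0 andbT.
rewrite (@le_trans _ _ (mu ([set 0] `|` [set 1])))//.
  apply: le_measure; rewrite ?inE.
  - by apply: measurableI => //; exact: measurableC.
  - exact: measurableU.
  - move=> x [/=]; rewrite !in_itv/= => /negP; rewrite negb_and -!leNgt.
    move=> /orP[?|?] ?; [left|right]; apply/eqP; rewrite eq_le; lra.
apply: le_trans (measureU2 _ _ _) _ => //.
by rewrite [X in (X + _)%E]lebesgue_measure_set1 [X in (_ + X)%E]lebesgue_measure_set1 adde0.
Qed.

Lemma ae_uniform (P : R -> Prop) : (forall x, 0 < x < 1 -> P x) ->
  {ae U, forall x, P x}.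
Proof.
move=> h; exists (~` `]0, 1[); split => //.
- exact: measurableC.
- exact: uniform_out.
- by move=> x /=; apply: contra_not; rewrite in_itv/=; exact: h.
Qed.

Lemma Rintegral_oc_split (f : R -> R) (a b c : R) : a <= b -> b <= c ->
  U.-integrable `]a, c] (EFin \o f) ->
  \int[U]_(x in `]a, c]) f x =
  \int[U]_(x in `]a, b]) f x + \int[U]_(x in `]b, c]) f x.
Proof.
move=> ab bc fi.
have E : `]a, c]%classic = `]a, b] `|` `]b, c].
  apply/seteqP; split => x /=; rewrite !in_itv/=.
    by have [xb|bx] := leP x b; [left|right]; lra.
  by case; lra.
rewrite E Rintegral_setU// -?E//.
by apply/disj_setPS => x [] /=; rewrite !in_itv/=; lra.
Qed.

Definition nondecr01 (D : R -> R) :=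
  forall x y, 0 < x -> x <= y -> y < 1 -> D x <= D y.

Lemma nondecr01_measurable (D : R -> R) (A : set R) : nondecr01 D ->
  measurable A -> A `<=` `]0, 1[ -> measurable_fun A D.
Proof.
move=> Dnd mA A01; apply: (measurable_funS _ A01) => //.
apply: (measurability (@RGenOInfty.G R)) => [|/= _ [_] [c] -> <-].
  exact: RGenOInfty.measurableE.
apply: is_interval_measurable => x y /=.
rewrite !in_itv/= !andbT => -[x01 Dx] [y01 Dy] z /andP[xz zy]; split; rewrite in_itv/=; first lra.
by rewrite andbT; apply: (lt_le_trans Dx); apply: Dnd; lra.
Qed.

Lemma nondecr01_integrable (D : R -> R) (a b : R) : nondecr01 D ->
  0 < a -> b < 1 -> U.-integrable `]a, b] (EFin \o D).
Proof.
move=> Dnd a0 b1.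
have sub : `]a, b]%classic `<=` `]0 : R, 1[.
  by move=> x /=; rewrite !in_itv/=; lra.
apply: measurable_bounded_integrable => //.
- by rewrite (le_lt_trans (probability_le1 _ _)) ?ltry.
- exact: nondecr01_measurable.
exists (`|D a| + `|D b|); split; first exact: num_real.
move=> M DM x /=; rewrite in_itv/= => /andP[ax xb].
have h1 : D a <= D x by apply: Dnd; lra.
have h2 : D x <= D b by apply: Dnd; lra.
rewrite ler_norml; have := ler_norm (D b); have := ler_norm (- D a).
have := normr_ge0 (D a); have := normr_ge0 (D b).
by rewrite normrN; lra.
Qed.

Lemma Rintegral_oc_le (f g : R -> R) (a b : R) :
  U.-integrable `]a, b] (EFin \o f) -> U.-integrable `]a, b] (EFin \o g) ->
  (forall x, a < x -> x <= b -> f x <= g x) ->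
  \int[U]_(x in `]a, b]) f x <= \int[U]_(x in `]a, b]) g x.
Proof.
move=> fi gi h; apply: le_Rintegral => // x /=; rewrite in_itv/= => /andP[? ?].
exact: h.
Qed.

Lemma Rintegral_oc_cst (a b k : R) : 0 <= a -> a <= b -> b <= 1 ->
  \int[U]_(x in `]a, b]) k = k * (b - a).
Proof.
move=> a0 ab b1; rewrite Rintegral_cst//; congr (_ * _).
by have /(congr1 fine) := uniform_oc a0 ab b1.
Qed.

Lemma integrable_oc_cst (a b k : R) : U.-integrable `]a, b] (EFin \o cst k).
Proof.
apply: measurable_bounded_integrable => //.
  by rewrite (le_lt_trans (probability_le1 _ _)) ?ltry.
by exists `|k|; split; [exact: num_real|move=> M kM x _ /=; exact: ltW].
Qed.

(** The error is at most the length of the interval times the increase of D,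
    and it is additive, so halving the interval n times divides this bound by
    2 ^ n. *)
Lemma subgradient_integral (H D : R -> R) (a b : R) : subgradient H D ->
  0 < a -> a <= b -> b < 1 -> \int[U]_(x in `]a, b]) D x = H b - H a.
Proof.
move=> HD a0 ab b1; have Dnd := subgradient_nondecreasing HD.
pose E x y := \int[U]_(z in `]x, y]) D z - (H y - H x).
have E1 x y : 0 < x -> x <= y -> y < 1 -> `|E x y| <= (D y - D x) * (y - x).
  move=> x0 xy y1.
  have Di := nondecr01_integrable Dnd x0 y1.
  have h1 : D x * (y - x) <= \int[U]_(z in `]x, y]) D z.
    rewrite -(Rintegral_oc_cst (D x) (ltW x0) xy (ltW y1)).
    apply: Rintegral_oc_le => //.
      exact: integrable_oc_cst.
    by move=> z xz zy; apply: Dnd; lra.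
  have h2 : \int[U]_(z in `]x, y]) D z <= D y * (y - x).
    rewrite -(Rintegral_oc_cst (D y) (ltW x0) xy (ltW y1)).
    apply: Rintegral_oc_le => //.
      exact: integrable_oc_cst.
    by move=> z xz zy; apply: Dnd; lra.
  have h3 := HD x y ltac:(lra) ltac:(lra).
  have h4 := HD y x ltac:(lra) ltac:(lra).
  rewrite /E ler_norml; clear E; move: h1 h2; move: (Rintegral _ _ _) => I h1 h2.
  by lra.
have E2 n : forall x y, 0 < x -> x <= y -> y < 1 ->
    `|E x y| <= (D y - D x) * (y - x) / 2 ^+ n.
  elim: n => [|n IH] x y x0 xy y1; first by rewrite expr0 divr1; exact: E1.
  pose c := 2^-1 * (x + y).
  have -> : E x y = E x c + E c y.
    rewrite /E (@Rintegral_oc_split _ x c y); first ring.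
    - by rewrite /c; lra.
    - by rewrite /c; lra.
    - exact: nondecr01_integrable.
  have h1 := IH x c x0 ltac:(rewrite /c; lra) ltac:(rewrite /c; lra).
  have h2 := IH c y ltac:(rewrite /c; lra) ltac:(rewrite /c; lra) y1.
  apply: le_trans (ler_normD _ _) _; apply: le_trans (lerD h1 h2) _.
  have -> : c - x = 2^-1 * (y - x) by rewrite /c; field.
  have -> : y - c = 2^-1 * (y - x) by rewrite /c; field.
  by rewrite exprS invfM le_eqVlt; apply/orP; left; apply/eqP; ring.
suff : E a b = 0 by rewrite /E => /eqP; rewrite subr_eq0 => /eqP.
apply/eqP; rewrite -normr_le0; apply/ler_addgt0Pr => /= e e0; rewrite add0r.
have [n] : exists n, (D b - D a) * (b - a) / e < 2 ^+ n.
  exists (Num.truncn `|(D b - D a) * (b - a) / e|).+1.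
  apply: le_lt_trans (ler_norm _) _; apply: lt_le_trans (truncnS_gt _) _.
  by rewrite -natrX ler_nat ltnW// ltn_expl.
rewrite ltr_pdivrMr// => hn.
apply: le_trans (E2 n a b a0 ab b1) _.
by rewrite ler_pdivrMr ?exprn_gt0//; apply/ltW; rewrite [e * _]mulrC.
Qed.
End unit_interval.

(** * Square roots of functions of weak type *)

Section weak_type.
Context {R : realType} d (T : measurableType d) (P : probability T R).

(** On the n-th dyadic scale the truncated square root grows by at most 2 ^ n
    on a set of measure C / 4 ^ n, which sums to a geometric series. *)
Lemma sqrt_integrable_of_weak_type (H : T -> R) (C : R) :
  measurable_fun setT H -> (forall x, 0 <= H x) -> 0 <= C ->
  (forall n, (P [set x | (4 ^+ n < H x)%R] <= (C / 4 ^+ n)%:E)%E) ->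
  P.-integrable setT (fun x => (Num.sqrt (H x))%:E).
Proof.
move=> mH H0 C0 weak.
have mS : measurable_fun setT (fun x => Num.sqrt (H x)).
  by apply: measurableT_comp mH; apply: continuous_measurable_fun; exact: sqrt_continuous.
pose g n x := Num.min (Num.sqrt (H x)) (2 ^+ n).
have mg n : measurable_fun setT (g n).
  by apply: measurable_minr => //; exact: measurable_cst.
have g0 n x : 0 <= g n x by rewrite /g le_min sqrtr_ge0 exprn_ge0.
have mset n : measurable [set x | 4 ^+ n < H x].
  have -> : [set x | 4 ^+ n < H x] = setT `&` H @^-1` `]4 ^+ n, +oo[.
    by rewrite setTI; apply/seteqP; split => x /=; rewrite in_itv/= andbT.
  exact: mH.
have gS n x : g n.+1 x <= g n x + 2 ^+ n * \1_[set x | 4 ^+ n < H x] x.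
  rewrite indicE; have [Hx|Hx] := ltP (4 ^+ n) (H x).
    rewrite mem_set//= mulr1 /g exprS.
    have p0 : 0 < 2 ^+ n :> R by rewrite exprn_gt0.
    case: (leP (Num.sqrt (H x)) (2 ^+ n)) => h1;
      case: (leP (Num.sqrt (H x)) (2 * 2 ^+ n)) => h2; lra.
  rewrite memNset/= ?mulr0 ?addr0; last by rewrite /= ltNge Hx.
  have sH : Num.sqrt (H x) <= 2 ^+ n.
    have -> : 2 ^+ n = Num.sqrt (4 ^+ n) :> R.
      rewrite -[LHS]ger0_norm ?exprn_ge0// -sqrtr_sqr -exprM mulnC exprM.
      by congr (Num.sqrt (_ ^+ _)); rewrite expr2; lra.
    exact: ler_wsqrtr.
  by rewrite /g (min_idPl sH) (min_idPl _)// (le_trans sH)// ler_weXn2l// ler1n.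
pose I n := (\int[P]_x (g n x)%:E)%E.
have In n : (I n <= (1 + 2 * C * (1 - 2 ^- n))%:E)%E.
  elim: n => [|n IH].
    rewrite expr0 invr1 subrr mulr0 addr0.
    apply: (@le_trans _ _ (\int[P]_x (cst 1%E x))%E); last first.
      by rewrite integral_cst// mul1e probability_le1.
    apply: ge0_le_integral => //.
    - by move=> x _; rewrite lee_fin.
    - exact/measurable_EFinP.
    - by move=> x _; rewrite lee_fin /g expr0 ge_min lexx orbT.
  apply: (@le_trans _ _ (I n + (2 ^+ n)%:E * (C / 4 ^+ n)%:E)%E); last first.
    apply: le_trans (leeD2r _ IH) _; rewrite -EFinM -EFinD lee_fin.
    have -> : 4 ^+ n = 2 ^+ n * 2 ^+ n :> R.
      by rewrite -exprMn; congr (_ ^+ _); lra.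
    have : 2 ^+ n != 0 :> R by rewrite expf_neq0.
    rewrite exprS; move: (2 ^+ n) => p p0.
    by rewrite le_eqVlt; apply/orP; left; apply/eqP; field.
  apply: (@le_trans _ _ (\int[P]_x ((g n x)%:E +
      (2 ^+ n)%:E * (\1_[set x | (4 ^+ n < H x)%R] x)%:E))%E).
    apply: ge0_le_integral => //.
    - by move=> x _; rewrite lee_fin.
    - exact/measurable_EFinP.
    - apply: emeasurable_funD; first exact/measurable_EFinP.
      by apply: emeasurable_funM => //; exact/measurable_EFinP/measurable_indic.
    - by move=> x _; rewrite -EFinM -EFinD lee_fin.
  rewrite ge0_integralD//; last 3 first.
  - by move=> x _; rewrite lee_fin.
  - exact/measurable_EFinP.
  - by apply: emeasurable_funM => //; exact/measurable_EFinP/measurable_indic.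
  rewrite leeD2l// ge0_integralZl//; last first.
    exact/measurable_EFinP/measurable_indic.
  by rewrite integral_indic// setIT; apply: lee_wpmul2l => //; exact: weak.
apply/integrableP; split; first exact/measurable_EFinP.
rewrite (eq_integral (fun x => (Num.sqrt (H x))%:E)); last first.
  by move=> x _; rewrite /= ger0_norm// sqrtr_ge0.
apply: (@le_lt_trans _ _ (1 + 2 * C)%:E); last by rewrite ltry.
have gcvg x : limn (fun n => (g n x)%:E) = (Num.sqrt (H x))%:E.
  apply/cvg_lim => //; apply: cvg_near_cst.
  exists (Num.truncn (Num.sqrt (H x))).+1 => // n /= hn.
  congr (_%:E); apply/min_idPl/ltW; apply: lt_le_trans (truncnS_gt _) _.
  by rewrite -natrX ler_nat (leq_trans hn)// ltnW// ltn_expl.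
under eq_integral do rewrite -gcvg.
rewrite monotone_convergence//; last 3 first.
- by move=> n; exact/measurable_EFinP.
- by move=> n x _; rewrite lee_fin.
- move=> x _ m n mn; rewrite lee_fin /g le_min !ge_min lexx/=.
  by rewrite (ler_weXn2l _ mn) ?orbT// ler1n.
apply: lime_le.
  apply: ereal_nondecreasing_is_cvgn => m n mn; apply: ge0_le_integral => //.
  - by move=> x _; rewrite lee_fin.
  - exact/measurable_EFinP.
  - exact/measurable_EFinP.
  - move=> x _; rewrite lee_fin /g le_min !ge_min lexx/=.
    by rewrite (ler_weXn2l _ mn) ?orbT// ler1n.
apply: nearW => n; apply: le_trans (In n) _; rewrite lee_fin.
have : 0 <= 2 * C * 2 ^- n by rewrite !mulr_ge0// invr_ge0 exprn_ge0.
lra.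
Qed.

End weak_type.

(** * Primitives of the initial data *)

Section initial_data.
Context {R : realType}.
Local Notation mu := (@lebesgue_measure R).
Local Notation U := (@unif R).
Variables X0 V0 : R -> R.

Hypothesis X0nd : nondecr01 X0.
Hypothesis mV0 : measurable_fun setT V0.
Hypothesis V0_L2 : (\int[U]_x ((V0 x) ^+ 2)%:E < +oo)%E.
Hypothesis V0_loc : forall x y : R, 0 < x -> x <= y -> y < 1 ->
  exists L : R, forall z, x <= z <= y -> `|V0 z| <= L.

(** The base point 1/2 is used because X0 may fail to be integrable near 0
    and near 1. *)
Definition primX (m : R) : R := if 2^-1 <= m
  then \int[U]_(x in `]2^-1, m]) X0 x else - \int[U]_(x in `]m, 2^-1]) X0 x.

Definition primV (m : R) : R := \int[U]_(x in `]0, m]) V0 x.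

Lemma primXB (a b : R) : 0 < a -> a <= b -> b < 1 ->
  primX b - primX a = \int[U]_(x in `]a, b]) X0 x.
Proof.
move=> a0 ab b1; rewrite /primX.
have I x y : 0 < x -> y < 1 -> U.-integrable `]x, y] (EFin \o X0).
  exact: nondecr01_integrable.
case: leP => hb; case: leP => ha.
- by rewrite (@Rintegral_oc_split _ X0 2^-1 a b)//; [lra|apply: I; lra].
- by rewrite (@Rintegral_oc_split _ X0 a 2^-1 b)//; [lra|lra|apply: I; lra].
- by lra.
- by rewrite (@Rintegral_oc_split _ X0 a b 2^-1)//; [lra|lra|apply: I; lra].
Qed.

Lemma primX_subgradient : subgradient primX X0.
Proof.
move=> x y x01 y01; have [xy|/ltW yx] := leP x y.
  have := @primXB x y ltac:(lra) xy ltac:(lra).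
  suff : X0 x * (y - x) <= \int[U]_(z in `]x, y]) X0 z by lra.
  rewrite -(@Rintegral_oc_cst _ x y); [|lra..].
  apply: Rintegral_oc_le; first exact: integrable_oc_cst.
    by apply: nondecr01_integrable => //; lra.
  by move=> z xz zy; apply: X0nd; lra.
have := @primXB y x ltac:(lra) yx ltac:(lra).
suff : \int[U]_(z in `]y, x]) X0 z <= X0 x * (x - y) by lra.
rewrite -(@Rintegral_oc_cst _ y x); [|lra..].
apply: Rintegral_oc_le; last 2 first.
- exact: integrable_oc_cst.
- by move=> z xz zy; apply: X0nd; lra.
by apply: nondecr01_integrable => //; lra.
Qed.

Lemma V0_integrable : U.-integrable setT (EFin \o V0).
Proof.
have i1 : U.-integrable setT (EFin \o (fun x => 1 + V0 x ^+ 2)).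
  apply: (@integrableD _ _ _ U setT measurableT (cst 1%E) (fun x => (V0 x ^+ 2)%:E)).
    by apply: finite_measure_integrable_cst.
  apply/integrableP; split.
    by apply/measurable_EFinP; exact: measurable_funX.
  rewrite (eq_integral (fun x => (V0 x ^+ 2)%:E))// => x _.
  by rewrite /= ger0_norm// sqr_ge0.
apply: le_integrable i1 => //; first exact/measurable_EFinP.
move=> x _ /=; rewrite lee_fin [X in _ <= X]ger0_norm; last first.
  by rewrite addr_ge0// sqr_ge0.
rewrite ler_norml; have := sqr_ge0 (V0 x - 1); have := sqr_ge0 (V0 x + 1).
by rewrite !expr2; lra.
Qed.

Lemma V0_integrable_oc (a b : R) : U.-integrable `]a, b] (EFin \o V0).
Proof. by apply: integrableS V0_integrable. Qed.

Lemma normV0_integrable : U.-integrable setT (EFin \o (fun x => `|V0 x|)).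
Proof. exact: (integrable_norm V0_integrable). Qed.

Lemma primVB (a b : R) : 0 <= a -> a <= b ->
  primV b - primV a = \int[U]_(x in `]a, b]) V0 x.
Proof.
move=> a0 ab; rewrite /primV (@Rintegral_oc_split _ V0 0 a b)//.
  by rewrite addrAC subrr add0r.
exact: V0_integrable_oc.
Qed.

Definition normV : R := \int[U]_x `|V0 x|.

Lemma int_normV_le (a b : R) :
  \int[U]_(x in `]a, b]) `|V0 x| <= normV.
Proof.
apply: fine_le.
- by apply: integrable_fin_num => //; apply: integrableS normV0_integrable.
- by apply: integrable_fin_num => //; exact: normV0_integrable.
apply: ge0_subset_integral => //.
by apply/measurable_EFinP/measurableT_comp.
Qed.

Lemma normV_ge0 : 0 <= normV. Proof. exact: Rintegral_ge0. Qed.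

Lemma primVB_le (a b : R) : 0 <= a -> a <= b ->
  `|primV b - primV a| <= \int[U]_(x in `]a, b]) `|V0 x|.
Proof.
by move=> a0 ab; rewrite primVB// le_normr_Rintegral//; exact: V0_integrable_oc.
Qed.

Lemma primV_bounded x : 0 < x < 1 -> `|primV x| <= normV.
Proof.
move=> x01; have := @primVB_le 0 x ltac:(lra) ltac:(lra).
have -> : primV 0 = 0 by rewrite /primV set_itvoc0 Rintegral_set0.
by rewrite subr0 => /le_trans; apply; exact: int_normV_le.
Qed.

(** The local Lipschitz constant of the flow in time, by [flow_lipschitz]. *)
Definition max_slope (m : R) : R := sup [set s | exists ab : R * R,
  [/\ 0 < ab.1 <= m, m <= ab.2 < 1, ab.1 < ab.2 &
      s = `|primV ab.2 - primV ab.1| / (ab.2 - ab.1)]].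

(** Short chords see only values of V0 on a compact part of ]0, 1[, where V0
    is bounded; long chords have slope at most the L1 norm of V0 over their
    length. *)
Lemma slopes_locally_bounded (x y : R) : 0 < x -> x <= y -> y < 1 ->
  exists L : R, forall a m b, 0 < a -> a <= m -> m <= b -> b < 1 -> x <= m <= y ->
    `|primV b - primV a| <= L * (b - a).
Proof.
move=> x0 xy y1.
pose r := 2^-1 * Num.min x (1 - y).
have r0 : 0 < r by rewrite mulr_gt0// lt_min; lra.
have rx : r < x by rewrite /r; case: (leP x (1 - y)); lra.
have ry : r < 1 - y by rewrite /r; case: (leP x (1 - y)); lra.
have [L hL] := @V0_loc (x - r) (y + r) ltac:(lra) ltac:(lra) ltac:(lra).
exists (`|L| + normV / r) => a m b a0 am mb b1 xmy.
have ab : a <= b by lra.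
have [h|h] := leP (b - a) r.
  apply: (@le_trans _ _ (`|L| * (b - a))); last first.
    by apply: ler_wpM2r; [lra|rewrite lerDl divr_ge0 ?normV_ge0 ?ltW].
  apply: le_trans (primVB_le (ltW a0) ab) _.
  rewrite -(@Rintegral_oc_cst _ a b); [|lra..].
  apply: Rintegral_oc_le.
  - by apply: integrableS normV0_integrable.
  - exact: integrable_oc_cst.
  - move=> z az zb; apply: le_trans (ler_norm L).
    by apply: hL; lra.
apply: (@le_trans _ _ normV).
  exact: le_trans (primVB_le (ltW a0) ab) (int_normV_le _ _).
apply: (@le_trans _ _ (normV / r * (b - a))).
  rewrite mulrAC ler_pdivlMr//; apply: ler_wpM2l; [exact: normV_ge0|lra].
by apply: ler_wpM2r; [lra|rewrite lerDr].
Qed.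

Lemma max_slopeP : slope_bound primV max_slope.
Proof.
move=> a m b a0 am mb b1.
have [->|nab] := eqVneq a b; first by rewrite !subrr normr0 mulr0.
have ab : a < b by rewrite lt_neqAle nab; lra.
rewrite -ler_pdivrMr ?subr_gt0//; apply: ub_le_sup; last first.
  by exists (a, b); split => //=; lra.
have [L hL] := @slopes_locally_bounded m m ltac:(lra) ltac:(lra) ltac:(lra).
exists L => _ [[a' b'] /= [h1 h2 h3 ->]].
by rewrite ler_pdivrMr ?subr_gt0//; apply: (hL _ m); lra.
Qed.

Lemma max_slope_le m L : 0 < m < 1 ->
  (forall a b, 0 < a -> a <= m -> m <= b -> b < 1 -> a < b ->
    `|primV b - primV a| <= L * (b - a)) -> max_slope m <= L.
Proof.
move=> m01 h; apply: ge_sup.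
  by eexists; exists (m / 2, m); split => /=; [lra|lra|lra|reflexivity].
move=> _ [[a b] /= [h1 h2 h3 ->]].
by rewrite ler_pdivrMr ?subr_gt0//; apply: h; lra.
Qed.

Lemma max_slope_locally_bounded (x y : R) : 0 < x -> x <= y -> y < 1 ->
  exists L : R, forall m, x <= m <= y -> max_slope m <= L.
Proof.
move=> x0 xy y1; have [L hL] := slopes_locally_bounded x0 xy y1.
exists L => m xmy; apply: max_slope_le; first lra.
by move=> a b a0 am mb b1 ab; apply: (hL a m b).
Qed.

Lemma max_slope_ge0 m : 0 < m < 1 -> 0 <= max_slope m.
Proof.
move=> m01; have := @max_slopeP (m / 2) m m ltac:(lra) ltac:(lra) ltac:(lra) ltac:(lra).
move=> /(le_trans (normr_ge0 _)); rewrite pmulr_lge0//; lra.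
Qed.

(** * An integrable majorant of the slopes *)

Lemma integral_unif (f : R -> \bar R) : measurable_fun setT f ->
  (forall x, (0 <= f x)%E) ->
  (\int[U]_x f x = \int[mu]_(x in `[0%R, 1%R]) f x)%E.
Proof.
move=> mf f0.
have := @integral_uniform R 0 1 ltr01 f mf f0.
rewrite subr0 invr1 mul1e => <-.
have := @ge0_integral_pushforward _ _ (measurableTypeR R) R R
  (idfun : measurableTypeR R -> R) _ (uniform_prob (@ltr01 R)) setT f.
rewrite preimage_setT => <- //; first by move=> ? ? ?; rewrite setTI.
Qed.

Lemma integral_unif_in (A : set R) (f : R -> \bar R) : measurable A ->
  A `<=` `[0, 1] -> measurable_fun setT f -> (forall x, (0 <= f x)%E) ->
  (\int[U]_(x in A) f x = \int[mu]_(x in A) f x)%E.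
Proof.
move=> mA A01 mf f0; rewrite integral_mkcond integral_unif.
- by rewrite -integral_mkcondr setIidr.
- by apply/(measurable_restrictT _ mA); exact: measurable_funTS.
- by move=> x; rewrite patchE; case: ifP.
Qed.

(** Extended by zero, because the maximal function averages over balls that
    may leave ]0, 1[. *)
Definition energy_density : R -> R := (fun x => V0 x ^+ 2) \_ `]0, 1[.

Lemma energy_density_ge0 x : 0 <= energy_density x.
Proof. by rewrite /energy_density patchE; case: ifP => // _; exact: sqr_ge0. Qed.

Lemma energy_density_measurable : measurable_fun setT energy_density.
Proof.
apply/(measurable_restrictT (fun x => V0 x ^+ 2) (measurable_itv `]0%R, 1%R[)).
by apply: measurable_funTS; exact: measurable_funX.
Qed.

Lemma energy_density_integrable :
  mu.-integrable setT (EFin \o energy_density).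
Proof.
apply/integrableP; split.
  by apply/measurable_EFinP; exact: energy_density_measurable.
rewrite (eq_integral (fun x : measurableTypeR R => (energy_density x)%:E)); last first.
  by move=> x _; rewrite /= ger0_norm// energy_density_ge0.
rewrite /energy_density.
have -> : (fun x => (((fun x => V0 x ^+ 2) \_ `]0, 1[) x)%:E) =
    ((fun x => (V0 x ^+ 2)%:E) \_ `]0, 1[).
  by apply/funext => x; rewrite !patchE; case: ifP.
rewrite -integral_mkcond.
apply: le_lt_trans V0_L2; rewrite integral_unif//; last 2 first.
- by apply/measurable_EFinP; exact: measurable_funX.
- by move=> x; rewrite lee_fin sqr_ge0.
apply: ge0_subset_integral => //.
- by apply/measurable_EFinP/measurable_funTS; exact: measurable_funX.
- by move=> x _; rewrite lee_fin sqr_ge0.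
- by move=> x /=; rewrite !in_itv/=; lra.
Qed.

Lemma energy_density_locally_integrable :
  locally_integrable setT energy_density.
Proof. exact: open_integrable_locally openT energy_density_integrable. Qed.

Local Notation HL := (HL_maximal energy_density).

(** Cauchy-Schwarz on ]a, b] bounds the slope by the square root of the
    average of V0 ^ 2, which is at most four times the average over the ball of radius
    2 (b - a) at m.  The former is used in the form
    |V0| <= th / 2 + V0 ^ 2 / (2 th), optimised over th. *)
Lemma slope_le_maximal a m b : 0 < a -> a <= m -> m <= b -> b < 1 -> a < b ->
  (HL m < +oo)%E ->
  `|primV b - primV a| <= 2 * Num.sqrt (fine (HL m)) * (b - a).
Proof.
move=> a0 am mb b1 ab Hoo.
have HL0 : (0 <= HL m)%E.
  by apply: HL_maximalT_ge0; exact: energy_density_locally_integrable.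
have fH : HL m \is a fin_num by rewrite ge0_fin_numE.
pose h := fine (HL m).
have h0 : 0 <= h by exact: fine_ge0.
have key : \int[U]_(x in `]a, b]) (V0 x ^+ 2) <= 4 * (b - a) * h.
  have ball0 : 0 < 2 * (b - a) by rewrite mulr_gt0 ?subr_gt0.
  have : (iavg energy_density (ball m (2 * (b - a))) <= HL m)%E.
    apply: ereal_sup_ubound; exists (2 * (b - a)) => //=.
    by rewrite in_itv/= andbT.
  rewrite -(fineK fH) -/h /iavg lebesgue_measure_ball; last exact: ltW.
  have -> : (2 * (b - a)) *+ 2 = 4 * (b - a) by rewrite mulr2n; ring.
  have b40 : 0 < 4 * (b - a) by rewrite mulr_gt0 ?subr_gt0.
  rewrite inver gt_eqF// lee_pdivrMl// -EFinM => hh.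
  have : (\int[U]_(x in `]a, b]) (V0 x ^+ 2)%:E <= (4 * (b - a) * h)%:E)%E.
    apply: le_trans hh.
    rewrite integral_unif_in//; last 3 first.
    - by move=> x /=; rewrite !in_itv/=; lra.
    - by apply/measurable_EFinP; exact: measurable_funX.
    - by move=> x; rewrite lee_fin sqr_ge0.
    rewrite (eq_integral (fun x : measurableTypeR R => `|energy_density x|%:E)); last first.
      move=> x; rewrite inE/= in_itv/= => xab.
      rewrite /energy_density patchE mem_set/=; last by rewrite in_itv/=; lra.
      by rewrite ger0_norm ?sqr_ge0.
    apply: ge0_subset_integral => //.
    - exact: measurable_ball.
    - apply: measurable_funTS; apply/measurable_EFinP/measurableT_comp => //.
      exact: energy_density_measurable.
    - move=> x /=; rewrite in_itv/= => xab.
      by rewrite /ball/= ltr_norml; lra.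
  move=> /fine_le; rewrite /Rintegral; apply => //.
  apply: integrable_fin_num => //; apply: integrableS (_ : U.-integrable setT _) => //.
  apply/integrableP; split; first by apply/measurable_EFinP; exact: measurable_funX.
  rewrite (eq_integral (fun x => (V0 x ^+ 2)%:E))// => x _.
  by rewrite /= ger0_norm// sqr_ge0.
have main th : 0 < th -> `|primV b - primV a| <= (th / 2 + 2 * h / th) * (b - a).
  move=> th0; apply: le_trans (primVB_le (ltW a0) (ltW ab)) _.
  have iV2 : U.-integrable `]a, b] (EFin \o (fun x => V0 x ^+ 2)).
    apply: integrableS (_ : U.-integrable setT _) => //.
    apply/integrableP; split; first by apply/measurable_EFinP; exact: measurable_funX.
    rewrite (eq_integral (fun x => (V0 x ^+ 2)%:E))// => x _.
    by rewrite /= ger0_norm// sqr_ge0.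
  have iV3 : U.-integrable `]a, b] (EFin \o (fun x => (2 * th)^-1 * V0 x ^+ 2)).
    have := integrableZl _ (2 * th)^-1 iV2.
    by move=> /(_ ltac:(by [])).
  apply: (@le_trans _ _ (\int[U]_(x in `]a, b]) (th / 2 + (2 * th)^-1 * V0 x ^+ 2))).
    apply: Rintegral_oc_le.
    - by apply: integrableS normV0_integrable.
    - exact: (integrableD (measurable_itv _) (integrable_oc_cst a b (th / 2)) iV3).
    move=> x _ _; have : 0 <= (2 * th)^-1 * (`|V0 x| - th) ^+ 2.
      by rewrite mulr_ge0 ?sqr_ge0// invr_ge0; lra.
    rewrite sqrrB real_normK ?num_real//.
    have -> : (2 * th)^-1 * (V0 x ^+ 2 - `|V0 x| * th *+ 2 + th ^+ 2) =
      th / 2 + (2 * th)^-1 * V0 x ^+ 2 - `|V0 x|.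
      rewrite mulr2n expr2; have : th != 0 by rewrite gt_eqF.
      by move=> ?; field.
    by rewrite subr_ge0.
  rewrite RintegralD//; last exact: integrable_oc_cst.
  rewrite Rintegral_oc_cst ?RintegralZl//; [|lra..].
  rewrite [X in _ <= X]mulrDl; apply: lerD => //.
  have -> : 2 * h / th * (b - a) = (2 * th)^-1 * (4 * (b - a) * h).
    by field; rewrite gt_eqF.
  by apply: ler_wpM2l => //; rewrite invr_ge0; lra.
rewrite -/h; have ba : 0 < b - a by lra.
move: h0; rewrite le_eqVlt => /predU1P[h0|h0].
  rewrite -h0 sqrtr0 mulr0 mul0r; apply/ler_addgt0Pr => /= e e0; rewrite add0r.
  have := main (2 * e / (b - a)) ltac:(by rewrite divr_gt0// mulr_gt0).
  rewrite -h0 mulr0 mul0r addr0.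
  by have -> : 2 * e / (b - a) / 2 * (b - a) = e by field; rewrite gt_eqF.
have s0 : 0 < Num.sqrt h by rewrite sqrtr_gt0.
have := main (2 * Num.sqrt h) ltac:(by rewrite mulr_gt0).
have E : h = Num.sqrt h * Num.sqrt h by rewrite -expr2 sqr_sqrtr// ltW.
rewrite {2}E; congr (_ <= _ * _).
by field; rewrite gt_eqF.
Qed.

Definition slope_dominator (m : R) : R := 2 * Num.sqrt (fine (HL m)).

Lemma weak_type_energy c : 0 < c ->
  (U [set x | c%:E < HL x] <= ((3 * fine (\int[mu]_x `|(energy_density x)%:E|)) / c)%:E)%E.
Proof.
move=> c0; apply: le_trans (uniform_le _) _.
  have -> : [set x | (c%:E < HL x)%E] = setT `&` [set x | (c%:E < HL x)%E] by rewrite setTI.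
  apply: emeasurable_fun_o_infty => //; apply: measurable_HL_maximal.
  exact: energy_density_locally_integrable.
apply: le_trans (maximal_inequality energy_density_locally_integrable c0) _.
rewrite [X in (_ <= X%:E)%E]mulrAC (EFinM (3 / c)) fineK//.
have /integrableP[_] := energy_density_integrable.
by rewrite ge0_fin_numE// integral_ge0.
Qed.

Lemma slope_dominator_integrable :
  U.-integrable setT (EFin \o slope_dominator).
Proof.
have i : U.-integrable setT (fun x => (Num.sqrt (fine (HL x)))%:E).
  apply: (@sqrt_integrable_of_weak_type _ _ _ U _
    (3 * fine (\int[mu]_x `|(energy_density x)%:E|))).
  - apply: measurableT_comp => //; apply: measurable_HL_maximal.
    exact: energy_density_locally_integrable.
  - move=> x; apply: fine_ge0; apply: HL_maximalT_ge0.
    exact: energy_density_locally_integrable.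
  - by rewrite mulr_ge0// fine_ge0// integral_ge0.
  move=> n; apply: le_trans (weak_type_energy (exprn_gt0 n _)) => //.
  have mHL : measurable_fun setT HL.
    by apply: measurable_HL_maximal; exact: energy_density_locally_integrable.
  apply: le_measure; rewrite ?inE.
  - have -> : [set x | 4 ^+ n < fine (HL x)] =
        setT `&` (fun x => fine (HL x)) @^-1` `]4 ^+ n, +oo[.
      by rewrite setTI; apply/seteqP; split => x /=; rewrite in_itv/= andbT.
    by apply: (measurableT_comp _ mHL).
  - rewrite -[X in measurable X]setTI.
    exact: emeasurable_fun_o_infty.
  move=> x /=; case: (HL x) => [r|_|] //=; rewrite ?ltry//.
  by rewrite ltNge exprn_ge0.
exact: (integrableZl _ 2 i).
Qed.

(** The maximal function is finite almost everywhere by its weak type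
    estimate; where it is infinite its finite part is zero and bounds nothing. *)
Lemma max_slope_le_dominator :
  {ae U, forall m, 0 < m < 1 -> max_slope m <= slope_dominator m}.
Proof.
have mHL : measurable_fun setT HL.
  by apply: measurable_HL_maximal; exact: energy_density_locally_integrable.
have mE : measurable (HL @^-1` [set +oo%E]).
  by rewrite -[X in measurable X]setTI; exact: mHL.
exists (HL @^-1` [set +oo%E]); split => //.
  apply/eqP; rewrite eq_le measure_ge0 andbT.
  pose C := 3 * fine (\int[mu]_x `|(energy_density x)%:E|).
  have C0 : 0 <= C by rewrite mulr_ge0// fine_ge0// integral_ge0.
  apply/lee_addgt0Pr => e e0; rewrite add0e.
  have c0 : 0 < (C + 1) / e by rewrite divr_gt0//; lra.
  apply: (@le_trans _ _ (U [set x | ((C + 1) / e)%:E < HL x]%E)).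
    apply: le_measure; rewrite ?inE//.
      by rewrite -[X in measurable X]setTI; exact: emeasurable_fun_o_infty.
    by move=> x /= ->; rewrite ltry.
  apply: le_trans (weak_type_energy c0) _; rewrite -/C lee_fin invf_div.
  by rewrite mulrA ler_pdivrMr; [rewrite mulrC ler_wpM2l; lra|lra].
move=> m /=; apply: contra_notP => Hoo m01.
apply: max_slope_le => // a b a0 am mb b1 ab.
by apply: slope_le_maximal => //; rewrite ltey; apply/eqP.
Qed.

End initial_data.

(** * Conservation of momentum on sublevel sets *)

Section real_dominated_convergence.
Context {R : realType} d (T : measurableType d) (mu : {measure set T -> \bar R}).

Lemma Rdominated_cvg (D : set T) (f_ : nat -> T -> R) (f g : T -> R) :
  measurable D ->
  (forall n, measurable_fun D (f_ n)) -> measurable_fun D f ->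
  {ae mu, forall x, D x -> f_ n x @[n --> \oo] --> f x} ->
  mu.-integrable D (EFin \o g) ->
  {ae mu, forall x, forall n, D x -> `|f_ n x| <= g x} ->
  \int[mu]_(x in D) f_ n x @[n --> \oo] --> \int[mu]_(x in D) f x.
Proof.
move=> mD mf_ mf f_f ig fg.
have aeF := ae_filter_ringOfSetsType mu.
have h1 n : measurable_fun D (fun x => (f_ n x)%:E) by exact/measurable_EFinP.
have h2 : measurable_fun D (EFin \o f) by exact/measurable_EFinP.
have h3 : {ae mu, forall x, D x ->
    (fun n x => (f_ n x)%:E) n x @[n --> \oo] --> (EFin \o f) x}.
  by apply: filterS f_f => x h Dx; apply/fine_cvgP; split; [exact: nearW|exact: h].
have h4 : {ae mu, forall x, forall n, D x -> (`|(f_ n x)%:E| <= (EFin \o g) x)%E}.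
  by apply: filterS fg => x h n Dx; rewrite lee_fin; exact: h.
have [fi _ cvgI] := dominated_convergence mD h1 h2 h3 ig h4.
apply: fine_cvg; rewrite fineK; first exact: cvgI.
exact: integrable_fin_num.
Qed.

End real_dominated_convergence.

Lemma cvg_eq_limit {R : realType} (u : nat -> R) (a b : R) :
  u n @[n --> \oo] --> a -> u n @[n --> \oo] --> b -> a = b.
Proof. by move=> ua ub; rewrite -(cvg_lim (@Rhausdorff R) ua) (cvg_lim (@Rhausdorff R) ub). Qed.

Section conservation.
Context {R : realType}.
Local Notation U := (@unif R).
Variables X0 V0 : R -> R.

Hypothesis X0nd : nondecr01 X0.
Hypothesis X0left : forall m c, 0 < m < 1 -> c < X0 m ->
  exists2 a, 0 < a < m & c <= X0 a.
Hypothesis mV0 : measurable_fun setT V0.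
Hypothesis V0_L2 : (\int[U]_x ((V0 x) ^+ 2)%:E < +oo)%E.
Hypothesis V0_loc : forall x y : R, 0 < x -> x <= y -> y < 1 ->
  exists L : R, forall z, x <= z <= y -> `|V0 z| <= L.

Local Notation F := (primX X0).
Local Notation G := (primV V0).
Local Notation X := (flow F G).
Local Notation D := (`]0 : R, 1[%classic).

Let FX0 : subgradient F X0. Proof. exact: primX_subgradient. Qed.
Let GK : slope_bound G (max_slope V0). Proof. exact: max_slopeP. Qed.
Let GB x : 0 < x < 1 -> `|G x| <= normV V0. Proof. exact: primV_bounded. Qed.

Lemma flow_nd t : nondecr01 (X t).
Proof. by move=> x y x0 xy y1; exact: (flow_nondecreasing FX0 GK). Qed.

Lemma flow_measurable t : measurable_fun D (X t).
Proof. by apply: nondecr01_measurable => //; exact: flow_nd. Qed.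

Lemma flow_initial m : 0 < m < 1 -> X 0 m = X0 m.
Proof. by move=> m01; apply: (flow0 FX0 GK m01) => c; exact: X0left. Qed.

(** Linear in the time increment, so that the same integrable function bounds
    the difference quotients and the velocities. *)
Lemma flow_increment_dominated :
  {ae U, forall m, forall s t, 0 < m < 1 ->
    `|X t m - X s m| <= slope_dominator V0 m * `|t - s|}.
Proof.
have aeF := ae_filter_ringOfSetsType U.
apply: filterS (max_slope_le_dominator mV0 V0_L2) => m h s t m01.
by apply: le_trans (flow_lipschitz FX0 GK s t m01) _; rewrite ler_wpM2r// h.
Qed.

(** Momentum defect: the displacement minus that of free motion. *)
Definition residual t m : R := X t m - X0 m - t * V0 m.

Lemma residual_measurable t : measurable_fun D (residual t).
Proof.
apply: measurable_funB; first apply: measurable_funB.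
- exact: flow_measurable.
- exact: nondecr01_measurable.
- by apply: measurable_funM => //; apply: measurable_funTS.
Qed.

Lemma flow_increment_integrable s t :
  U.-integrable D (EFin \o (fun m => X t m - X s m)).
Proof.
have aeF := ae_filter_ringOfSetsType U.
have sdi : U.-integrable D (fun m => (`|t - s| * slope_dominator V0 m)%:E).
  apply: integrableS (_ : U.-integrable setT _) => //.
  exact: (integrableZl _ `|t - s| (slope_dominator_integrable mV0 V0_L2)).
have mX : measurable_fun D (EFin \o (fun m => X t m - X s m)).
  by apply/measurable_EFinP/measurable_funB; exact: flow_measurable.
apply/integrableP; split => //.
move/integrableP : sdi => [msd]; apply: le_lt_trans.
apply: ae_ge0_le_integral => //.
- exact: measurableT_comp.
- exact: measurableT_comp.
apply: filterS flow_increment_dominated => m h /=; rewrite in_itv/= => m01.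
by rewrite lee_fin; apply: le_trans (h s t m01) _; rewrite mulrC ler_norm.
Qed.

Lemma residual_integrable t : U.-integrable D (EFin \o residual t).
Proof.
have h1 := flow_increment_integrable 0 t.
have h2 : U.-integrable D (EFin \o (fun m => t * V0 m)).
  apply: integrableS (_ : U.-integrable setT _) => //.
  exact: (integrableZl _ t (V0_integrable mV0 V0_L2)).
have := integrableB (measurable_itv _) h1 h2.
apply: eq_integrable => // m; rewrite inE/= in_itv/= => m01.
by rewrite /residual flow_initial.
Qed.

Lemma ae_unif_neq (a : R) : {ae U, forall m, m <> a}.
Proof.
exists [set a]; split => //; last by move=> m /= /contrapT.
apply/eqP; rewrite eq_le measure_ge0 andbT.
by apply: le_trans (uniform_le (measurable_set1 a)) _; rewrite lebesgue_measure_set1.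
Qed.

Lemma flow_sublevel_measurable t c : measurable (D `&` [set m | X t m < c]).
Proof.
have := flow_measurable t (measurable_itv _) (measurable_itv `]-oo, c[).
by congr (measurable (_ `&` _)); apply/seteqP; split => m /=; rewrite in_itv.
Qed.

Local Notation gap := (gap F G).

(** Both the envelope and F are the integrals of their subgradients. *)
Lemma gap_increment t x y : 0 < x -> x <= y -> y < 1 ->
  gap t y - gap t x = - \int[U]_(z in `]x, y]) residual t z.
Proof.
move=> x0 xy y1.
have iX : U.-integrable `]x, y] (EFin \o X t).
  by apply: nondecr01_integrable => //; exact: flow_nd.
have iX0 : U.-integrable `]x, y] (EFin \o X0) by exact: nondecr01_integrable.
have iV : U.-integrable `]x, y] (EFin \o V0) by exact: V0_integrable_oc.
have itV : U.-integrable `]x, y] (EFin \o (fun z => t * V0 z)).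
  exact: (integrableZl _ t iV).
have iXX0 : U.-integrable `]x, y] (EFin \o (fun z => X t z - X0 z)).
  exact: (integrableB _ iX iX0).
rewrite /residual RintegralB// RintegralB// RintegralZl//.
rewrite (subgradient_integral (envelope_subgradient FX0 GK GB t) x0 xy y1).
rewrite (subgradient_integral FX0 x0 xy y1) -primVB//; last exact: ltW.
by rewrite /gap /potential; ring.
Qed.

Local Notation al := (sublevel_end F G).

(** The integral of the residual at time s up to x is a constant minus
    gap s x.  Near the end point of {X t < c} the gap at time t, hence at the
    earlier time s, is arbitrarily small, so the integral over {X t < c} is the
    same constant for every c.  It is zero, as these sets shrink to the empty
    set when c tends to -oo. *)
Lemma residual_sublevel s t c : 0 < s -> s <= t ->
  \int[U]_(m in D `&` [set m | X t m < c]) residual s m = 0.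
Proof.
move=> s0 st; have t0 : 0 < t by lra.
have aeF := ae_filter_ringOfSetsType U.
have mD : measurable D by [].
have ms := residual_measurable s.
have ires := residual_integrable s.
pose J x := \int[U]_(z in `]0, x]) residual s z.
have isub x : x < 1 -> U.-integrable `]0, x] (EFin \o residual s).
  by move=> x1; apply: integrableS ires => // z /=; rewrite !in_itv/=; lra.
have [k hk] : exists k, forall x, 0 < x < 1 -> gap s x + J x = k.
  exists (gap s 2^-1 + J 2^-1) => x x01.
  have [h|h] := leP x 2^-1.
    have := @gap_increment s x 2^-1 ltac:(lra) h ltac:(lra).
    rewrite /J (@Rintegral_oc_split _ (residual s) 0 x 2^-1)//; [lra|lra|].
    by apply: isub; lra.
  have := @gap_increment s 2^-1 x ltac:(lra) (ltW h) ltac:(lra).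
  rewrite /J (@Rintegral_oc_split _ (residual s) 0 2^-1 x)//; [lra|lra|].
  by apply: isub; lra.
have main c' : \int[U]_(m in D `&` [set m | X t m < c']) residual s m = k.
  have cont n := @contact _ F G X0 _ FX0 GK _ GB t c' (n.+1%:R^-1) (n.+1%:R^-1)
    ltac:(by []) ltac:(by []).
  pose x n := s2val (cid2 (cont n)).
  have x01 n : 0 < x n < 1 by rewrite /x; case: cid2.
  have xal n : `|x n - al t c'| < n.+1%:R^-1 by rewrite /x; case: cid2 => ? ? [].
  have xgap n : gap t (x n) < n.+1%:R^-1 by rewrite /x; case: cid2 => ? ? [].
  have inv0 : (n.+1%:R^-1 : R) @[n --> \oo] --> 0 by exact: cvg_harmonic.
  have gs0 : gap s (x n) @[n --> \oo] --> 0.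
    apply: (squeeze_cvgr _ (cvg_cst 0) inv0); apply: nearW => n.
    rewrite (gap_ge0 FX0 GB s (x01 n))/=.
    apply: le_trans (gap_le FX0 GK GB s0 st (x01 n)) _.
    apply: le_trans (ltW (xgap n)); apply: ler_piMl.
      exact: (gap_ge0 FX0 GB t (x01 n)).
    by rewrite ler_pdivrMr// mul1r.
  have Jk : J (x n) @[n --> \oo] --> k.
    have -> : (fun n => J (x n)) = (fun n => k - gap s (x n)).
      by apply/funext => n; have := hk _ (x01 n); lra.
    by rewrite -[X in _ --> X]subr0; apply: cvgB => //; exact: cvg_cst.
  have xa : x n @[n --> \oo] --> al t c'.
    apply/cvgrPdist_lt => e e0; near=> n; rewrite distrC.
    apply: lt_trans (xal n) _; near: n.
    by have /cvgrPdist_lt/(_ e e0) := inv0; apply: filterS => n;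
      rewrite sub0r normrN ger0_norm.
  have JE n : J (x n) = \int[U]_(m in D) (residual s \_ `]0, x n]) m.
    rewrite -Rintegral_mkcondr /J; congr Rintegral; apply/seteqP; split => z /=;
      rewrite !in_itv/=; have := x01 n; first by split; lra.
    by move=> _ [].
  have -> : D `&` [set m | X t m < c'] = D `&` (D `&` [set m | X t m < c']).
    by rewrite setIA setIid.
  rewrite Rintegral_mkcondr; apply/esym; apply: cvg_eq_limit Jk _.
  under eq_fun do rewrite JE.
  apply: (Rdominated_cvg mD _ _ _ (integrable_norm ires)).
  - move=> n; apply/(measurable_restrict _ (measurable_itv _) mD).
    by apply: measurable_funS ms => //; exact: subIsetl.
  - apply/(measurable_restrict _ (flow_sublevel_measurable _ _) mD).
    by apply: measurable_funS ms => //; exact: subIsetl.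
  - apply: filterS (ae_unif_neq (al t c')) => m ma Dm.
    move: (Dm) => /=; rewrite in_itv/= => m01.
    have [mal|alm|//] := ltgtP m (al t c').
      apply: cvg_near_cst; near=> n.
      rewrite !patchE !mem_set//=; first by split => //; exact: flow_lt_sublevel_end FX0 GK _ _ _ m01 mal.
      rewrite in_itv/=; apply/andP; split; first lra.
      by near: n; move: xa => /cvgr_ge; apply.
    apply: cvg_near_cst; near=> n.
    rewrite !patchE !memNset//=.
      by move=> [_]; rewrite ltNge (sublevel_end_gt m01 alm).
    rewrite in_itv/= => /andP[_]; rewrite leNgt => /negP; apply.
    by near: n; move: xa => /cvgr_lt; apply.
  - apply/nearW => m n Dm /=; rewrite patchE; case: ifP => // _.
    by rewrite normr0.
suff k0 : k = 0 by rewrite main.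
have lim0 : \int[U]_(m in D `&` [set m | (X t m < - n%:R)%R]) residual s m
    @[n --> \oo] --> \int[U]_(m in D) (cst 0 : R -> R) m.
  under eq_fun.
    move=> n; rewrite (_ : _ `&` _ = D `&` (D `&` [set m | X t m < - n%:R])).
      rewrite Rintegral_mkcondr; over.
    by rewrite setIA setIid.
  apply: (Rdominated_cvg mD _ _ _ (integrable_norm ires)) => //.
  - move=> n; apply/(measurable_restrict _ (flow_sublevel_measurable _ _) mD).
    by apply: measurable_funS ms => //; exact: subIsetl.
  - apply/nearW => m Dm; apply: cvg_near_cst; near=> n.
    rewrite patchE memNset//= => -[_]; rewrite ltNge => /negP; apply.
    rewrite lerNl; apply/ltW; near: n; exact: nbhs_infty_gtr.
  - apply/nearW => m n Dm /=; rewrite patchE; case: ifP => // _.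
    by rewrite normr0.
apply: cvg_eq_limit (_ : (k : R) @[_ --> \oo] --> k) _; first exact: cvg_cst.
by move: lim0; under eq_fun do rewrite main; rewrite Rintegral_cst// mul0r.
Unshelve. all: by end_near. Qed.

Lemma flow_conservation s t c : 0 < s -> s <= t ->
  \int[U]_(m in D `&` [set m | X t m < c]) (X t m - X s m - (t - s) * V0 m) = 0.
Proof.
move=> s0 st.
have sub : D `&` [set m | X t m < c] `<=` D by exact: subIsetl.
have mE := flow_sublevel_measurable t c.
have i u : U.-integrable (D `&` [set m | X t m < c]) (EFin \o residual u).
  by apply: integrableS (residual_integrable u).
rewrite (@eq_Rintegral _ _ _ U _ (fun m => residual t m - residual s m)); last first.
  by move=> m _; rewrite /residual; ring.
rewrite RintegralB// !residual_sublevel ?subrr//; lra.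
Qed.

End conservation.

(** * Lipschitz functions are derivable almost everywhere *)

Section lipschitz_derivable.
Context {R : realType}.
Local Notation mu := (@lebesgue_measure R).
Local Notation TR := (measurableTypeR R).

Section monotone_contraction.
Variable g : R -> R.
Hypothesis g_nd : {homo g : x y / x <= y}.
Hypothesis g_le : {homo (fun x => x - g x) : x y / x <= y}.

Let g_contr x y : x <= y -> 0 <= g y - g x <= y - x.
Proof. by move=> xy; have := g_nd xy; have := g_le xy; lra. Qed.

Let g_rc : right_continuous g.
Proof.
move=> x; apply/cvgrPdist_lt => e e0; near=> y.
have xy : x <= y by near: y; exact: nbhs_right_ge.
have ye : y < x + e by near: y; apply: nbhs_right_lt; lra.
by have := g_contr xy; rewrite ltr_norml; lra.
Unshelve. all: by end_near. Qed.

Let k x : R := x - g x.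

Let k_rc : right_continuous k.
Proof.
move=> x; apply/cvgrPdist_lt => e e0; near=> y.
have xy : x <= y by near: y; exact: nbhs_right_ge.
have ye : y < x + e by near: y; apply: nbhs_right_lt; lra.
by have := g_contr xy; rewrite /k ltr_norml; lra.
Unshelve. all: by end_near. Qed.

#[local] HB.instance Definition _ := isCumulative.Build R _ R g g_nd g_rc.
#[local] HB.instance Definition _ := isCumulative.Build R _ R k g_le k_rc.

Let LS_oc (f : cumulative R R) (a b : R) : a <= b ->
  lebesgue_stieltjes_measure f `]a, b]%classic = (f b - f a)%:E.
Proof.
move=> ab; rewrite /lebesgue_stieltjes_measure /measure_extension/=.
rewrite measurable_mu_extE/=; last exact: is_ocitv.
by rewrite wlength_itv_bnd.
Qed.

(** The Stieltjes measures of g and of x - g add up to the Lebesgue measure. *)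
Let LS_le (A : set TR) : measurable A ->
  (lebesgue_stieltjes_measure g A <= mu A)%E.
Proof.
move=> mA.
have addE X : measure_add (lebesgue_stieltjes_measure g) (lebesgue_stieltjes_measure k) X =
    (lebesgue_stieltjes_measure g X + lebesgue_stieltjes_measure k X)%E.
  exact: measure_addE.
have -> : mu A = measure_add (lebesgue_stieltjes_measure g) (lebesgue_stieltjes_measure k) A.
  apply: lebesgue_stieltjes_measure_unique => // X [[a b]/= _ <-].
  have [ab|ba] := leP a b; last first.
    by rewrite set_itv_ge ?measure0// bnd_simp -leNgt ltW.
  transitivity (lebesgue_stieltjes_measure g `]a, b]%classic +
    lebesgue_stieltjes_measure k `]a, b]%classic)%E; last exact/esym/addE.
  have -> : lebesgue_stieltjes_measure idfun `]a, b]%classic = (b - a)%:E.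
    exact: (LS_oc idfun ab).
  have -> : lebesgue_stieltjes_measure g `]a, b]%classic = (g b - g a)%:E.
    exact: (LS_oc g ab).
  have -> : lebesgue_stieltjes_measure k `]a, b]%classic = (b - g b - (a - g a))%:E.
    exact: (LS_oc k ab).
  by rewrite -EFinD; congr _%:E; ring.
rewrite [X in (_ <= X)%E]addE; apply: leeDl; exact: measure_ge0.
Qed.

(** The Stieltjes measure of g has a density by Radon-Nikodym, so g is an
    indefinite integral and Lebesgue differentiation applies.  The restriction
    to a bounded interval makes the measure finite. *)
Lemma contraction_derivable_in (N : R) :
  {ae mu, forall x, - N < x < N -> derivable g x 1}.
Proof.
have aeF := ae_filter_ringOfSetsType mu.
have [N0|N0] := leP N 0; first by apply/nearW => x; lra.
have mI : measurable (`](- N), N]%classic : set TR) by [].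
have Ioo : (lebesgue_stieltjes_measure g `](- N)%R, N]%classic < +oo)%E.
  have h : - N <= N by lra.
  by rewrite (LS_oc g h) ltry.
pose nu := charge_of_finite_measure (mfrestr mI Ioo).
have numu : nu `<< mu.
  move=> A A0 B mB BA; apply/eqP; rewrite eq_le measure_ge0 andbT.
  rewrite -(A0 _ mB BA); apply: le_trans (LS_le mB).
  apply: le_measure; rewrite ?inE//; first exact: measurableI.
have iphi := Radon_Nikodym_integrable numu.
set phi := Radon_Nikodym nu mu in iphi.
have phiE : phi = EFin \o (fine \o phi).
  by apply/funext => x /=; rewrite fineK// Radon_Nikodym_fin_num.
rewrite phiE in iphi.
have iphiy (y : R) : mu.-integrable `]-oo, y] (EFin \o (fine \o phi)).
  by apply: integrableS iphi.
have := FTC1Ny iphiy (open_integrable_locally openT iphi).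
apply: filterS => x /= [dF _] xN.
have Fy (y : R) : - N < y < N ->
    \int[mu]_(t in `]-oo, y]) (fine (phi t)) = g y - g (- N).
  move=> yN; rewrite /Rintegral.
  rewrite (eq_integral phi); last by move=> t _; rewrite [in RHS]phiE.
  rewrite /phi -Radon_Nikodym_integral//.
  transitivity (fine (g y - g (- N))%:E); last by [].
  congr fine.
  have yN' : - N <= y by lra.
  apply: etrans (LS_oc g yN').
  rewrite /nu /mfrestr /mrestr /=.
  congr (lebesgue_stieltjes_measure g _); apply/seteqP; split => z /=;
    rewrite !in_itv/=; first by lra.
  by lra.
apply: (@near_eq_derivable R R R
  (fun y : R => \int[mu]_(t in `]-oo, y]) (fine (phi t)) + g (- N)) g x 1).
  have : nbhs x `](- N), N[%classic by apply: near_in_itvoo; rewrite in_itv.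
  apply: filterS => y /=; rewrite in_itv/= => /Fy ->.
  by rewrite subrK.
by apply: derivableD => //; exact: derivable_cst.
Qed.

Lemma contraction_derivable : {ae mu, forall x, derivable g x 1}.
Proof.
have h n := contraction_derivable_in n%:R.
have : {ae mu, forall x, forall n : nat, - n%:R < x < n%:R -> derivable g x 1}.
  exact: ae_foralln.
have aeF := ae_filter_ringOfSetsType mu.
apply: filterS => x /(_ (Num.truncn `|x|).+1); apply.
by rewrite -ltr_norml; exact: truncnS_gt.
Qed.

End monotone_contraction.

(** An affine change of f turns it into a function g such that both g and
    x - g x are nondecreasing. *)
Lemma lipschitz_derivable (f : R -> R) (K : R) :
  (forall s t, `|f t - f s| <= K * `|t - s|) ->
  {ae mu, forall t, derivable f t 1}.
Proof.
move=> fK; pose L := `|K| + 1.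
have L0 : 0 < L by rewrite ltr_wpDl.
have fL s t : s <= t -> `|f t - f s| <= L * (t - s).
  move=> st; apply: le_trans (fK s t) _; rewrite ger0_norm ?subr_ge0//.
  by apply: ler_wpM2r; [lra|rewrite /L; have := ler_norm K; lra].
pose g x := (2 * L)^-1 * f x + 2^-1 * x.
have L20 : 0 < (2 * L)^-1 by rewrite invr_gt0; lra.
have aux s t : s <= t -> - (2^-1 * (t - s)) <= (2 * L)^-1 * (f t - f s) <= 2^-1 * (t - s).
  move=> /fL h; rewrite -ler_norml normrM gtr0_norm//.
  rewrite mulrC ler_pdivrMr; last lra.
  by apply: le_trans h _; rewrite le_eqVlt; apply/orP; left; apply/eqP; field.
have gnd : {homo g : x y / x <= y}.
  by move=> s t st; have := aux s t st; rewrite /g; lra.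
have gle : {homo (fun x => x - g x) : x y / x <= y}.
  by move=> s t st; have := aux s t st; rewrite /g; lra.
have aeF := ae_filter_ringOfSetsType mu.
apply: filterS (contraction_derivable gnd gle) => t dg.
have -> : f = (fun x => (2 * L) *: (g x - 2^-1 *: x)).
  apply/funext => x; rewrite /g /GRing.scale/=; field; rewrite gt_eqF//.
by apply: derivableZ; apply: derivableB => //; apply: derivableZ; exact: derivable_id.
Qed.

End lipschitz_derivable.

(** * The space of paths *)

Section path_topology.
Context {R : realType}.
Implicit Types (g : Gamma R) (s t : R).

Definition to_halfline t : halfline R := exist _ (Num.max t 0) (max0_halfline t).

Lemma to_halfline_continuous : continuous to_halfline.
Proof.
apply: continuous_comp_initial; rewrite /comp /= => t.
by apply: continuous_max; [exact: cvg_id|exact: cvg_cst].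
Qed.

Lemma path_at_continuous g : continuous (path_at g).
Proof.
move=> t; apply: (@continuous_comp _ _ _ to_halfline (Gamma_fun g)).
  exact: to_halfline_continuous.
exact: (@cts_fun _ _ (g : continuousType (halfline R) R)).
Qed.

(** Uniform convergence on compact sets implies pointwise convergence. *)
Lemma eval_at_continuous t : continuous (@eval_at R t).
Proof.
move=> g A Ag.
have h1 : nbhs (Gamma_fun g) (fun f : {family compact, halfline R -> R} => A (f (to_halfline t))).
  have FF : Filter (nbhs (Gamma_fun g)) := nbhs_filter _.
  have cv : {family compact, nbhs (Gamma_fun g) --> (Gamma_fun g : halfline R -> R)}.
    exact: cvg_id.
  have /(pointwise_cvgP (Gamma_fun g) FF) := pointwise_cvg_compact_family FF cv.
  by move=> /(_ (to_halfline t)); apply.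
exact: (@initial_continuous _ _ (@Gamma_fun R) g _ h1).
Qed.

Lemma eval_at_open t (A : set R) : open A -> open (@eval_at R t @^-1` A).
Proof. by move/continuousP : (@eval_at_continuous t); exact. Qed.

Lemma Gamma_open_measurable (A : set (Gamma R)) : open A -> measurable A.
Proof. by move=> oA; apply: sub_sigma_algebra. Qed.

Lemma eval_at_measurable t : measurable_fun setT (@eval_at R t).
Proof.
apply: (measurability (@RGenOpens.G R)) => [|/= _ [_] [a [b ->]] <-].
  exact: RGenOpens.measurableE.
rewrite setTI; apply: Gamma_open_measurable; apply: eval_at_open.
exact: interval_open.
Qed.

Section path_of.
Variables (f : R -> R) (cf : continuous f).

Let path_of_continuous : continuous (fun x : halfline R => f (set_val x)).
Proof.
move=> x; apply: (@continuous_comp (halfline R) R R set_val f); last exact: cf.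
exact: initial_continuous.
Qed.

Definition path_of : Gamma R :=
  (mkcts path_of_continuous : continuousType (halfline R) R).

Lemma path_of_at t : path_at path_of t = f (Num.max t 0).
Proof. by []. Qed.

End path_of.
End path_topology.

(** * The paths of the flow *)

Section left_open.
Context {R : realType}.

(** Such a set is a countable union of intervals: each point has a rational
    to its left from which the whole interval up to the point belongs to the
    set. *)
Lemma left_open_measurable (A : set R) :
  (forall m, A m -> exists2 d, 0 < d & forall z, m - d < z -> z <= m -> A z) ->
  measurable A.
Proof.
move=> lo.
pose B (q : rat) := [set m : R | ratr q <= m /\ forall z, ratr q <= z -> z <= m -> A z].
have -> : A = \bigcup_q B q.
  apply/seteqP; split => [m Am|m [q _ [qm]]]; last by apply.
  have [d d0 hd] := lo m Am.
  have [q] := @rat_in_itvoo R (m - d) m ltac:(lra).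
  rewrite in_itv/= => qm; exists q => //; split; first lra.
  by move=> z qz zm; apply: hd => //; lra.
apply: countable_bigcupT_measurable => // q.
apply: is_interval_measurable => x y [qx hx] [qy hy] z xzy; split; first lra.
by move=> w qw wz; apply: hy => //; lra.
Qed.

End left_open.

Section flow_paths.
Context {R : realType}.
Local Notation U := (@unif R).
Variables X0 V0 : R -> R.

Hypothesis X0nd : nondecr01 X0.
Hypothesis mV0 : measurable_fun setT V0.
Hypothesis V0_L2 : (\int[U]_x ((V0 x) ^+ 2)%:E < +oo)%E.
Hypothesis V0_loc : forall x y : R, 0 < x -> x <= y -> y < 1 ->
  exists L : R, forall z, x <= z <= y -> `|V0 z| <= L.

Local Notation F := (primX X0).
Local Notation G := (primV V0).
Local Notation X := (flow F G).
Local Notation D := (`]0 : R, 1[%classic).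

Let FX0 : subgradient F X0. Proof. exact: primX_subgradient. Qed.
Let GK : slope_bound G (max_slope V0). Proof. exact: max_slopeP. Qed.

(** Labels outside ]0, 1[ carry no mass; sending them to 1/2 gives every label
    a path. *)
Definition clamp01 (m : R) : R := if 0 < m < 1 then m else 2^-1.

Lemma clamp01_in m : 0 < clamp01 m < 1.
Proof. by rewrite /clamp01; case: ifP => //; lra. Qed.

Lemma clamp01_id m : 0 < m < 1 -> clamp01 m = m.
Proof. by rewrite /clamp01 => ->. Qed.

Lemma flow_time_continuous m : continuous (fun t => X t (clamp01 m)).
Proof.
move=> t; apply: (@locally_lipschitz_continuous _ _ t (max_slope V0 (clamp01 m)) 1) => // s _.
exact: (flow_lipschitz FX0 GK t s (clamp01_in m)).
Qed.

Definition flow_path (m : R) : Gamma R := path_of (@flow_time_continuous m).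

Lemma flow_path_at m t : 0 < m < 1 -> path_at (flow_path m) t = X (Num.max t 0) m.
Proof. by move=> m01; rewrite path_of_at clamp01_id. Qed.

Lemma flow_path_at_ge0 m t : 0 < m < 1 -> 0 <= t -> path_at (flow_path m) t = X t m.
Proof. by move=> m01 t0; rewrite flow_path_at// (max_idPl t0). Qed.

Lemma flow_path_lipschitz m s t : 0 < m < 1 ->
  `|path_at (flow_path m) t - path_at (flow_path m) s| <= max_slope V0 m * `|t - s|.
Proof.
move=> m01; rewrite !flow_path_at//.
apply: le_trans (flow_lipschitz FX0 GK _ _ m01) _.
apply: ler_wpM2l; first by apply: max_slope_ge0.
case: (leP t 0) => t0; case: (leP s 0) => s0; rewrite ?subrr ?normr0//.
- by rewrite sub0r normrN gtr0_norm// ler0_norm; lra.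
- by rewrite subr0 gtr0_norm// ger0_norm; lra.
Qed.

(** In each position m |-> X t m is left continuous, and the paths of labels
    near m are Lipschitz with a common constant; a compactness argument in t
    upgrades pointwise to locally uniform convergence. *)
Lemma flow_path_left_continuous m (A : set (Gamma R)) : 0 < m < 1 ->
  open A -> A (flow_path m) ->
  exists2 d, 0 < d & forall z, m - d < z -> z <= m -> 0 < z < 1 -> A (flow_path z).
Proof.
move=> m01 [W oW <-] /= Wm.
pose f z : halfline R -> R := Gamma_fun (flow_path z).
suff cv : {family compact, (fun z => f z) @ m^'- --> f m}.
  have [d /= d0 hd] := cv W (open_nbhs_nbhs (conj oW Wm)).
  exists d => // z mdz zm z01.
  move: zm; rewrite le_eqVlt => /predU1P[->//|zm].
  by apply: (hd z) => //=; rewrite ltr_norml; lra.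
apply/fam_cvgP => B cB P; rewrite uniform_nbhs => -[E [eE EP]].
have [e e0 he] : exists2 e : R, 0 < e & forall x y : R, `|x - y| < e -> E (x, y).
  move: eE; rewrite -entourage_ballE => -[e /= e0 he]; exists e => // x y xy.
  exact: (he (x, y)).
suff : \forall z \near m^'-, B `<=` (fun x => `|f m x - f z x| < e).
  by apply: filterS => z hz; apply: EP => x Bx /=; apply: he; exact: hz.
move: cB => /compact_near_coveringP; apply => x Bx.
have fE z y : 0 < z < 1 -> f z y = X (set_val y) z.
  by move=> z01; rewrite -[in RHS](clamp01_id z01).
have m20 : 0 < m / 2 by lra.
have m2m : m / 2 <= m by lra.
have m1 : m < 1 by lra.
have [L hL] := max_slope_locally_bounded mV0 V0_L2 V0_loc m20 m2m m1.
have L10 : 0 < `|L| + 1 by rewrite ltr_wpDl.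
have hx : \forall y \near x, `|set_val y - set_val x| < e / (4 * (`|L| + 1)).
  have /cvgrPdistC_lt := @initial_continuous _ _ (@set_val R (halfline R)) x.
  by apply; rewrite divr_gt0// mulr_gt0.
have hz : \forall z \near m^'-, X (set_val x) m - e / 4 <= X (set_val x) z.
  by apply: (flow_left_continuous FX0 GK) => //; lra.
have hz2 : \forall z \near m^'-, m / 2 < z < m.
  near=> z; apply/andP; split; near: z; last exact: nbhs_left_lt.
  by apply: nbhs_left_gt; lra.
exists ([set y | `|set_val y - set_val x| < e / (4 * (`|L| + 1))],
  [set z | X (set_val x) m - e / 4 <= X (set_val x) z /\ m / 2 < z < m]).
  by split => //=; near=> z; split; near: z.
move=> [y z] /= [yx [zm zm2]].
have z01 : 0 < z < 1 by lra.
rewrite !fE//.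
have Lb w : m / 2 <= w <= m -> `|X (set_val y) w - X (set_val x) w| <= e / 4.
  move=> wm; apply: le_trans (flow_lipschitz FX0 GK _ _ _) _; first lra.
  apply: (@le_trans _ _ ((`|L| + 1) * `|set_val y - set_val x|)).
    by apply: ler_wpM2r => //; have := hL w wm; have := ler_norm L; lra.
  rewrite mulrC -ler_pdivlMr//; apply: le_trans (ltW yx) _.
  by rewrite invfM mulrA.
have h1 := Lb m ltac:(lra); have h2 := Lb z ltac:(lra).
have h3 : X (set_val x) z <= X (set_val x) m.
  by apply: (flow_nondecreasing FX0 GK); lra.
by move: h1 h2; rewrite ltr_norml !ler_norml; lra.
Unshelve. all: try by end_near. all: lra. Qed.

Lemma flow_path_out m : ~ (0 < m < 1) -> flow_path m = flow_path 2^-1.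
Proof.
move=> m01; rewrite /flow_path.
apply/continuousEP => x /=; congr (X _ _).
by rewrite [LHS]/clamp01 ifF; [rewrite clamp01_id//; lra|exact/negbTE/negP].
Qed.

(** The open sets generate the sigma-algebra of the path space, and the
    preimage of an open set is left open inside ]0, 1[. *)
Lemma flow_path_measurable : measurable_fun setT flow_path.
Proof.
move=> _ A mA; rewrite setTI; move: A mA.
pose S := [set A : set (Gamma R) | measurable (flow_path @^-1` A)].
suff : <<s (@open (Gamma R)) >> `<=` S by apply.
apply: smallest_sub.
  split.
  - by rewrite /S /= preimage_set0.
  - by move=> A SA; rewrite /S /= setTD -preimage_setC; exact: measurableC.
  - by move=> A_ SA; rewrite /S /= preimage_bigcup; exact: bigcupT_measurable.
move=> A oA; rewrite /S /=.
have -> : flow_path @^-1` A = (D `&` (flow_path @^-1` A)) `|`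
    (~` D `&` [set m | A (flow_path 2^-1)]).
  apply/seteqP; split => m /=; rewrite in_itv/=.
    move=> Am; have [m01|/negP m01] := boolP (0 < m < 1); [by left|right; split => //].
    by move: Am; rewrite flow_path_out.
  by case=> -[// m01]; rewrite (flow_path_out m01).
apply: measurableU; last first.
  apply: measurableI; first exact: measurableC.
  have [h|h] := pselect (A (flow_path 2^-1)).
    by rewrite (_ : [set _ | _] = setT)//; apply/seteqP; split.
  by rewrite (_ : [set _ | _] = set0)//; apply/seteqP; split.
apply: left_open_measurable => m [/=]; rewrite in_itv/= => m01 Am.
have [d d0 hd] := flow_path_left_continuous m01 oA Am.
exists (Num.min d m); first by rewrite lt_min d0; lra.
move=> z mz zm.
have h1 : Num.min d m <= d by rewrite ge_min lexx.
have h2 : Num.min d m <= m by rewrite ge_min lexx orbT.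
have z01 : 0 < z < 1 by lra.
by split; [rewrite /= in_itv|apply: hd => //; lra].
Qed.

End flow_paths.

(** * Joint measurability in path and time *)

Section measurable_helpers.
Context d (T : measurableType d).

Lemma measurable_bool_set (b : T -> bool) :
  measurable_fun setT b -> measurable [set x | b x].
Proof.
move=> mb; have := mb measurableT [set true] ltac:(by []).
by rewrite setTI (_ : _ @^-1` _ = [set x | b x])//; apply/seteqP; split.
Qed.

Lemma measurable_bigcap_rat (F : rat -> set T) :
  (forall q, measurable (F q)) -> measurable (\bigcap_q F q).
Proof.
move=> mF; rewrite -[X in measurable X]setCK setC_bigcap; apply: measurableC.
apply: countable_bigcupT_measurable => // q; exact: measurableC.
Qed.

End measurable_helpers.

Section joint_measurability.
Context {R : realType}.
Implicit Types (g : Gamma R) (s t : R).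

(** A continuous path exceeds c at t if and only if, for some k, it is at least
    c + 1/k at all rational times within 1/k of t. *)
Lemma path_at_jointly_measurable :
  measurable_fun setT (fun gt : Gamma R * R => path_at gt.1 gt.2).
Proof.
apply: (measurability (@RGenOInfty.G R)) => [|/= _ [_] [c] -> <-].
  exact: RGenOInfty.measurableE.
rewrite setTI.
pose B (k : nat) (q : rat) : set (Gamma R * R) :=
  [set gt | k.+1%:R^-1 <= `|ratr q - gt.2|] `|` [set gt | c + k.+1%:R^-1 <= path_at gt.1 (ratr q)].
have -> : (fun gt : Gamma R * R => path_at gt.1 gt.2) @^-1` `]c, +oo[ =
    \bigcup_k \bigcap_q B k q.
  apply/seteqP; split => -[g t] /=; rewrite in_itv/= andbT.
    move=> cg; pose e := path_at g t - c.
    have e0 : 0 < e by rewrite subr_gt0.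
    have e20 : 0 < e / 2 by rewrite divr_gt0.
    have /cvgrPdistC_lt/(_ _ e20) [d /= d0 hd] := @path_at_continuous R g t.
    pose r := Num.min d (e / 2).
    have r0 : 0 < r by rewrite lt_min d0 divr_gt0.
    have [k hk] : exists k, k.+1%:R^-1 < r.
      have [k _ hk] := near_infty_natSinv_lt (PosNum r0).
      by exists k; apply: hk => /=.
    exists k => // q _; rewrite /B /=.
    have [h|h] := leP k.+1%:R^-1 `|ratr q - t|; [by left|right].
    have : `|path_at g (ratr q) - path_at g t| < e / 2.
      apply: hd; rewrite /ball_/= distrC (lt_trans h)// (lt_le_trans hk)//.
      by rewrite ge_min lexx.
    have : k.+1%:R^-1 < e / 2 by rewrite (lt_le_trans hk)// ge_min lexx orbT.
    move=> h1; rewrite ltr_norml => /andP[h2 _]; apply/ltW.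
    rewrite -ltrBrDl; apply: lt_trans h1 _; rewrite /e in h2 *; lra.
  move=> [k _ hk]; rewrite ltNge; apply/negP => gc.
  have k0 : 0 < k.+1%:R^-1 :> R by rewrite invr_gt0.
  have /cvgrPdistC_lt/(_ _ k0) [d /= d0 hd] := @path_at_continuous R g t.
  pose r := Num.min d k.+1%:R^-1.
  have r0 : 0 < r by rewrite lt_min d0.
  have [q] := @rat_in_itvoo R t (t + r) ltac:(lra).
  rewrite in_itv/= => tq.
  have qt : `|t - ratr q| < r by rewrite ltr_norml; lra.
  have : `|path_at g (ratr q) - path_at g t| < k.+1%:R^-1.
    by apply: hd; rewrite /ball_/= (lt_le_trans qt)// ge_min lexx.
  case: (hk q I) => /=.
    rewrite leNgt distrC => /negP; case.
    by rewrite (lt_le_trans qt)// ge_min lexx orbT.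
  move=> h1; rewrite ltr_norml => /andP[_ h2]; move: h1 h2 gc; clear.
  by move: (k.+1%:R^-1) => K; lra.
apply: bigcupT_measurable => k; apply: measurable_bigcap_rat => q.
apply: measurableU; apply: measurable_bool_set; apply: measurable_fun_ler => //.
- apply: measurableT_comp => //; apply: measurable_funB => //.
- by apply: (measurableT_comp (eval_at_measurable (ratr q))).
Qed.

Lemma is_derive_realP (f : R -> R) t l : is_derive t 1 f l <->
  (forall e, 0 < e -> exists2 d, 0 < d & forall h, h != 0 -> `|h| < d ->
    `|(f (t + h) - f t) / h - l| <= e).
Proof.
have E (h : R) : h^-1 *: (f (h *: (1 : R) + t) - f t) = (f (t + h) - f t) / h.
  by rewrite /GRing.scale/= mulr1 mulrC [h + t]addrC.
split=> [[df <-] e e0|H].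
  have /cvgrPdistC_le/(_ _ e0) [d /= d0 hd] := df.
  exists d => // h h0 hd'; have := hd h; rewrite /ball_/= sub0r normrN => /(_ hd' h0).
  by rewrite E.
have cv : (h^-1 *: ((f \o shift t) (h *: (1 : R)) - f t)) @[h --> 0^'] --> l.
  apply/cvgrPdistC_le => e e0; have [d d0 hd] := H e e0.
  exists d => //= h; rewrite /ball_/= sub0r normrN => hd' h0.
  by rewrite E; exact: hd.
split; first by apply/cvg_ex; exists l.
exact: (cvg_lim (@Rhausdorff R) cv).
Qed.

(** The difference quotients are continuous in the increment off zero, so
    rational increments suffice. *)
Lemma path_is_derive_ratP g t l : is_derive t 1 (path_at g) l <->
  (forall k : nat, exists j : nat, forall q : rat, q != 0 -> `|ratr q| < j.+1%:R^-1 :> R ->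
    `|(path_at g (t + ratr q) - path_at g t) / ratr q - l| <= k.+1%:R^-1).
Proof.
rewrite is_derive_realP; split => [H k|H e e0].
  have [|d d0 hd] := H k.+1%:R^-1; first by rewrite invr_gt0.
  have [j _ hj] := near_infty_natSinv_lt (PosNum d0).
  exists j => q q0 qj; apply: hd; first by rewrite fmorph_eq0.
  by apply: lt_trans qj _; apply: (hj j) => /=.
have [k _ hk] := near_infty_natSinv_lt (PosNum e0).
have {}hk : k.+1%:R^-1 < e by apply: (hk k) => /=.
have [j hj] := H k; exists j.+1%:R^-1 => // h h0 hd.
apply: le_trans _ (ltW hk); rewrite leNgt; apply/negP => bad.
pose f (h : R) := `|(path_at g (t + h) - path_at g t) / h - l|.
have cf : {for h, continuous f}.
  apply: continuous_comp; last exact: norm_continuous.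
  apply: continuousB; last exact: cvg_cst.
  apply: continuousM; last by apply: continuousV => //; exact: cvg_id.
  apply: continuousB; last exact: cvg_cst.
  apply: (@continuous_comp _ _ _ (fun h => t + h) (path_at g)).
    by apply: continuousD; [exact: cvg_cst|exact: cvg_id].
  exact: path_at_continuous.
have : \forall x \near h, k.+1%:R^-1 < f x by exact: (cvgr_gt (f h) cf).
have : \forall x \near h, x != 0.
  exists `|h|; rewrite /= ?normr_gt0// => x; rewrite /ball_/=.
  by apply: contraTneq => ->; rewrite subr0 ltxx.
have : \forall x \near h, `|x| < j.+1%:R^-1.
  exists (j.+1%:R^-1 - `|h|); rewrite /= ?subr_gt0// => x; rewrite /ball_/= => hx.
  have -> : x = h - (h - x) by ring.
  by apply: le_lt_trans (ler_normB _ _) _; rewrite -ltrBrDl.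
move=> [d1 /= d10 h1] [d2 /= d20 h2] [d3 /= d30 h3].
pose r := Num.min d1 (Num.min d2 d3).
have r0 : 0 < r by rewrite !lt_min d10 d20.
have [q] := @rat_in_itvoo R h (h + r) ltac:(lra).
rewrite in_itv/= => hq.
have qr : `|h - ratr q| < r by rewrite ltr_norml; lra.
have b1 := h1 (ratr q); have b2 := h2 (ratr q); have b3 := h3 (ratr q).
move: b1 b2 b3; rewrite /ball_/= => b1 b2 b3.
have rd1 : r <= d1 by rewrite /r ge_min lexx.
have rd2 : r <= d2 by rewrite /r !ge_min lexx orbT.
have rd3 : r <= d3 by rewrite /r !ge_min lexx !orbT.
have {b1} b1 := b1 (lt_le_trans qr rd1).
have {b2} b2 := b2 (lt_le_trans qr rd2).
have {b3} b3 := b3 (lt_le_trans qr rd3).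
have q0 : q != 0 by rewrite -(fmorph_eq0 (@ratr R)).
by have := hj q q0 b1; rewrite leNgt; move/negP; apply; exact: b3.
Qed.

Lemma path_is_derive_measurable (L : Gamma R * R -> R) :
  measurable_fun setT L ->
  measurable [set gt : Gamma R * R | is_derive gt.2 1 (path_at gt.1) (L gt)].
Proof.
move=> mL.
pose DQ (q : rat) (gt : Gamma R * R) :=
  `|(path_at gt.1 (gt.2 + ratr q) - path_at gt.1 gt.2) / ratr q - L gt|.
pose E (k j : nat) (q : rat) : set (Gamma R * R) :=
  [set gt | (q != 0) && (`|ratr q| < j.+1%:R^-1 :> R) ==> (DQ q gt <= k.+1%:R^-1)].
have -> : [set gt : Gamma R * R | is_derive gt.2 1 (path_at gt.1) (L gt)] =
    \bigcap_k \bigcup_j \bigcap_q E k j q.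
  apply/seteqP; split => -[g t].
    move=> /path_is_derive_ratP h k _; have [j hj] := h k.
    by exists j => // q _; apply/implyP => /andP[q0 qj]; exact: hj.
  move=> h; apply/path_is_derive_ratP => k; have [j _ hj] := h k I.
  exists j => q q0 qj; have := hj q I; rewrite /E /= q0 qj.
  by apply.
apply: bigcapT_measurable => k; apply: bigcupT_measurable => j.
apply: measurable_bigcap_rat => q; rewrite /E.
case: (_ && _); rewrite /=; last first.
  by rewrite (_ : [set _ | _] = setT)//; apply/seteqP; split.
apply: measurable_bool_set; apply: measurable_fun_ler => //.
apply: measurableT_comp => //; apply: measurable_funB => //.
apply: measurable_funM => //; apply: measurable_funB; last exact: path_at_jointly_measurable.
have m2 : measurable_fun setT (fun gt : Gamma R * R => (gt.1, gt.2 + ratr q)).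
  by apply: measurable_fun_pair => //; apply: measurable_funD.
exact: (measurableT_comp path_at_jointly_measurable m2).
Qed.

End joint_measurability.

(** * The velocity as a function of position and time *)

Section upper_limit.
Context {R : realType}.

(** A total substitute for the limit that is measurable in parameters. *)
Definition upper_lim (u : nat -> R) : R := fine (limn_esup (EFin \o u)).

Lemma upper_limE (u : nat -> R) l : u n @[n --> \oo] --> l -> upper_lim u = l.
Proof.
move=> ul; have ul' : (EFin \o u) n @[n --> \oo] --> l%:E.
  by apply/fine_cvgP; split; [exact: nearW|exact: ul].
rewrite /upper_lim is_cvg_limn_esupE; last by apply/cvg_ex; exists l%:E.
by rewrite (cvg_lim _ ul').
Qed.

Lemma upper_lim_measurable d (T : measurableType d) (u : nat -> T -> R) :
  (forall n, measurable_fun setT (u n)) ->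
  measurable_fun setT (fun x => upper_lim (u ^~ x)).
Proof.
move=> mu; apply: measurableT_comp => //.
apply: (@measurable_fun_limn_esup _ _ _ _ (fun n x => (u n x)%:E)) => n.
exact/measurable_EFinP.
Qed.

Lemma is_derive_quotient (f : R -> R) (t l : R) : is_derive t 1 f l ->
  (n.+1%:R * (f (t + n.+1%:R^-1) - f t)) @[n --> \oo] --> l.
Proof.
move=> /is_derive_realP H; apply/cvgrPdistC_le => e e0.
have [d d0 hd] := H e e0.
have [N _ hN] := near_infty_natSinv_lt (PosNum d0).
exists N => // n /= Nn; have := hd n.+1%:R^-1.
rewrite invr_neq0// ger0_norm// => /(_ isT (hN n Nn)).
by rewrite invrK mulrC.
Qed.

End upper_limit.

Section velocity_measurability.
Context {R : realType}.

Lemma is_derive_velocity (g : Gamma R) (t l : R) :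
  is_derive t 1 (path_at g) l -> velocity g t = l.
Proof. by move=> [_ <-]; rewrite /velocity derive1E. Qed.

Lemma derivable_velocity (g : Gamma R) (t : R) :
  derivable (path_at g) t 1 -> is_derive t 1 (path_at g) (velocity g t).
Proof. by move=> dg; split => //; rewrite /velocity derive1E. Qed.

Lemma velocity_not_derivable (g : Gamma R) (t : R) :
  ~ derivable (path_at g) t 1 -> velocity g t = 0.
Proof. by move=> ndg; rewrite /velocity derive1E; exact: dvgP. Qed.

Definition right_quotient_lim (gt : Gamma R * R) : R :=
  upper_lim (fun n => n.+1%:R * (path_at gt.1 (gt.2 + n.+1%:R^-1) - path_at gt.1 gt.2)).

Lemma path_at_shift_measurable (r : R) :
  measurable_fun setT (fun gt : Gamma R * R => path_at gt.1 (gt.2 + r)).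
Proof.
have m2 : measurable_fun setT (fun gt : Gamma R * R => (gt.1, gt.2 + r)).
  by apply: measurable_fun_pair => //; apply: measurable_funD.
exact: (measurableT_comp path_at_jointly_measurable m2).
Qed.

Lemma right_quotient_lim_measurable : measurable_fun setT right_quotient_lim.
Proof.
apply: upper_lim_measurable => n; apply: measurable_funM => //.
apply: measurable_funB; first exact: path_at_shift_measurable.
exact: path_at_jointly_measurable.
Qed.

(** Where the path is derivable its derivative is the limit of the right
    difference quotients with increments 1/n, and the set of such points is
    measurable. *)
Lemma velocity_measurable :
  measurable_fun setT (fun gt : Gamma R * R => velocity gt.1 gt.2).
Proof.
have mE := path_is_derive_measurable right_quotient_lim_measurable.
have -> : (fun gt : Gamma R * R => velocity gt.1 gt.2) =
    right_quotient_lim \_ [set gt : Gamma R * R |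
      is_derive gt.2 1 (path_at gt.1) (right_quotient_lim gt)].
  apply/funext => -[g t]; rewrite patchE; case: ifPn => /=.
    by rewrite inE /= => /is_derive_velocity.
  rewrite notin_setE /= => nd; apply: velocity_not_derivable => dg; apply: nd.
  have dv := derivable_velocity dg.
  have -> // : right_quotient_lim (g, t) = velocity g t.
  exact: (upper_limE (is_derive_quotient dv)).
apply/(measurable_restrictT _ mE); apply: measurable_funTS.
exact: right_quotient_lim_measurable.
Qed.

Lemma velocity_at_measurable (t : R) :
  measurable_fun setT (fun g : Gamma R => velocity g t).
Proof.
have m2 : measurable_fun setT (fun g : Gamma R => (g, t)).
  exact: measurable_fun_pair.
exact: (measurableT_comp velocity_measurable m2).
Qed.

End velocity_measurability.

Section flow_map.
Context {R : realType}.
Variable X : R -> R -> R.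
Hypothesis Xnd : forall t, nondecr01 (X t).
Hypothesis Xleft : forall t m c, 0 < m < 1 -> c < X t m ->
  \forall m' \near m^'-, c <= X t m'.
Hypothesis Xtime : forall m, 0 < m < 1 -> continuous (X ^~ m).
Hypothesis Xsticky : forall s t m m', 0 < s -> s <= t -> 0 < m < 1 ->
  0 < m' < 1 -> X s m = X s m' -> X t m = X t m'.

Definition rational01 (k : nat) : R := clamp01 (ratr (odflt 0 (unpickle k : option rat))).

Lemma rational01_in k : 0 < rational01 k < 1.
Proof. exact: clamp01_in. Qed.

Lemma rational01_dense (a b : R) : 0 <= a -> a < b -> b <= 1 ->
  exists k, a < rational01 k < b.
Proof.
move=> a0 ab b1; have [q] := @rat_in_itvoo R a b ab.
rewrite in_itv/= => qab; exists (pickle q).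
by rewrite /rational01 pickleK/= clamp01_id//; lra.
Qed.

(** The position at time t of the particles found at x at time s: the highest
    position at time t of a rational label that is at time s at or below x.
    By left continuity and stickiness this does not depend on which label is
    found at x. *)
Definition flow_map (s t x : R) : R :=
  fine (esups (fun k => if X s (rational01 k) <= x
                        then (X t (rational01 k))%:E else -oo%E) 0).

(** Rational labels to the left of m approach X t m by left continuity.  A
    rational label to the right of m that is at time s not above X s m is at
    X s m, hence at time t at X t m. *)
Lemma flow_mapE s t m : 0 < s -> s <= t -> 0 < m < 1 ->
  flow_map s t (X s m) = X t m.
Proof.
move=> s0 st m01; rewrite /flow_map.
suff -> : esups (fun k => if X s (rational01 k) <= X s m
    then (X t (rational01 k))%:E else -oo%E) 0 = (X t m)%:E by [].
apply/eqP; rewrite eq_le; apply/andP; split.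
  apply: ub_ereal_sup => _ [k _ <-] /=.
  have k01 := rational01_in k.
  case: ifPn => [Xk|_]; last by rewrite leNye.
  rewrite lee_fin.
  have [km|mk] := leP (rational01 k) m; first by apply: Xnd; lra.
  have -> // : X t (rational01 k) = X t m.
  apply: (Xsticky s0 st) => //; apply/eqP; rewrite eq_le Xk/=.
  by apply: Xnd; lra.
apply/lee_addgt0Pr => e e0.
rewrite -leeBlDr// -EFinB.
have Xe : X t m - e < X t m by lra.
have [d /= d0 hd] := Xleft m01 Xe.
have [k hk] := @rational01_dense (Num.max 0 (m - d)) m ltac:(by rewrite le_max lexx)
  ltac:(by rewrite gt_max; lra) ltac:(lra).
move: hk => /andP[+ km]; rewrite gt_max => /andP[k0 dk].
apply: (@le_trans _ _ (X t (rational01 k))%:E).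
  rewrite lee_fin; apply: hd => //.
  by rewrite /ball_/= ltr_norml; lra.
apply: ereal_sup_ubound; exists k => //=.
by rewrite (Xnd _ k0 (ltW km) _) //; lra.
Qed.

Lemma flow_map_measurable d (T : measurableType d) (a b x : T -> R) :
  measurable_fun setT a -> measurable_fun setT b -> measurable_fun setT x ->
  measurable_fun setT (fun z => flow_map (a z) (b z) (x z)).
Proof.
move=> ma mb mx; apply: measurableT_comp => //.
apply: (@measurable_fun_esups _ _ _ _ (fun k z => if X (a z) (rational01 k) <= x z
   then (X (b z) (rational01 k))%:E else -oo%E)) => k.
have mX : measurable_fun setT (X ^~ (rational01 k)).
  by apply: continuous_measurable_fun; exact: Xtime (rational01_in k).
apply: measurable_fun_ifT => //.
- by apply: measurable_fun_ler => //; exact: (measurableT_comp mX ma).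
- by apply/measurable_EFinP; exact: (measurableT_comp mX mb).
Qed.

(** The right derivative at t of the trajectory that starts from x at t. *)
Definition velocity_field (xt : R * R) : R :=
  upper_lim (fun n => n.+1%:R * (flow_map xt.2 (xt.2 + n.+1%:R^-1) xt.1 - xt.1)).

Lemma velocity_field_measurable : measurable_fun setT velocity_field.
Proof.
apply: upper_lim_measurable => n; apply: measurable_funM => //.
apply: measurable_funB => //; apply: flow_map_measurable => //.
by apply: measurable_funD.
Qed.

Lemma velocity_fieldE (f : R -> R) (t l m : R) : 0 < m < 1 -> 0 < t ->
  (forall s, 0 < s -> f s = X s m) ->
  is_derive t 1 f l -> velocity_field (f t, t) = l.
Proof.
move=> m01 t0 fX /is_derive_quotient H; rewrite -(upper_limE H).
congr upper_lim; apply/funext => n /=; congr (_ * (_ - _)).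
by rewrite !fX// ?flow_mapE// ?addr_gt0// lerDl.
Qed.

End flow_map.

(** * Functions orthogonal to a random variable, and energy *)

Section orthogonality.
Context {R : realType} d (T : measurableType d) (P : probability T R).
Variables X Y : T -> R.
Hypothesis mX : measurable_fun setT X.
Hypothesis iY : P.-integrable setT (EFin \o Y).
Hypothesis Y_sublevel : forall c : R, \int[P]_(x in [set x | X x < c]) Y x = 0.

Let aeF := ae_filter_ringOfSetsType P.

Let mY : measurable_fun setT Y.
Proof. by have /integrableP[/measurable_EFinP] := iY. Qed.

Let mpre (A : set R) : measurable A -> measurable (X @^-1` A).
Proof. by move=> mA; rewrite -[X in measurable X]setTI; exact: mX. Qed.

Let iYS (A : set T) : measurable A -> P.-integrable A (EFin \o Y).
Proof. by move=> mA; apply: integrableS iY. Qed.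

Let Rint_cvg (A_ : nat -> set T) (A : set T) : (forall n, measurable (A_ n)) ->
  measurable A -> (forall x, \forall n \near \oo, (x \in A_ n) = (x \in A)) ->
  \int[P]_(x in A_ n) Y x @[n --> \oo] --> \int[P]_(x in A) Y x.
Proof.
move=> mA_ mA cv; rewrite Rintegral_mkcond.
under eq_fun do rewrite Rintegral_mkcond.
apply: (Rdominated_cvg measurableT _ _ _ (integrable_norm iY)).
- by move=> n; apply/(measurable_restrictT _ (mA_ n)); exact: measurable_funTS.
- by apply/(measurable_restrictT _ mA); exact: measurable_funTS.
- apply: nearW => x _; apply: cvg_near_cst.
  by have := cv x; apply: filterS => n e; rewrite !patchE e.
- by apply: nearW => x n _ /=; rewrite patchE; case: ifP => // _; rewrite normr0.
Qed.

(** The sets with this property form a Dynkin class, and the half lines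
    generate the Borel sets. *)
Lemma orthogonal_set (S : set R) : measurable S ->
  \int[P]_(x in X @^-1` S) Y x = 0.
Proof.
pose H := [set A : set R | measurable A /\ \int[P]_(x in X @^-1` A) Y x = 0].
pose G := @RGenInftyO.G R.
suff GH : <<s G >> `<=` H.
  have mE : @measurable _ R = <<s G >> by exact: RGenInftyO.measurableE.
  by rewrite mE => /GH[].
have mG c : measurable (`]-oo, c[%classic : set R) by [].
have GE c : X @^-1` `]-oo, c[%classic = [set x | X x < c].
  by apply/seteqP; split => x /=; rewrite in_itv.
have IG : setI_closed G.
  move=> _ _ [a ->] [b ->]; exists (Num.min a b).
  by apply/seteqP; split => x /=; rewrite !in_itv/= lt_min; [by move=> [-> ->]|by move=> /andP[]].
have GH : G `<=` H by move=> _ [c ->]; split => //; rewrite GE.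
suff lH : lambda_system setT H by exact: (lambda_system_subset IG lH GH).
split => //.
- split => //; apply: cvg_eq_limit (_ : (0 : R) @[_ --> \oo] --> 0); last exact: cvg_cst.
  rewrite preimage_setT.
  have -> : (fun _ : nat => 0 : R) = (fun n => \int[P]_(x in [set x | X x < n%:R]) Y x).
    by apply/funext => n; rewrite Y_sublevel.
  apply: Rint_cvg => //.
    by move=> n; rewrite -GE; exact: mpre.
  move=> x; exists (Num.truncn `|X x|).+1 => // n /= hn.
  rewrite [RHS]mem_set// mem_set//=; apply: le_lt_trans (ler_norm _) _.
  by apply: lt_le_trans (truncnS_gt _) _; rewrite ler_nat.
- move=> A B BA [mA A0] [mB B0]; split; first exact: measurableD.
  have : \int[P]_(x in X @^-1` B `|` X @^-1` (A `\` B)) Y x = 0.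
    rewrite -preimage_setU setDUK//; exact: A0.
  rewrite Rintegral_setU//.
  + by rewrite B0 add0r.
  + exact: mpre.
  + by apply: mpre; exact: measurableD.
  + by apply: iYS; apply: measurableU; apply: mpre => //; exact: measurableD.
  + by apply/disj_setPS => x [/= ? []].
- move=> A ndA HA; split; first by apply: bigcupT_measurable => n; have [] := HA n.
  apply: cvg_eq_limit (_ : (0 : R) @[_ --> \oo] --> 0); last exact: cvg_cst.
  have -> : (fun _ : nat => 0 : R) = (fun n => \int[P]_(x in X @^-1` (A n)) Y x).
    by apply/funext => n; have [] := HA n.
  apply: Rint_cvg.
  + by move=> n; apply: mpre; have [] := HA n.
  + by apply: mpre; apply: bigcupT_measurable => n; have [] := HA n.
  move=> x; have [[k _ Ak]|nA] := pselect ((\bigcup_n A n) (X x)).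
    exists k => // n /= kn; rewrite [RHS]mem_set//; last by exists k.
    by rewrite mem_set//=; have /subsetPset := ndA _ _ kn; apply.
  apply: nearW => n; rewrite [RHS]memNset// memNset//= => An.
  by apply: nA; exists n.
Qed.

Lemma integrable_bounded_comp (r : R -> R) (b : R) : measurable_fun setT r ->
  (forall x, `|r x| <= b) -> P.-integrable setT (EFin \o (fun x => r (X x) * Y x)).
Proof.
move=> mr rb.
have i : P.-integrable setT (EFin \o (fun x => b * `|Y x|)).
  exact: (integrableZl _ b (integrable_norm iY)).
apply: le_integrable i => //.
  apply/measurable_EFinP; apply: measurable_funM => //.
  exact: (measurableT_comp mr mX).
move=> x _; rewrite lee_fin normrM (ger0_norm (mulr_ge0 _ _))//; last first.
  by apply: le_trans (rb 0); exact: normr_ge0.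
by apply: ler_wpM2r.
Qed.

(** Subtracting b / 2 times the indicator of {r >= b / 2} halves the range of
    r and does not change the integral, by [orthogonal_set]. *)
Lemma orthogonal_ge0_le (n : nat) (r : R -> R) (b : R) : measurable_fun setT r ->
  (forall x, 0 <= r x <= b) ->
  `|\int[P]_x (r (X x) * Y x)| <= b / 2 ^+ n * \int[P]_x `|Y x|.
Proof.
elim: n r b => [|n IH] r b mr rb.
  rewrite expr0 divr1.
  have b0 : 0 <= b by have := rb 0; lra.
  have rb' x : `|r x| <= b by rewrite ger0_norm; have := rb x; lra.
  apply: le_trans (le_normr_Rintegral _ _) _ => //.
    exact: integrable_bounded_comp rb'.
  rewrite -RintegralZl//; last exact: (integrable_norm iY).
  apply: le_Rintegral => //.
  - by apply: (integrable_norm (integrable_bounded_comp mr rb')).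
  - exact: (integrableZl _ b (integrable_norm iY)).
  by move=> x _; rewrite normrM; apply: ler_wpM2r.
pose A := [set x | b / 2 <= r x].
have mA : measurable A.
  by apply: measurable_bool_set; apply: measurable_fun_ler.
pose r' x := r x - b / 2 * \1_A x.
have mr' : measurable_fun setT r'.
  by apply: measurable_funB => //; apply: measurable_funM.
have r'b x : 0 <= r' x <= b / 2.
  rewrite /r' indicE; have := rb x.
  have [h|h] := leP (b / 2) (r x); first by rewrite mem_set//=; lra.
  by rewrite memNset/=; [lra|rewrite /A /= leNgt h].
suff -> : \int[P]_x (r (X x) * Y x) = \int[P]_x (r' (X x) * Y x).
  apply: le_trans (IH _ _ mr' r'b) _; rewrite le_eqVlt; apply/orP; left; apply/eqP.
  by congr (_ * _); rewrite exprS invfM; ring.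
have ir' : P.-integrable setT (EFin \o (fun x => r' (X x) * Y x)).
  apply: (@integrable_bounded_comp _ (b / 2)) => // x.
  by rewrite ger0_norm; have := r'b x; lra.
have i1 : P.-integrable setT (EFin \o (fun x => \1_A (X x) * Y x)).
  apply: (@integrable_bounded_comp _ 1) => // x.
  by rewrite indicE; case: (_ \in _); rewrite ?normr1 ?normr0.
have i2 : P.-integrable setT (EFin \o (fun x => b / 2 * (\1_A (X x) * Y x))).
  exact: (integrableZl _ (b / 2) i1).
transitivity (\int[P]_x (r' (X x) * Y x + b / 2 * (\1_A (X x) * Y x))).
  by apply: eq_Rintegral => x _; rewrite /r'; ring.
rewrite RintegralD// RintegralZl// (_ : \int[P]_x (\1_A (X x) * Y x) = 0).
  by rewrite mulr0 addr0.
rewrite -(orthogonal_set mA) [RHS]Rintegral_mkcond; apply: eq_Rintegral => x _.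
by rewrite patchE indicE; case: ifPn; rewrite ?inE ?notin_setE /= => Ax;
  [rewrite mem_set// mul1r|rewrite memNset// mul0r].
Qed.

Lemma orthogonal_bounded (h : R -> R) (b : R) : measurable_fun setT h ->
  (forall x, `|h x| <= b) -> \int[P]_x (h (X x) * Y x) = 0.
Proof.
move=> mh hb.
have hb' x : 0 <= h x + b <= 2 * b.
  by have := hb x; rewrite ler_norml; lra.
have mh' : measurable_fun setT (fun x => h x + b) by apply: measurable_funD.
have Z : \int[P]_x ((h (X x) + b) * Y x) = 0.
  apply/eqP; rewrite -normr_le0; apply/ler_addgt0Pr => /= e e0; rewrite add0r.
  pose C := 2 * b * \int[P]_x `|Y x|.
  have [n] : exists n, C / e < 2 ^+ n.
    exists (Num.truncn `|C / e|).+1.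
    apply: le_lt_trans (ler_norm _) _; apply: lt_le_trans (truncnS_gt _) _.
    by rewrite -natrX ler_nat ltnW// ltn_expl.
  rewrite ltr_pdivrMr// => hn.
  apply: le_trans (orthogonal_ge0_le n mh' hb') _.
  by rewrite mulrAC ler_pdivrMr ?exprn_gt0//; apply/ltW; rewrite [e * _]mulrC.
have ih := integrable_bounded_comp mh hb.
have ib : P.-integrable setT (EFin \o (fun x => b * Y x)).
  exact: (integrableZl _ b iY).
have Y0 : \int[P]_x Y x = 0.
  by have := orthogonal_set measurableT; rewrite preimage_setT.
move: Z; rewrite (_ : \int[P]_x _ = \int[P]_x (h (X x) * Y x + b * Y x)).
  by rewrite RintegralD// RintegralZl// Y0 mulr0 addr0.
by apply: eq_Rintegral => x _; ring.
Qed.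

End orthogonality.

Section energy.
Context {R : realType} d (T : measurableType d) (P : probability T R).
Variables X A V : T -> R.
Hypothesis mX : measurable_fun setT X.
Hypothesis iA : P.-integrable setT (EFin \o A).
Hypothesis iV : P.-integrable setT (EFin \o V).
Hypothesis A_projection : forall (h : R -> R) (b : R), measurable_fun setT h ->
  (forall x, `|h x| <= b) -> \int[P]_x (h (X x) * (A x - V x)) = 0.
Variable w : R -> R.
Hypothesis mw : measurable_fun setT w.
Hypothesis A_function : {ae P, forall x, A x = w (X x)}.

Let trunc (n : nat) (x : R) : R := if `|w x| <= n%:R then w x else 0.

Let mtrunc n : measurable_fun setT (trunc n).
Proof.
apply: measurable_fun_ifT => //.
by apply: measurable_fun_ler => //; exact: measurableT_comp.
Qed.

Let truncb n x : `|trunc n x| <= n%:R.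
Proof. by rewrite /trunc; case: ifP => //; rewrite normr0. Qed.

Let mA : measurable_fun setT A.
Proof. by have /integrableP[/measurable_EFinP] := iA. Qed.

Let mV : measurable_fun setT V.
Proof. by have /integrableP[/measurable_EFinP] := iV. Qed.

Let trunc_energy n : (\int[P]_x ((trunc n (X x)) ^+ 2)%:E <= \int[P]_x ((V x) ^+ 2)%:E)%E.
Proof.
have [->|] := eqVneq (\int[P]_x ((V x) ^+ 2)%:E)%E +oo%E; first by rewrite leey.
rewrite -ltey => V2.
have mt : measurable_fun setT (fun x => trunc n (X x)).
  exact: (measurableT_comp (mtrunc n) mX).
have iV2 : P.-integrable setT (EFin \o (fun x => (V x) ^+ 2)).
  apply/integrableP; split; first by apply/measurable_EFinP; exact: measurable_funX.
  by under eq_integral => x _ do rewrite /= ger0_norm ?sqr_ge0//.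
have iAV : P.-integrable setT (EFin \o (fun x => A x - V x)).
  by have := integrableB measurableT iA iV.
have ih : P.-integrable setT (EFin \o (fun x => trunc n (X x) * (A x - V x))).
  exact: (integrable_bounded_comp mX iAV (mtrunc n) (truncb n)).
have i2h : P.-integrable setT (EFin \o (fun x => 2 * (trunc n (X x) * (A x - V x)))).
  exact: (integrableZl _ 2 ih).
have it2 : P.-integrable setT (EFin \o (fun x => (trunc n (X x)) ^+ 2)).
  have i1 : P.-integrable setT (EFin \o cst (n%:R ^+ 2)).
    exact: finite_measure_integrable_cst.
  apply: le_integrable i1 => //; first by apply/measurable_EFinP; exact: measurable_funX.
  move=> x _ /=; rewrite lee_fin !normrX ler_pXn2r ?nnegrE// (ger0_norm (ler0n _ _)).
  exact: truncb.
have iD : P.-integrable setT (EFin \o (fun x => (V x) ^+ 2 - (trunc n (X x)) ^+ 2)).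
  by have := integrableB measurableT iV2 it2.
have : 0 <= \int[P]_x ((V x) ^+ 2 - (trunc n (X x)) ^+ 2).
  have -> : \int[P]_x ((V x) ^+ 2 - (trunc n (X x)) ^+ 2) =
      \int[P]_x ((V x) ^+ 2 - (trunc n (X x)) ^+ 2 + 2 * (trunc n (X x) * (A x - V x))).
    by rewrite [RHS]RintegralD// RintegralZl// (A_projection (mtrunc n) (truncb n)) mulr0 addr0.
  rewrite /Rintegral (ae_eq_integral (EFin \o (fun x => (V x - trunc n (X x)) ^+ 2)))//.
  - by apply: fine_ge0; apply: integral_ge0 => x _; rewrite lee_fin sqr_ge0.
  - apply/measurable_EFinP; apply: measurable_funD.
      by apply: measurable_funB; exact: measurable_funX.
    by apply: measurable_funM => //; apply: measurable_funM => //; exact: measurable_funB.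
  - by apply/measurable_EFinP; apply: measurable_funX; exact: measurable_funB.
  - have aeF := ae_filter_ringOfSetsType P.
    apply: filterS A_function => x Aw _ /=; congr _%:E.
    by rewrite Aw /trunc; case: ifP => _; ring.
rewrite RintegralB// subr_ge0 => le2.
rewrite -(fineK (integrable_fin_num measurableT iV2)).
by rewrite -(fineK (integrable_fin_num measurableT it2)) lee_fin.
Qed.

(** The hypotheses say that A is the conditional expectation of V given X.
    For the truncation k of w, A k = k ^ 2 almost everywhere, and testing with k
    turns the integral of V ^ 2 - k ^ 2 into that of (V - k) ^ 2. *)
Lemma projection_energy_le :
  (\int[P]_x ((A x) ^+ 2)%:E <= \int[P]_x ((V x) ^+ 2)%:E)%E.
Proof.
have mt n : measurable_fun setT (fun x => ((trunc n (X x)) ^+ 2)%:E).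
  apply/measurable_EFinP; apply: measurable_funX.
  exact: (measurableT_comp (mtrunc n) mX).
rewrite (ae_eq_integral (fun x => ((w (X x)) ^+ 2)%:E)) => //; first last.
- have aeF := ae_filter_ringOfSetsType P.
  by apply: filterS A_function => x -> _.
- by apply/measurable_EFinP; apply: measurable_funX; exact: (measurableT_comp mw mX).
- by apply/measurable_EFinP; exact: measurable_funX.
have cvt x : ((trunc n (X x)) ^+ 2)%:E @[n --> \oo] --> ((w (X x)) ^+ 2)%:E.
  apply: cvg_near_cst; exists (Num.truncn `|w (X x)|).+1 => // n /= hn.
  rewrite /trunc ifT//; apply: ltW; apply: lt_le_trans (truncnS_gt _) _.
  by rewrite ler_nat.
have -> : (fun x => ((w (X x)) ^+ 2)%:E) = (fun x => limn (fun n => ((trunc n (X x)) ^+ 2)%:E)).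
  by apply/funext => x; rewrite (cvg_lim _ (cvt x)).
have nd x : {homo (fun n => ((trunc n (X x)) ^+ 2)%:E) : a b / (a <= b)%N >-> (a <= b)%E}.
  move=> a b ab; rewrite lee_fin /trunc.
  have [wa|wa] := leP `|w (X x)| a%:R; last by rewrite expr0n/= sqr_ge0.
  by rewrite ifT//; apply: le_trans wa _; rewrite ler_nat.
rewrite monotone_convergence//.
- apply: lime_le; last by apply: nearW => n; exact: trunc_energy.
  apply: ereal_nondecreasing_is_cvgn => a b ab; apply: ge0_le_integral => //.
  + by move=> x _; rewrite lee_fin sqr_ge0.
  + by move=> x _; exact: nd.
- by move=> n x _; rewrite lee_fin sqr_ge0.
Qed.

End energy.

(** * Quantile functions *)

Section quantile.
Context {R : realType}.
Variable rho : probability R R.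
Local Notation U := (@unif R).

Definition mass_below (x : R) : \bar R := rho `]-oo, x]%classic.

Lemma mass_below_nondecreasing (x y : R) : x <= y -> (mass_below x <= mass_below y)%E.
Proof.
move=> xy; apply: le_measure; rewrite ?inE// => z /=.
by rewrite !in_itv/=; lra.
Qed.

Lemma mass_below_right_continuous (x : R) (m : \bar R) :
  (forall y, x < y -> (m <= mass_below y)%E) -> (m <= mass_below x)%E.
Proof.
move=> h; rewrite /mass_below.
have -> : `]-oo, x]%classic = \bigcap_n `]-oo, x + n.+1%:R^-1]%classic.
  apply/seteqP; split => z /=; rewrite in_itv/=.
    move=> zx n _ /=; rewrite in_itv/=.
    have : 0 < n.+1%:R^-1 :> R by rewrite invr_gt0.
    by move: (n.+1%:R^-1) => K; lra.
  move=> hz; apply/ler_addgt0Pr => e e0.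
  have [k _ hk] := near_infty_natSinv_lt (PosNum e0).
  have := hz k I; rewrite /= in_itv/=.
  by have := hk k (leqnn k) => /=; move: (k.+1%:R^-1) => K; lra.
have cv : (rho \o (fun n : nat => `]-oo, x + n.+1%:R^-1]%classic)) n @[n --> \oo] -->
    rho (\bigcap_n `]-oo, x + n.+1%:R^-1]%classic).
  apply: nonincreasing_cvg_mu => //.
  - by rewrite (le_lt_trans (probability_le1 _ _)) ?ltry.
  - exact: bigcapT_measurable.
  move=> a b ab; apply/subsetPset => z /=; rewrite !in_itv/= => /le_trans; apply.
  by rewrite lerD2l lef_pV2 ?posrE// ler_nat.
apply: cvge_ge cv; apply: nearW => n /=; apply: h.
by rewrite ltrDl invr_gt0.
Qed.

Lemma mass_below_large (m : R) : m < 1 -> exists x, (m%:E <= mass_below x)%E.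
Proof.
move=> m1; apply/not_existsP => h.
have cv : (rho \o (fun n : nat => `]-oo, n%:R : R]%classic)) n @[n --> \oo] -->
    rho (\bigcup_n `]-oo, n%:R : R]%classic).
  apply: nondecreasing_cvg_mu => //.
    exact: bigcupT_measurable.
  move=> a b ab; apply/subsetPset => z /=; rewrite !in_itv/= => /le_trans; apply.
  by rewrite ler_nat.
have E : \bigcup_n `]-oo, n%:R : R]%classic = setT.
  apply/seteqP; split => // z _; exists (Num.truncn `|z|).+1 => //=.
  rewrite in_itv/=; apply: le_trans (ler_norm _) _; apply/ltW.
  exact: truncnS_gt.
have : (1%:E <= m%:E :> \bar R)%E.
  rewrite -(probability_setT rho) -E; apply: cvge_le cv.
  apply: nearW => n /=; have := h n%:R.
  by rewrite leNgt => /negP; rewrite negbK => /ltW.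
by rewrite lee_fin; lra.
Qed.

Lemma mass_below_small (m : R) : 0 < m ->
  exists x, forall y, (m%:E <= mass_below y)%E -> x <= y.
Proof.
move=> m0; apply/not_existsP => h.
have cv : (rho \o (fun n : nat => `]-oo, - n%:R : R]%classic)) n @[n --> \oo] -->
    rho (\bigcap_n `]-oo, - n%:R : R]%classic).
  apply: nonincreasing_cvg_mu => //.
  - by rewrite (le_lt_trans (probability_le1 _ _)) ?ltry.
  - exact: bigcapT_measurable.
  move=> a b ab; apply/subsetPset => z /=; rewrite !in_itv/= => /le_trans; apply.
  by rewrite lerN2 ler_nat.
have E : \bigcap_n `]-oo, - n%:R : R]%classic = set0.
  apply/seteqP; split => // z /(_ (Num.truncn `|z|).+1 I) /=.
  rewrite in_itv/= => hz; have := truncnS_gt `|z|.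
  by have := ler_norm (- z); rewrite normrN; move: hz; move: (_.+1%:R) => K; lra.
have : (m%:E <= 0 :> \bar R)%E.
  rewrite -(measure0 rho) -E; apply: cvge_ge cv.
  apply: nearW => n /=; have /existsNP[y /not_implyP[my yn]] := h (- n%:R).
  by apply: le_trans my _; apply: mass_below_nondecreasing; apply/ltW; rewrite ltNge; apply/negP.
by rewrite lee_fin; lra.
Qed.

Definition quantile (m : R) : R :=
  if 0 < m < 1 then inf [set x | (m%:E <= mass_below x)%E] else 0.

(** This Galois connection characterises the quantile function and holds
    because x |-> rho ]-oo, x] is right continuous. *)
Lemma quantile_le (m x : R) : 0 < m < 1 ->
  (quantile m <= x) = (m%:E <= mass_below x)%E.
Proof.
move=> m01; rewrite /quantile m01.
have [y0 hy0] := @mass_below_large m ltac:(lra).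
have [x0 hx0] := @mass_below_small m ltac:(lra).
have hi : has_inf [set x | (m%:E <= mass_below x)%E].
  by split; [exists y0|exists x0 => y; exact: hx0].
apply/idP/idP => [le|mx].
  apply: mass_below_right_continuous => y xy.
  have [z /= mz zy] := inf_lt hi.1 (le_lt_trans le xy).
  by apply: le_trans mz _; exact: mass_below_nondecreasing (ltW _).
by apply: ge_inf => //; case: hi.
Qed.

Lemma quantile_nondecreasing : nondecr01 quantile.
Proof.
move=> x y x0 xy y1; rewrite quantile_le; last lra.
apply: (@le_trans _ _ y%:E); first by rewrite lee_fin.
by rewrite -quantile_le; lra.
Qed.

(** Left continuity, in the form needed at time 0 for the flow. *)
Lemma quantile_left (m c : R) : 0 < m < 1 -> c < quantile m ->
  exists2 a, 0 < a < m & c <= quantile a.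
Proof.
move=> m01; rewrite ltNge quantile_le// -ltNge => h.
have fc : mass_below c \is a fin_num by rewrite fin_num_measure.
have c0 : 0 <= fine (mass_below c) by rewrite fine_ge0// measure_ge0.
move: h; rewrite -(fineK fc) lte_fin => h.
exists ((fine (mass_below c) + m) / 2); first lra.
apply/ltW; rewrite ltNge quantile_le; last lra.
by rewrite -(fineK fc) lee_fin; lra.
Qed.

Lemma quantile_measurable : measurable_fun setT quantile.
Proof.
have -> : quantile = quantile \_ `]0, 1[.
  apply/funext => m; rewrite patchE mem_setE in_itv/=.
  by case: ifP => // m01; rewrite /quantile m01.
apply/(measurable_restrictT _ (measurable_itv `]0%R, 1%R[)).
exact: nondecr01_measurable quantile_nondecreasing _ _.
Qed.

Lemma uniform_eq01 (A B : set R) : measurable A -> measurable B ->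
  A `&` `]0, 1[ = B `&` `]0, 1[ -> U A = U B.
Proof.
have H (C : set R) : measurable C -> U C = U (C `&` `]0, 1[).
  move=> mC; rewrite [LHS](@measureDI _ _ _ U C `]0, 1[%classic)//.
  have Z : U (C `\` `]0, 1[%classic) = 0%E.
    apply/eqP; rewrite eq_le; apply/andP; split; last exact: measure_ge0.
    rewrite -(@uniform_out R); apply: le_measure; rewrite ?inE//.
    - exact: measurableD.
    - exact: measurableC.
  by rewrite [X in (X + _)%E]Z add0e.
by move=> mA mB E; rewrite H// E -H.
Qed.

Lemma quantile_pushforward (A : set R) : measurable A ->
  rho A = U (quantile @^-1` A).
Proof.
pose q : {mfun R >-> R} := HB.pack quantile (isMeasurableFun.Build _ _ R R quantile quantile_measurable).
have E : U \o (fun B => quantile @^-1` B) = distribution U q by [].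
move=> mA; rewrite -[RHS]/((U \o (fun B => quantile @^-1` B)) A) E.
apply: (measure_unique (@RGenOInfty.G R) (fun n => `]- n%:R, +oo[%classic)) => //.
- exact: RGenOInfty.measurableE.
- move=> _ _ [a ->] [b ->]; exists (Num.max a b).
  apply/seteqP; split => x /=; rewrite !in_itv/= !andbT gt_max; first by move=> [-> ->].
  by move=> /andP[].
- by move=> n; exists (- n%:R).
- apply/seteqP; split => // z _; exists (Num.truncn `|z|).+1 => //=.
  rewrite in_itv/= andbT ltrNl; apply: le_lt_trans (truncnS_gt _).
  by rewrite -normrN ler_norm.
- move=> _ [x ->].
  change (rho `]x, +oo[%classic = U (quantile @^-1` `]x, +oo[%classic)).
  have fx : mass_below x \is a fin_num by rewrite fin_num_measure.
  have p0 : 0 <= fine (mass_below x) by rewrite fine_ge0// measure_ge0.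
  have p1 : fine (mass_below x) <= 1.
    by rewrite -lee_fin fineK// probability_le1.
  rewrite (@uniform_eq01 _ `]fine (mass_below x), 1]%classic)//.
  + rewrite uniform_oc// EFinB fineK// -[X in rho X]setCK setCitvr.
    by rewrite probability_setC.
  + by rewrite -[X in measurable X]setTI; exact: quantile_measurable.
  + apply/seteqP; split => m /=; rewrite !in_itv/= andbT => -[h m01]; split => //.
      move: h; rewrite ltNge quantile_le// -ltNge -(fineK fx) lte_fin; lra.
    by rewrite ltNge quantile_le// -ltNge -(fineK fx) lte_fin; lra.
- by move=> n; rewrite (le_lt_trans (probability_le1 _ _)) ?ltry.
Qed.

End quantile.

(** * Exchange of almost everywhere quantifiers, and Lipschitz paths *)

Lemma ae_dominated_integrable {R : realType} d (T : measurableType d)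
    (P : {measure set T -> \bar R}) (f g : T -> R) :
  measurable_fun setT f -> P.-integrable setT (EFin \o g) ->
  {ae P, forall x, `|f x| <= g x} -> P.-integrable setT (EFin \o f).
Proof.
move=> mf /integrableP[/measurable_EFinP mg ig] h; apply/integrableP; split.
  exact/measurable_EFinP.
apply: le_lt_trans ig; apply: ae_ge0_le_integral => //.
- by apply/measurable_EFinP; exact: measurableT_comp.
- by apply/measurable_EFinP; exact: measurableT_comp.
- have aeF := ae_filter_ringOfSetsType P.
  by apply: filterS h => x fg _; rewrite lee_fin (le_trans fg)// ler_norm.
Qed.

Section almost_everywhere_sections.
Context {R : realType} d1 d2 (T1 : measurableType d1) (T2 : measurableType d2).
Variable m1 : {sigma_finite_measure set T1 -> \bar R}.
Variable m2 : {sigma_finite_measure set T2 -> \bar R}.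
Variable A : set (T1 * T2).
Hypothesis mA : measurable A.

Lemma section_mass_measurable :
  measurable_fun setT (fun x => m2 (xsection (~` A) x)).
Proof. by apply: measurable_fun_xsection; exact: measurableC. Qed.

(** Tonelli for the indicator of the complement. *)
Lemma ae_section_swap :
  {ae m1, forall x, m2 (xsection (~` A) x) = 0%E} ->
  {ae m2, forall y, {ae m1, forall x, A (x, y)}}.
Proof.
move=> h.
have mC : measurable (~` A) by exact: measurableC.
have := indic_fubini_tonelli m1 m2 mC.
rewrite indic_fubini_tonelli_FE// indic_fubini_tonelli_GE//=.
rewrite (ae_eq_integral (cst 0%E)) ?integral0//; first last.
- have aeF := ae_filter_ringOfSetsType m1.
  by apply: filterS h => x /= -> _.
- exact: section_mass_measurable.
move=> /esym.
have mY : measurable_fun setT (m1 \o ysection (~` A)).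
  by apply: measurable_fun_ysection.
rewrite (eq_integral (fun y => `|(m1 \o ysection (~` A)) y|%E)); last first.
  by move=> y _; rewrite gee0_abs//= measure_ge0.
move/(ae_eq_integral_abs m2 measurableT mY) => /=.
have aeF2 := ae_filter_ringOfSetsType m2.
apply: filterS => y /= /(_ I) my.
exists (ysection (~` A) y); split => //; first exact: measurable_ysection.
by move=> x /= nA; rewrite /ysection /= inE.
Qed.

End almost_everywhere_sections.

Section lipschitz_paths.
Context {R : realType}.

Lemma lipschitz_absolutely_continuous (f : R -> R) (K : R) :
  (forall s t, `|f t - f s| <= K * `|t - s|) -> locally_absolutely_continuous f.
Proof.
move=> fK a b a0 ab e e0.
have K1 : 0 < `|K| + 1 by rewrite ltr_wpDl.
exists (e / (`|K| + 1)); first by rewrite divr_gt0.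
move=> n l r lr _; rewrite ltr_pdivlMr// => hs.
apply: le_lt_trans hs; rewrite mulr_suml; apply: ler_sum => i _.
have [_ lri _] := lr i.
apply: le_trans (fK _ _) _; rewrite ger0_norm ?subr_ge0// mulrC.
apply: ler_wpM2l; first by rewrite subr_ge0.
by have := ler_norm K; lra.
Qed.

(** A measurable set of paths, unlike a priori the set of absolutely
    continuous ones. *)
Definition lipschitz_on_rationals : set (Gamma R) :=
  \bigcup_n \bigcap_q \bigcap_r [set g : Gamma R |
    `|path_at g (ratr q) - path_at g (ratr r)| <= n%:R * `|ratr q - ratr r|].

Lemma lipschitz_on_rationals_measurable : measurable lipschitz_on_rationals.
Proof.
apply: bigcupT_measurable => n; apply: measurable_bigcap_rat => q.
apply: measurable_bigcap_rat => r.
apply: measurable_bool_set; apply: measurable_fun_ler => //.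
apply: measurableT_comp => //.
by apply: measurable_funB; exact: eval_at_measurable.
Qed.

Lemma lipschitz_path_on_rationals (g : Gamma R) (K : R) :
  (forall s t, `|path_at g t - path_at g s| <= K * `|t - s|) ->
  lipschitz_on_rationals g.
Proof.
move=> gK; exists (Num.truncn `|K|).+1 => // q _ r _ /=.
apply: le_trans (gK _ _) _; apply: ler_wpM2r => //.
by apply: le_trans (ler_norm _) _; apply/ltW; exact: truncnS_gt.
Qed.

Lemma lipschitz_on_rationals_absolutely_continuous (g : Gamma R) :
  lipschitz_on_rationals g -> locally_absolutely_continuous (path_at g).
Proof.
move=> [n _ hn]; apply: (@lipschitz_absolutely_continuous _ n%:R) => s t.
apply/ler_addgt0Pr => e e0.
pose e' := e / (2 * (n%:R + 1)).
have n1 : 0 < n%:R + 1 :> R by rewrite ltr_wpDl.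
have e'0 : 0 < e' by rewrite divr_gt0// mulr_gt0.
have near_rat (u : R) : exists2 q : rat, `|ratr q - u| < e' &
    `|path_at g (ratr q) - path_at g u| < e'.
  have /cvgrPdistC_lt/(_ _ e'0) [d /= d0 hd] := @path_at_continuous R g u.
  have m0 : 0 < Num.min d e' by rewrite lt_min d0.
  have [q] := @rat_in_itvoo R u (u + Num.min d e') ltac:(lra).
  rewrite in_itv/= => /andP[uq]; rewrite -ltrBlDl lt_min => /andP[qd qe].
  by exists q; [|apply: hd; rewrite /ball_/= distrC]; rewrite ger0_norm; lra.
have [q qt gq] := near_rat t.
have [r rs gr] := near_rat s.
have h := hn q I r I; rewrite /= in h.
have -> : path_at g t - path_at g s = (path_at g (ratr q) - path_at g (ratr r)) -
    (path_at g (ratr q) - path_at g t) + (path_at g (ratr r) - path_at g s) by ring.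
have d1 : `|ratr q - ratr r| <= `|t - s| + (e' + e').
  have -> : ratr q - ratr r = (t - s) + ((ratr q - t) - (ratr r - s)) by ring.
  apply: le_trans (ler_normD _ _) _; apply: lerD => //.
  by apply: le_trans (ler_normB _ _) _; apply: lerD; exact: ltW.
have h2 : n%:R * `|ratr q - ratr r| <= n%:R * (`|t - s| + (e' + e')).
  by apply: ler_wpM2l.
apply: le_trans (ler_normD _ _) _.
have h3 := ler_normB (path_at g (ratr q) - path_at g (ratr r)) (path_at g (ratr q) - path_at g t).
have -> : e = 2 * e' + n%:R * (e' + e') by rewrite /e'; field; lra.
move: h h2 h3 gq gr; rewrite mulrDr; lra.
Qed.

End lipschitz_paths.

(** * The law of the paths *)

Section path_measure.
Context {R : realType}.
Local Notation U := (@unif R).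
Local Notation D := (`]0 : R, 1[%classic).
Variables X0 V0 v0 : R -> R.

Hypothesis X0nd : nondecr01 X0.
Hypothesis X0left : forall m c, 0 < m < 1 -> c < X0 m ->
  exists2 a, 0 < a < m & c <= X0 a.
Hypothesis mX0 : measurable_fun setT X0.
Hypothesis mV0 : measurable_fun setT V0.
Hypothesis V0_L2 : (\int[U]_x ((V0 x) ^+ 2)%:E < +oo)%E.
Hypothesis V0_loc : forall x y : R, 0 < x -> x <= y -> y < 1 ->
  exists L : R, forall z, x <= z <= y -> `|V0 z| <= L.
Hypothesis mv0 : measurable_fun setT v0.
Hypothesis V0E : forall m, 0 < m < 1 -> V0 m = v0 (X0 m).

Local Notation X := (flow (primX X0) (primV V0)).
Local Notation path := (flow_path X0nd mV0 V0_L2 V0_loc).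

Let FX0 : subgradient (primX X0) X0. Proof. exact: primX_subgradient. Qed.
Let GK : slope_bound (primV V0) (max_slope V0). Proof. exact: max_slopeP. Qed.

Let mpath : measurable_fun setT path.
Proof. exact: flow_path_measurable. Qed.

Let path_mfun : {mfun R >-> Gamma R} :=
  HB.pack path (isMeasurableFun.Build _ _ R (Gamma R) path mpath).

(** The law of the trajectory of a uniformly distributed label. *)
Definition path_measure : probability (Gamma R) R := distribution U path_mfun.

Local Notation eta := path_measure.

Lemma path_measureE (A : set (Gamma R)) : eta A = U (path @^-1` A).
Proof. by []. Qed.

Lemma ae_path_measure (Q : set (Gamma R)) : measurable Q ->
  (forall m, 0 < m < 1 -> Q (path m)) -> {ae eta, forall g, Q g}.
Proof.
move=> mQ h; exists (~` Q); split => //; first exact: measurableC.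
rewrite path_measureE; apply/eqP; rewrite eq_le; apply/andP; split; last exact: measure_ge0.
rewrite -(@uniform_out R); apply: le_measure; rewrite ?inE.
- by rewrite -[X in measurable X]setTI; apply: mpath => //; exact: measurableC.
- exact: measurableC.
- by move=> m /= nQ; rewrite in_itv/= => /h.
Qed.

Lemma ae_path (Q : set (Gamma R)) : measurable Q ->
  {ae eta, forall g, Q g} -> {ae U, forall m, Q (path m)}.
Proof.
move=> mQ [N [mN N0 sN]]; exists (path @^-1` N); split => //.
- by rewrite -[X in measurable X]setTI; exact: mpath.
- by move=> m /= nQ; apply: sN.
Qed.

Lemma path_measure_integral (F : Gamma R -> \bar R) : measurable_fun setT F ->
  (forall g, (0 <= F g)%E) -> (\int[eta]_g F g = \int[U]_m F (path m))%E.
Proof. by move=> mF F0; rewrite ge0_integral_distribution. Qed.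

Lemma path_measure_integrable (F : Gamma R -> R) : measurable_fun setT F ->
  U.-integrable setT (EFin \o (F \o path)) -> eta.-integrable setT (EFin \o F).
Proof.
move=> mF /integrableP[_ iF]; apply/integrableP; split; first exact/measurable_EFinP.
rewrite path_measure_integral//.
by apply/measurable_EFinP; exact: measurableT_comp.
Qed.

Lemma initial_position m : 0 < m < 1 -> path_at (path m) 0 = X0 m.
Proof. by move=> m01; rewrite flow_path_at_ge0// flow_initial. Qed.

Lemma initial_law (A : set R) : measurable A ->
  pushforward eta (eval_at 0) A = U (X0 @^-1` A).
Proof.
move=> mA; rewrite /pushforward path_measureE; apply: uniform_eq01.
- rewrite -comp_preimage -[X in measurable X]setTI.
  by apply: (measurableT_comp (@eval_at_measurable R 0) mpath).
- by rewrite -[X in measurable X]setTI; exact: mX0.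
have E m : 0 < m < 1 -> eval_at 0 (path m) = X0 m by exact: initial_position.
apply/seteqP; split => m -[h m01]; split => //; have {}m01 : 0 < m < 1 by
  move: m01; rewrite /= in_itv.
  by change (A (X0 m)); rewrite -E.
by change (A (eval_at 0 (path m))); rewrite E.
Qed.

(** The trajectories of labels in ]0, 1[ have full measure, so they meet
    every open set of positive measure. *)
Lemma support_approximation (g : Gamma R) (s t e : R) : measure_support eta g ->
  0 <= s -> 0 <= t -> 0 < e -> exists2 m, 0 < m < 1 &
    `|path_at g s - X s m| < e /\ `|path_at g t - X t m| < e.
Proof.
move=> sg s0 t0 e0; apply/not_exists2P => h.
pose B := eval_at s @^-1` (ball (path_at g s) e) `&` eval_at t @^-1` (ball (path_at g t) e).
have oB : open B.
  by apply: openI; apply: eval_at_open; exact: ball_open.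
have : (0 < eta B)%E.
  by apply: sg => //; split; exact: ballxx.
apply/negP; rewrite -leNgt path_measureE -(@uniform_out R).
apply: le_measure; rewrite ?inE.
- by rewrite -[X in measurable X]setTI; apply: mpath => //; exact: Gamma_open_measurable.
- exact: measurableC.
move=> m /= [Bs Bt]; rewrite in_itv/= => m01; have [//|] := h m; apply.
by rewrite -!(flow_path_at_ge0 X0nd mV0 V0_L2 V0_loc).
Qed.

(** Approximate the two paths by trajectories at both times and order the
    two labels to apply [flow_ratio]. *)
Lemma support_ratio (s t : R) (g x : Gamma R) : 0 < s -> s <= t ->
  measure_support eta g -> measure_support eta x ->
  t^-1 * `|path_at g t - path_at x t| <= s^-1 * `|path_at g s - path_at x s|.
Proof.
move=> s0 st sg sx; apply/ler_addgt0Pr => e e0.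
have t0 : 0 < t by lra.
have it0 : 0 < t^-1 by rewrite invr_gt0.
have is0 : 0 < s^-1 by rewrite invr_gt0.
pose d := e / (2 * (t^-1 + s^-1)).
have d0 : 0 < d by rewrite divr_gt0// mulr_gt0// addr_gt0.
have [m m01 [gs gt]] := support_approximation sg (ltW s0) (ltW t0) d0.
have [m' m'01 [xs xt]] := support_approximation sx (ltW s0) (ltW t0) d0.
have main : t^-1 * `|X t m - X t m'| <= s^-1 * `|X s m - X s m'|.
  wlog mm' : m m' m01 m'01 {gs gt xs xt} / m <= m'.
    move=> W; have [mm'|/ltW mm'] := leP m m'; first exact: W.
    by rewrite distrC [X in _ <= _ * X]distrC; exact: W.
  rewrite [X in _ * X <= _]distrC [X in _ <= _ * X]distrC.
  have nd u : X u m <= X u m' by apply: (flow_nondecreasing FX0 GK); lra.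
  rewrite !ger0_norm ?subr_ge0//; apply: (flow_ratio FX0 GK) => //; lra.
have E : e = t^-1 * (2 * d) + s^-1 * (2 * d).
  rewrite /d; field.
  by rewrite !gt_eqF//= addr_gt0.
have h1 : `|path_at g t - path_at x t| <= `|X t m - X t m'| + 2 * d.
  have -> : path_at g t - path_at x t = (X t m - X t m') +
    ((path_at g t - X t m) - (path_at x t - X t m')) by ring.
  apply: le_trans (ler_normD _ _) _; rewrite lerD2l.
  by apply: le_trans (ler_normB _ _) _; lra.
have h2 : `|X s m - X s m'| <= `|path_at g s - path_at x s| + 2 * d.
  have -> : X s m - X s m' = (path_at g s - path_at x s) -
    ((path_at g s - X s m) - (path_at x s - X s m')) by ring.
  apply: le_trans (ler_normB _ _) _; rewrite lerD2l.
  by apply: le_trans (ler_normB _ _) _; lra.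
have {}h1 := ler_wpM2l (ltW it0) h1; have {}h2 := ler_wpM2l (ltW is0) h2.
by move: h1 h2 main; rewrite !mulrDr E; lra.
Qed.

Lemma ae_absolutely_continuous :
  {ae eta, forall g, locally_absolutely_continuous (path_at g)}.
Proof.
have aeF := ae_filter_ringOfSetsType eta.
apply: (filterS lipschitz_on_rationals_absolutely_continuous).
apply: (ae_path_measure lipschitz_on_rationals_measurable) => m m01.
apply: (@lipschitz_path_on_rationals _ _ (max_slope V0 m)) => s t.
exact: flow_path_lipschitz.
Qed.

Let Xnd t : nondecr01 (X t). Proof. exact: flow_nd. Qed.

Let Xleft t m c : 0 < m < 1 -> c < X t m -> \forall m' \near m^'-, c <= X t m'.
Proof. by move=> m01 cX; exact: (flow_left_continuous FX0 GK). Qed.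

Let Xtime m : 0 < m < 1 -> continuous (X ^~ m).
Proof.
move=> m01; have := flow_time_continuous X0nd mV0 V0_L2 V0_loc (m := m).
by rewrite clamp01_id.
Qed.

Let Xsticky s t m m' : 0 < s -> s <= t -> 0 < m < 1 -> 0 < m' < 1 ->
  X s m = X s m' -> X t m = X t m'.
Proof.
move=> s0 st; wlog mm' : m m' / m <= m'.
  move=> W m01 m'01 E; have [mm'|/ltW mm'] := leP m m'; first exact: W.
  by apply: esym; apply: W.
move=> m01 m'01 E; apply/eqP; rewrite eq_le Xnd//=; [|lra..].
have := flow_ratio FX0 GK s0 st (m := m) (m' := m') ltac:(lra) mm' ltac:(lra).
rewrite E subrr mulr0 pmulr_rle0 ?subr_le0// invr_gt0; lra.
Qed.

Local Notation v := (velocity_field X).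

Let mv : measurable_fun setT v.
Proof. exact: (velocity_field_measurable Xtime). Qed.

(** The first component is the path, the second the time. *)
Definition follows_field : set (Gamma R * R) := [set gt : Gamma R * R | 0 < gt.2 ->
  is_derive gt.2 1 (path_at gt.1) (v (path_at gt.1 gt.2, gt.2))].

Lemma follows_field_measurable : measurable follows_field.
Proof.
have -> : follows_field = [set gt : Gamma R * R | gt.2 <= 0] `|`
    [set gt : Gamma R * R | is_derive gt.2 1 (path_at gt.1) (v (path_at gt.1 gt.2, gt.2))].
  apply/seteqP; split => -[g t] /=; rewrite /follows_field /=.
    by move=> h; have [t0|t0] := leP t 0; [left|right; exact: h].
  by case=> // t0; rewrite ltNge t0.
apply: measurableU.
  by apply: measurable_bool_set; exact: measurable_fun_ler.
apply: (@path_is_derive_measurable _ (fun gt => v (path_at gt.1 gt.2, gt.2))).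
apply: (measurableT_comp mv); apply: measurable_fun_pair => //.
exact: path_at_jointly_measurable.
Qed.

Lemma flow_path_follows_field m : 0 < m < 1 ->
  {ae lebesgue_measure, forall t : R, follows_field (path m, t)}.
Proof.
move=> m01.
have := @lipschitz_derivable R (path_at (path m)) (max_slope V0 m).
have aeF := ae_filter_ringOfSetsType (@lebesgue_measure R).
move=> H; have {}H := H (fun s t => flow_path_lipschitz X0nd mV0 V0_L2 V0_loc s t m01).
apply: filterS H => t dt t0 /=.
have d := derivable_velocity dt.
rewrite (velocity_fieldE Xnd Xleft Xsticky m01 t0 _ d)// => s s0.
by rewrite flow_path_at_ge0// ltW.
Qed.

Let missed (g : Gamma R) : \bar R := lebesgue_measure (xsection (~` follows_field) g).

Let missed_measurable : measurable_fun setT missed.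
Proof.
exact: (@section_mass_measurable R _ _ (Gamma R) (measurableTypeR R)
  (@lebesgue_measure R) _ follows_field_measurable).
Qed.

Let ae_missed : {ae eta, forall g, missed g = 0%E}.
Proof.
apply: (@ae_path_measure [set g | missed g = 0%E]).
  rewrite (_ : [set g | _] = missed @^-1` [set 0%E]); last by apply/seteqP; split.
  by rewrite -[X in measurable X]setTI; exact: missed_measurable.
move=> m m01 /=.
have [N [mN N0 sN]] := flow_path_follows_field m01.
apply/eqP; rewrite eq_le; apply/andP; split; last exact: measure_ge0.
rewrite -N0; apply: le_measure; rewrite ?inE//.
- apply: measurable_xsection; apply: measurableC; exact: follows_field_measurable.
- by move=> t; rewrite /xsection /= inE => h; apply: sN.
Qed.

Lemma ae_follows_field :
  {ae eta, forall g, {ae lebesgue_measure, forall t : R, follows_field (g, t)}}.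
Proof.
have aeF := ae_filter_ringOfSetsType eta.
apply: filterS ae_missed => g mg.
exists (xsection (~` follows_field) g); split => //.
- apply: (@measurable_xsection _ _ (Gamma R) (measurableTypeR R)); apply: measurableC; exact: follows_field_measurable.
- by move=> t /= nA; rewrite /xsection /= inE.
Qed.

Lemma ae_time_follows_field :
  {ae lebesgue_measure, forall t : R, {ae eta, forall g, follows_field (g, t)}}.
Proof.
exact: (@ae_section_swap R _ _ (Gamma R) (measurableTypeR R) eta
  (@lebesgue_measure R) _ follows_field_measurable ae_missed).
Qed.

(** * Balance of momentum and decay of energy *)

Let aeU := ae_filter_ringOfSetsType U.
Let aeeta := ae_filter_ringOfSetsType eta.

(** The times at which the balance laws are proved; almost every positive time
    is one. *)
Definition good_time (t : R) := 0 < t /\ {ae eta, forall g, follows_field (g, t)}.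

Local Notation vel t := (fun g : Gamma R => velocity g t).
Local Notation v0_start := (fun g : Gamma R => v0 (path_at g 0)).

Lemma start_velocity m : 0 < m < 1 -> v0 (path_at (path m) 0) = V0 m.
Proof. by move=> m01; rewrite initial_position// V0E. Qed.

Let mv0_start : measurable_fun setT v0_start.
Proof. exact: (measurableT_comp mv0 (@eval_at_measurable R 0)). Qed.

Let mvel t : measurable_fun setT (vel t).
Proof. exact: velocity_at_measurable. Qed.

Lemma start_velocity_integrable : eta.-integrable setT (EFin \o v0_start).
Proof.
apply: path_measure_integrable => //.
apply: (ae_dominated_integrable (g := fun m => `|V0 m|)).
- exact: measurableT_comp.
- exact: (integrable_norm (V0_integrable mV0 V0_L2)).
- by apply: ae_uniform => m m01 /=; rewrite start_velocity.
Qed.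

Lemma start_energy :
  (\int[eta]_g ((v0 (path_at g 0)) ^+ 2)%:E = \int[U]_m ((V0 m) ^+ 2)%:E)%E.
Proof.
rewrite path_measure_integral.
- apply: ae_eq_integral => //.
  + by apply/measurable_EFinP; apply: measurable_funX; exact: (measurableT_comp mv0_start mpath).
  + by apply/measurable_EFinP; exact: measurable_funX.
  + by apply: ae_uniform => m m01 _; rewrite start_velocity.
- by apply/measurable_EFinP; exact: measurable_funX.
- by move=> g; rewrite lee_fin sqr_ge0.
Qed.

Lemma flow_path_velocity_dominated :
  {ae U, forall m, forall t, 0 < t -> `|velocity (path m) t| <= slope_dominator V0 m}.
Proof.
have h := flow_increment_dominated X0nd mV0 V0_L2 V0_loc.
have h01 : {ae U, forall m : R, 0 < m < 1} by exact: ae_uniform.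
apply: (filterS2 _ _ h h01) => m inc m01 t t0.
have {}inc s u := inc s u m01.
have D0 : 0 <= slope_dominator V0 m.
  by have := inc 0 1; rewrite subr0 normr1 mulr1; exact: le_trans.
have [dt|ndt] := pselect (derivable (path_at (path m)) t 1); last first.
  by rewrite velocity_not_derivable// normr0.
have /is_derive_quotient/cvg_norm cv := derivable_velocity dt.
apply: cvgr_to_le cv _; apply: nearW => n.
have n0 : 0 < n.+1%:R^-1 :> R by rewrite invr_gt0.
have tn0 : 0 <= t + n.+1%:R^-1 by rewrite addr_ge0// ltW.
rewrite !flow_path_at_ge0 ?(ltW t0)//.
rewrite normrM ger0_norm//.
have := inc t (t + n.+1%:R^-1); rewrite [X in _ * `|X|]addrAC subrr add0r.
rewrite [X in _ <= _ * X]gtr0_norm// => /(ler_wpM2l (ler0n R n.+1)).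
by rewrite mulrCA mulfV ?mulr1.
Qed.

Lemma velocity_integrable t : 0 < t -> eta.-integrable setT (EFin \o vel t).
Proof.
move=> t0; apply: path_measure_integrable => //.
apply: (ae_dominated_integrable (g := slope_dominator V0)).
- exact: measurableT_comp.
- exact: slope_dominator_integrable.
- by apply: filterS flow_path_velocity_dominated => m; apply.
Qed.

Lemma acceleration_integrable t : 0 < t ->
  eta.-integrable setT (EFin \o (fun g => velocity g t - v0 (path_at g 0))).
Proof.
by move=> t0; have := integrableB measurableT (velocity_integrable t0) start_velocity_integrable.
Qed.

Let good_path_derive t : good_time t ->
  {ae U, forall m, is_derive t 1 (path_at (path m)) (velocity (path m) t)}.
Proof.
move=> [t0 gt].
have mQ : measurable [set g : Gamma R | follows_field (g, t)].
  rewrite (_ : [set g | _] = ysection follows_field t).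
    by apply: measurable_ysection; exact: follows_field_measurable.
  by apply/seteqP; split => g /=; rewrite /ysection/= inE.
apply: filterS (ae_path mQ gt) => m /(_ t0) h.
by rewrite /= (is_derive_velocity h).
Qed.

Let dominator_integrable :
  U.-integrable setT (EFin \o (fun m => slope_dominator V0 m + `|V0 m|)).
Proof.
by have := integrableD measurableT (slope_dominator_integrable mV0 V0_L2)
  (integrable_norm (V0_integrable mV0 V0_L2)).
Qed.

(** The difference quotients from the left satisfy this by
    [flow_conservation], the sublevel set being taken at the later time t. *)
Lemma velocity_conservation t c : good_time t ->
  \int[U]_(m in D `&` [set m | X t m < c]) (velocity (path m) t - V0 m) = 0.
Proof.
move=> gt; have [t0 _] := gt.
have mD := flow_sublevel_measurable X0nd mV0 V0_L2 V0_loc t c.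
set S := D `&` _ in mD *.
(* The denominator starts at 2 so that the earlier time t - r n is positive. *)
pose r (n : nat) : R := t / n.+2%:R.
have r0 n : 0 < r n by rewrite divr_gt0.
have rt n : r n < t by rewrite ltr_pdivrMr// ltr_pMr// ltr1n.
pose q n m := (r n)^-1 * (X t m - X (t - r n) m) - V0 m.
have mX u : measurable_fun S (X u).
  apply: measurable_funS (flow_measurable X0nd mV0 V0_L2 V0_loc u) => //.
  exact: subIsetl.
have q0 n : \int[U]_(m in S) q n m = 0.
  have i1 : U.-integrable S (EFin \o (fun m => X t m - X (t - r n) m - (t - (t - r n)) * V0 m)).
    have ii := @integrableB _ _ _ U D (measurable_itv _) _ _
      (flow_increment_integrable X0nd mV0 V0_L2 V0_loc (t - r n) t)
      (integrableZl (measurable_itv _) (t - (t - r n)) (integrableS measurableT (measurable_itv _) (@subsetT _ _) (V0_integrable mV0 V0_L2))).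
    by apply: integrableS ii => //; exact: subIsetl.
  transitivity (\int[U]_(m in S) ((r n)^-1 * (X t m - X (t - r n) m - (t - (t - r n)) * V0 m))).
    apply: eq_Rintegral => m _; rewrite /q.
    by have := r0 n; move: (r n) => rr rr0; field; rewrite gt_eqF.
  rewrite RintegralZl// (flow_conservation X0nd X0left mV0 V0_L2 V0_loc) ?mulr0//.
    by have := rt n; lra.
  by have := r0 n; lra.
have cv : \int[U]_(m in S) q n m @[n --> \oo] --> \int[U]_(m in S) (velocity (path m) t - V0 m).
  apply: (@Rdominated_cvg _ _ _ _ _ q _ (fun m => slope_dominator V0 m + `|V0 m|)) => //.
  - move=> n; apply: measurable_funB; last exact: measurable_funTS.
    by apply: measurable_funM => //; exact: measurable_funB.
  - apply: measurable_funTS; apply: measurable_funB => //.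
    by apply: (measurableT_comp (mvel t) mpath).
  - have h01 : {ae U, forall m : R, 0 < m < 1} by exact: ae_uniform.
    apply: (filterS2 _ _ (good_path_derive gt) h01) => m /is_derive_realP dm m01 _.
    apply: cvgB; last exact: cvg_cst.
    apply/cvgrPdistC_le => e e0; have [d d0 hd] := dm e e0.
    have [N _ hN] := near_infty_natSinv_lt (PosNum (divr_gt0 d0 t0)).
    exists N => // n /= Nn.
    have := hd (- r n); rewrite oppr_eq0 gt_eqF// normrN gtr0_norm//.
    rewrite !flow_path_at_ge0//; [|by have := rt n; have := r0 n; lra..].
    have -> : (r n)^-1 * (X t m - X (t - r n) m) = (X (t - r n) m - X t m) / - r n.
      by have := r0 n; move: (r n) => rr rr0; field; rewrite gt_eqF.
    apply => //; rewrite /r mulrC -ltr_pdivlMr//.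
    apply: le_lt_trans (hN n Nn).
    by rewrite lef_pV2 ?posrE// ler_nat.
  - exact: integrableS dominator_integrable.
  - have h01 : {ae U, forall m : R, 0 < m < 1} by exact: ae_uniform.
    apply: (filterS2 _ _ (flow_increment_dominated X0nd mV0 V0_L2 V0_loc) h01).
    move=> m inc m01 n _; apply: le_trans (ler_normB _ _) _; rewrite lerD2r.
    have := inc (t - r n) t m01; rewrite (_ : t - (t - r n) = r n); last by ring.
    move: (r n) (r0 n) => rr rr0; rewrite normrM normfV (gtr0_norm rr0).
    by rewrite [X in _ -> X <= _]mulrC ler_pdivrMr.
apply: (cvg_eq_limit cv); under eq_fun do rewrite q0; exact: cvg_cst.
Qed.

Lemma velocity_sublevel t c : good_time t ->
  \int[eta]_(g in [set g | path_at g t < c]) (velocity g t - v0 (path_at g 0)) = 0.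
Proof.
move=> gt; have [t0 _] := gt.
have R0 := velocity_conservation c gt; rewrite -[RHS]R0 {R0}.
have mS : measurable [set g : Gamma R | path_at g t < c].
  by apply: measurable_bool_set; apply: measurable_fun_ltr => //; exact: eval_at_measurable.
have mE := flow_sublevel_measurable X0nd mV0 V0_L2 V0_loc t c.
have ia := acceleration_integrable t0.
pose Y (g : Gamma R) := velocity g t - v0 (path_at g 0).
have mY : measurable_fun setT (Y \_ [set g | path_at g t < c]).
  apply/(measurable_restrictT _ mS); apply: measurable_funTS.
  by apply: measurable_funB.
rewrite Rintegral_mkcond [RHS]Rintegral_mkcond /Rintegral; congr fine.
rewrite (@integral_distribution _ _ _ _ _ U path_mfun (EFin \o (Y \_ [set g | path_at g t < c]))).
- apply: ae_eq_integral => //.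
  + by apply/measurable_EFinP; apply: (measurableT_comp mY mpath).
  + apply/measurable_EFinP/(measurable_restrictT _ mE).
    by apply: measurable_funTS; apply: measurable_funB => //; exact: (measurableT_comp (mvel t) mpath).
  + apply: ae_uniform => m m01 _ /=; congr _%:E; rewrite !patchE.
    rewrite (_ : (path m \in _) = (m \in D `&` [set m | X t m < c])).
      by case: ifP => // _; rewrite /Y start_velocity.
    have E : path_at (path m) t = X t m by rewrite flow_path_at_ge0// ltW.
    apply/idP/idP; rewrite !inE; first by rewrite /mkset E; split=> //=; rewrite in_itv.
    by case=> _; rewrite /mkset E.
- exact/measurable_EFinP.
- apply: (@ae_dominated_integrable _ _ _ U _ (fun m => slope_dominator V0 m + `|V0 m|)).
  + exact: (measurableT_comp mY mpath).
  + exact: dominator_integrable.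
  + have h01 : {ae U, forall m : R, 0 < m < 1} by exact: ae_uniform.
    apply: (filterS2 _ _ flow_path_velocity_dominated h01) => m dom m01 /=.
    rewrite patchE; case: ifP => _; last first.
      by rewrite normr0 addr_ge0// (le_trans _ (dom t t0)).
    by rewrite /Y start_velocity// (le_trans (ler_normB _ _))// lerD2r dom.
Qed.

(** The velocity at t is the conditional expectation of the initial velocity
    given the position at t. *)
Lemma velocity_projection t (h : R -> R) (b : R) : good_time t ->
  measurable_fun setT h -> (forall x, `|h x| <= b) ->
  \int[eta]_g (h (path_at g t) * (velocity g t - v0 (path_at g 0))) = 0.
Proof.
move=> gt mh hb; have [t0 _] := gt.
apply: (@orthogonal_bounded _ _ _ eta (eval_at t)
  (fun g => velocity g t - v0 (path_at g 0)) _ _ _ h b) => //.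
- exact: eval_at_measurable.
- exact: acceleration_integrable.
- by move=> c; exact: velocity_sublevel.
Qed.

Let bounded_integrable t (Y : Gamma R -> R) (h : R -> R) (b : R) :
  measurable_fun setT h -> (forall x, `|h x| <= b) ->
  eta.-integrable setT (EFin \o Y) ->
  eta.-integrable setT (EFin \o (fun g => Y g * h (path_at g t))).
Proof.
move=> mh hb iY.
have := @integrable_bounded_comp _ _ _ eta _ _ (@eval_at_measurable R t) iY h b mh hb.
by under eq_fun do rewrite /= mulrC.
Qed.

Lemma weak_velocity t (h : R -> R) : good_time t -> continuous h -> bounded_fun h ->
  [/\ eta.-integrable setT (fun g => (velocity g t * h (path_at g t))%:E),
      eta.-integrable setT (fun g => (v0 (path_at g 0) * h (path_at g t))%:E) &
      (\int[eta]_g (velocity g t * h (path_at g t))%:E =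
       \int[eta]_g (v0 (path_at g 0) * h (path_at g t))%:E)%E].
Proof.
move=> gt ch [M [_ hM]]; have [t0 _] := gt.
have hb x : `|h x| <= M + 1 by apply: hM => //; rewrite ltrDl.
have mh : measurable_fun setT h by exact: continuous_measurable_fun.
have i1 := bounded_integrable t mh hb (velocity_integrable t0).
have i2 := bounded_integrable t mh hb start_velocity_integrable.
split => //.
rewrite -(fineK (integrable_fin_num measurableT i1)).
rewrite -(fineK (integrable_fin_num measurableT i2)); congr _%:E.
apply/eqP; rewrite -subr_eq0; apply/eqP.
have B := @RintegralB _ _ _ eta _ _ _ measurableT i1 i2.
rewrite -[LHS]B -[RHS](velocity_projection gt mh hb).
by apply: eq_Rintegral => g _; ring.
Qed.

Let ae_velocity_field t : good_time t ->
  {ae eta, forall g, velocity g t = v (path_at g t, t)}.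
Proof.
by move=> [t0 gt]; apply: filterS gt => g /(_ t0) /is_derive_velocity.
Qed.

Let mv_at t : measurable_fun setT (fun x => v (x, t)).
Proof. by apply: (measurableT_comp mv); exact: measurable_fun_pair. Qed.

Lemma energy_le_initial t : good_time t ->
  (\int[eta]_g ((velocity g t) ^+ 2)%:E <= \int[U]_m ((V0 m) ^+ 2)%:E)%E.
Proof.
move=> gt; have [t0 _] := gt.
rewrite -start_energy.
apply: (@projection_energy_le _ _ _ eta (eval_at t) (vel t) v0_start _ _ _ _
  (fun x => v (x, t))) => //.
- exact: eval_at_measurable.
- exact: velocity_integrable.
- exact: start_velocity_integrable.
- by move=> h b mh hb; exact: velocity_projection mh hb.
- exact: ae_velocity_field.
Qed.

Let flow_map_path s t : 0 < s -> s <= t ->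
  {ae eta, forall g, path_at g t = flow_map X s t (path_at g s)}.
Proof.
move=> s0 st.
apply: (@ae_path_measure [set g | path_at g t = flow_map X s t (path_at g s)]).
  rewrite (_ : [set g | _] = [set g | path_at g t == flow_map X s t (path_at g s)]).
    apply: measurable_bool_set; apply: measurable_fun_eqr.
      exact: eval_at_measurable.
    apply: (flow_map_measurable Xtime) => //; exact: eval_at_measurable.
  by apply/seteqP; split => g /= /eqP.
move=> m m01; have t0 : 0 <= t by lra.
by rewrite /mkset !flow_path_at_ge0 ?(ltW s0)// (flow_mapE Xnd Xleft Xsticky).
Qed.

(** A bounded Borel function of the position at t is one of the position at
    s, since positions at s determine those at t.  Testing both velocities
    with it gives the same value, that of the initial velocity. *)
Lemma energy_nonincreasing s t : good_time s -> good_time t -> s <= t ->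
  (\int[eta]_g ((velocity g t) ^+ 2)%:E <= \int[eta]_g ((velocity g s) ^+ 2)%:E)%E.
Proof.
move=> gs gt st; have [s0 _] := gs; have [t0 _] := gt.
apply: (@projection_energy_le _ _ _ eta (eval_at t) (vel t) (vel s) _ _ _ _
  (fun x => v (x, t))) => //; [exact: eval_at_measurable|exact: velocity_integrable..| |exact: ae_velocity_field].
move=> h b mh hb.
pose k x := h (flow_map X s t x).
have mk : measurable_fun setT k.
  by apply: (measurableT_comp mh); exact: (flow_map_measurable Xtime).
have kb x : `|k x| <= b by exact: hb.
have ia u (r : R -> R) : 0 < u -> measurable_fun setT r -> (forall x, `|r x| <= b) ->
    forall w, eta.-integrable setT (EFin \o (fun g => r (path_at g w) * (velocity g u - v0 (path_at g 0)))).
  move=> u0 mr rb w.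
  exact: (@integrable_bounded_comp _ _ _ eta _ _ (@eval_at_measurable R w) (acceleration_integrable u0) r b mr rb).
transitivity (\int[eta]_g (h (path_at g t) * (velocity g t - v0 (path_at g 0)) -
    h (path_at g t) * (velocity g s - v0 (path_at g 0)))).
  by apply: eq_Rintegral => g _; rewrite /eval_at; ring.
rewrite RintegralB//; [|exact: ia..].
rewrite (velocity_projection gt mh hb) sub0r.
rewrite -[RHS]oppr0; congr (- _); rewrite -[RHS](velocity_projection gs mk kb).
congr fine; apply: ae_eq_integral => //.
- by have /integrableP[] := ia _ _ s0 mh hb t.
- by have /integrableP[] := ia _ _ s0 mk kb s.
- by apply: filterS (flow_map_path s0 st) => g e _; rewrite /= e.
Qed.

Lemma ae_good_time : {ae lebesgue_measure, forall t : R, 0 < t -> good_time t}.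
Proof.
have aeF := ae_filter_ringOfSetsType (@lebesgue_measure R).
by apply: filterS ae_time_follows_field => t gt t0.
Qed.

Lemma velocity_field_follows :
  measurable_fun ([set: R] `*` (`]0%R, +oo[ : set R)) v /\
  {ae eta, forall g, {ae lebesgue_measure, forall t : R, 0 < t ->
    is_derive t 1 (path_at g) (v (path_at g t, t))}}.
Proof. by split; [exact: measurable_funTS|exact: ae_follows_field]. Qed.

Lemma good_time_derivable t : good_time t ->
  {ae eta, forall g, derivable (path_at g) t 1}.
Proof. by move=> [t0 gt]; apply: filterS gt => g /(_ t0) []. Qed.

End path_measure.

(** * Existence of the path measure *)

Lemma quantile_integral {R : realType} (rho : probability R R) (f : R -> \bar R) :
  measurable_fun setT f -> (forall x, (0 <= f x)%E) ->
  (\int[@unif R]_m f (quantile rho m) = \int[rho]_x f x)%E.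
Proof.
move=> mf f0.
have := ge0_integral_pushforward (quantile_measurable rho) (@unif R) measurableT mf.
rewrite preimage_setT => <-; last by move=> x _.
apply: eq_measure_integral => [|mq A mA _]; first exact: quantile_measurable.
exact: esym (quantile_pushforward rho mA).
Qed.

(** The values of X0 between x and y stay in the compact interval
    [X0 x, X0 y]. *)
Lemma continuous_nondecr01_bounded {R : realType} (v0 X0 : R -> R) :
  continuous v0 -> nondecr01 X0 ->
  forall x y : R, 0 < x -> x <= y -> y < 1 ->
    exists L : R, forall z, x <= z <= y -> `|v0 (X0 z)| <= L.
Proof.
move=> cv0 X0nd x y x0 xy y1.
have cn : {within `[X0 x, X0 y], continuous (fun z => `|v0 z|)}.
  apply: continuous_subspaceT => z; apply: continuous_comp; first exact: cv0.
  exact: norm_continuous.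
have le : X0 x <= X0 y by exact: X0nd.
have [c _ hc] := EVT_max le cn; exists `|v0 c| => z xzy; apply: hc.
by rewrite in_itv/= !X0nd//; lra.
Qed.

Theorem proposition1p3 (R : realType) (rho0 : probability R R) (v0 : R -> R)
    (v0_cont : continuous v0)
    (v0_L2 : (\int[rho0]_x ((v0 x) ^+ 2)%:E < +oo)%E) :
  exists eta : probability (Gamma R) R,
    (forall A : set R, measurable A -> rho0 A = pushforward eta (eval_at 0) A)
    /\
    (forall (s t : R) (g x : Gamma R), 0 < s -> s <= t ->
       measure_support eta g -> measure_support eta x ->
       t^-1 * `|path_at g t - path_at x t|
         <= s^-1 * `|path_at g s - path_at x s|)
    /\
    {ae eta, forall g, locally_absolutely_continuous (path_at g)}
    /\
    (exists v : R * R -> R,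
       measurable_fun ([set: R] `*` (`]0%R, +oo[ : set R)) v /\
       {ae eta, forall g, {ae lebesgue_measure, forall t : R, 0 < t ->
          is_derive t 1 (path_at g) (v (path_at g t, t))}})
    /\
    {ae lebesgue_measure, forall t : R, 0 < t ->
       {ae eta, forall g, derivable (path_at g) t 1} /\
       forall h : R -> R, continuous h -> bounded_fun h ->
         [/\ eta.-integrable setT (fun g => (velocity g t * h (path_at g t))%:E),
             eta.-integrable setT
               (fun g => (v0 (path_at g 0) * h (path_at g t))%:E) &
             (\int[eta]_g (velocity g t * h (path_at g t))%:E =
              \int[eta]_g (v0 (path_at g 0) * h (path_at g t))%:E)%E]}
    /\
    (exists2 N : set R, N `<=` `[0, +oo[%classic /\ lebesgue_measure.-negligible N &
       forall s t : R, 0 <= s -> s <= t -> ~ N s -> ~ N t ->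
         ((\int[eta]_g ((velocity g t) ^+ 2)%:E
             <= \int[eta]_g ((velocity g s) ^+ 2)%:E) /\
          (\int[eta]_g ((velocity g s) ^+ 2)%:E < +oo))%E).
Proof.
pose X0 := quantile rho0; pose V0 m := v0 (X0 m).
have mv0 : measurable_fun setT v0 by exact: continuous_measurable_fun.
have mX0 : measurable_fun setT X0 by exact: quantile_measurable.
have mV0 : measurable_fun setT V0 by exact: measurableT_comp.
have X0nd : nondecr01 X0 by exact: quantile_nondecreasing.
have X0left m c : 0 < m < 1 -> c < X0 m -> exists2 a, 0 < a < m & c <= X0 a.
  exact: quantile_left.
have V0_L2 : (\int[@unif R]_m ((V0 m) ^+ 2)%:E < +oo)%E.
  rewrite (quantile_integral rho0 (f := fun x => ((v0 x) ^+ 2)%:E))//.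
    by apply/measurable_EFinP; exact: measurable_funX.
  by move=> x; rewrite lee_fin sqr_ge0.
have V0_loc := continuous_nondecr01_bounded v0_cont X0nd.
have V0E m : 0 < m < 1 -> V0 m = v0 (X0 m) by [].
exists (path_measure X0nd mV0 V0_L2 V0_loc).
split.
  move=> A mA; rewrite (initial_law X0nd X0left mX0)//.
  exact: quantile_pushforward.
split; first by move=> s t g x; exact: support_ratio.
split; first exact: ae_absolutely_continuous.
split; first by exists (velocity_field (flow (primX X0) (primV V0))); exact: velocity_field_follows.
have good := ae_good_time X0nd mV0 V0_L2 V0_loc.
have aeF := ae_filter_ringOfSetsType (@lebesgue_measure R).
split.
  apply: filterS good => t gt t0; have {}gt := gt t0; split.
    exact: good_time_derivable gt.
  by move=> h ch bh; apply: (weak_velocity X0left mv0 V0E gt).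
pose N : set R := [set t | 0 <= t /\ (t = 0 \/ ~ good_time X0nd mV0 V0_L2 V0_loc t)].
have Ngood t : 0 <= t -> ~ N t -> good_time X0nd mV0 V0_L2 V0_loc t.
  by move=> t0 Nt; apply: contrapT => ngt; apply: Nt; split => //; right.
exists N; first split.
- by move=> t [t0 _]; rewrite /= in_itv/= t0.
- have : lebesgue_measure.-negligible ([set 0 : R] `|` [set t | ~ (0 < t -> good_time X0nd mV0 V0_L2 V0_loc t)]).
    apply: negligibleU => //.
    apply/negligibleP; first exact: measurable_set1.
    exact: lebesgue_measure_set1.
  apply: negligibleS => t [t0 [->|ngt]]; first by left.
  move: t0; rewrite le_eqVlt => /predU1P[<-|t0]; [by left|right].
  by move=> /= h; apply: ngt; exact: h.
move=> s t s0 st Ns Nt.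
have gs := Ngood s s0 Ns; have gt := Ngood t (le_trans s0 st) Nt.
split; first exact: (energy_nonincreasing X0left mv0 V0E gs gt st).
exact: le_lt_trans (energy_le_initial X0left mv0 V0E gs) V0_L2.
Qed.
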